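(* Let $p>1$, let $\mathcal G$ be a connected noncompact metric graph, and let $\mathrm H$ be a self-adjoint Hamiltonian on $\mathcal G$ having $k$ negative eigenvalues $\lambda_1\le\cdots\le\lambda_k<0$ (repeated according to multiplicity). Then, for all $\omega\in(0,-\lambda_k)$, the equation $\mathrm H\psi+\omega\psi+|\psi|^{p-1}\psi=0$ admits at least $k$ distinct $S^1$-orbits of solutions in $\mathcal D(Q_{\mathrm H})$ (the orbit of $u$ being $\{e^{i\theta}u:\theta\in[0,2\pi)\}$), all having a negative action level, i.e. $S_\omega<0$. Furthermore, if the matrices $\Lambda_v$ are real symmetric for all $v\in\mathcal V$, then these solutions can be chosen to be real-valued, yielding at least $k$ distinct pairs $\pm\psi_1,\dots,\pm\psi_k$.
   Context: Metric graph: $\mathcal G$ has a finite vertex set $\mathcal V$ and a finite edge set $\mathcal E=\mathcal E_{\mathrm{fin}}\cup\mathcal E_{\mathrm{inf}}$. Each $e\in\mathcal E_{\mathrm{fin}}$ is identified with $I_e=[0,L_e]$, $0<L_e<\infty$, with both endpoints attached to vertices; each $e\in\mathcal E_{\mathrm{inf}}$ is identified with $I_e=[0,\infty)$, with $0$ attached to a vertex. $\mathcal G$ is connected. Noncompact means $\mathcal E_{\mathrm{inf}}\ne\emptyset$. A function $\psi=(\psi_e)_{e\in\mathcal E}$ on $\mathcal G$ is a collection of functions $\psi_e:I_e\to\mathbb C$. $L^q(\mathcal G)=\bigoplus_e L^q(I_e)$ and $H^k(\mathcal G)=\bigoplus_e H^k(I_e)$ (edgewise, no vertex conditions imposed), with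 the natural norms; $\langle\psi,\phi\rangle_{L^2(\mathcal G)}=\mathrm{Re}\sum_e\int_{I_e}\psi_e\overline{\phi_e}\,dx$. Hamiltonian: for $v\in\mathcal V$ of degree $d_v$, $\Psi(v)\in\mathbb C^{d_v}$ is the vector of the values at $v$ of $\psi$ along the edges adjacent to $v$, and $\Psi'(v)\in\mathbb C^{d_v}$ the vector of derivatives at $v$ in the direction going out of $v$ into the edges. For each $v$ there are mutually orthogonal orthogonal projectors $P_{D,v},P_{N,v},P_{R,v}$ on $\mathbb C^{d_v}$ with $P_{D,v}+P_{N,v}+P_{R,v}=I$, and an invertible Hermitian matrix $\Lambda_v$ acting on the subspace $P_{R,v}\mathbb C^{d_v}$. The self-adjoint operator $\mathrm H$ is $\mathrm H\psi=(-\psi_e'')_e$ with domain $\{\psi\in H^2(\mathcal G): P_{D,v}\Psi(v)=0,\ P_{N,v}\Psi'(v)=0,\ P_{R,v}\Psi'(v)=\Lambda_vP_{R,v}\Psi(v)\ \forall v\in\mathcal V\}$. Its quadratic form is $Q_{\mathrm H}(\psi)=\|\psi'\|_{L^2(\mathcal G)}^2+\sum_{v}\langle\Lambda_vP_{R,v}\Psi(v),P_{R,v}\Psi(v)\rangle_{\mathbb C^{d_v}}$ on $\mathcal D(Q_{\mathrm H})=\{\psi\in H^1(\mathcal G):P_{D,v}\Psi(v)=0\ \forall v\}$. Energy and action: $E_{\mathrm H}(\psi)=\frac12Q_{\mathrm H}(\psi)+\frac1{p+1}\|\psi\|_{L^{p+1}(\mathcal G)}^{p+1}$ and $S_\omega(\psi)=E_{\mathrm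 H}(\psi)+\frac\omega2\|\psi\|_{L^2(\mathcal G)}^2$ for $\psi\in\mathcal D(Q_{\mathrm H})$. Solutions in $\mathcal D(Q_{\mathrm H})$ of the equation are exactly the critical points of $S_\omega$ on $\mathcal D(Q_{\mathrm H})$.
   Formalization: In the ''Furthermore'' part the projectors P_D, P_N, P_R are required to be real as well as the matrices Λ_v; with only Λ_v real the claim fails, e.g. for a vertex condition f(0+)=i f(0−), f'(0+)=i f'(0−), which forces every real solution to vanish. *)

(* Defs.v *)
From HB Require Import structures.
From mathcomp Require Import all_boot all_order all_algebra.
From mathcomp Require Import complex.
From mathcomp Require Import all_classical all_reals all_analysis.

Set Implicit Arguments.
Unset Strict Implicit.
Unset Printing Implicit Defensive.

Import Order.TTheory GRing.Theory Num.Theory.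
Import numFieldNormedType.Exports.

Local Open Scope classical_set_scope.
Local Open Scope ring_scope.
Local Open Scope complex_scope.
Local Open Scope sesquilinear_scope.

(* Notation for the two components of z : R[i] as elements of R; MathComp's
   'Re and 'Im are valued in R[i]. *)
Notation reC := (@complex.Re _).
Notation imC := (@complex.Im _).
Notation absC := (@Normc.normc _).

(** Metric graphs *)

(* Loops and multiple edges are allowed. [ends e false] and [ends e true] are
   the vertices to which the points 0 and [len e] of the finite edge [e] are
   attached; [root e] is the vertex to which the point 0 of the half-line [e]
   is attached. *)
Record metric_graph (R : realType) := MetricGraph {
  vertex : finType;
  fin_edge : finType;
  inf_edge : finType;
  len : fin_edge -> R;
  len_gt0 : forall e, 0 < len e;
  ends : fin_edge -> bool -> vertex;
  root : inf_edge -> vertex }.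

Section MetricGraph.
Variables (R : realType) (G : metric_graph R).

Definition edge : finType := (fin_edge G + inf_edge G)%type.

Definition edge_dom (e : edge) : set R :=
  match e with
  | inl f => `[0, len f]
  | inr _ => `[0, +oo[
  end.

Definition noncompact_graph : Prop := (0 < #|inf_edge G|)%N.

Definition adjacent_vertices : rel (vertex G) :=
  fun v w => [exists e : fin_edge G, exists b : bool,
    (ends e b == v) && (ends e (~~ b) == w)].

Definition connected_graph : Prop :=
  forall v w : vertex G, connect adjacent_vertices v w.

(* Incidences of edges with vertices. The degree of a vertex counts
   incidences, so that a loop contributes 2. *)
Definition edge_end : finType := (fin_edge G * bool + inf_edge G)%type.

Definition end_vertex (a : edge_end) : vertex G :=
  match a with
  | inl (e, b) => ends e b
  | inr e => root e
  end.

Definition ends_at (v : vertex G) : {set edge_end} :=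
  [set a | end_vertex a == v]%SET.

Definition degree (v : vertex G) : nat := #|ends_at v|.

(** Functions on a metric graph *)

(* Only the values of [psi e] on [edge_dom e] are meaningful: functions on the
   graph are to be compared with [eq_on_graph]. *)
Definition graph_fun : Type := edge -> R -> R[i].

Definition eq_on_graph (psi phi : graph_fun) : Prop :=
  forall e x, edge_dom e x -> psi e x = phi e x.

(* The function read from the given edge end: [along psi a t] is the value of
   [psi] at the point of the edge at distance [t] from that end. *)
Definition along (psi : graph_fun) (a : edge_end) (t : R) : R[i] :=
  match a with
  | inl (e, false) => psi (inl e) t
  | inl (e, true) => psi (inl e) (len e - t)
  | inr e => psi (inr e) t
  end.

Definition out_deriv (f : R -> R[i]) : R[i] :=
  lim (t^-1 * (reC (f t) - reC (f 0)) @[t --> 0^'+]) +i*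
  lim (t^-1 * (imC (f t) - imC (f 0)) @[t --> 0^'+]).

(* The vectors Psi(v) and Psi'(v). *)
Definition vvals (psi : graph_fun) (v : vertex G) : 'cV[R[i]]_(degree v) :=
  \col_(i < degree v) along psi (enum_val i) 0.

Definition vderivs (psi : graph_fun) (v : vertex G) : 'cV[R[i]]_(degree v) :=
  \col_(i < degree v) out_deriv (along psi (enum_val i)).

End MetricGraph.

(** Sobolev spaces on an interval *)

Section Sobolev.
Variable R : realType.
Notation mu := (@lebesgue_measure R).

Definition in_L2 (I : set R) (f : R -> R[i]) : Prop :=
  [/\ measurable_fun I (fun x => reC (f x)),
      measurable_fun I (fun x => imC (f x)) &
      (\int[mu]_(x in I) ((absC (f x)) ^+ 2)%:E < +oo)%E].

(* Compactly supported C^1 functions in the interior of I. *)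
Definition test_fun (I : set R) (phi : R -> R) : Prop :=
  [/\ forall x, derivable phi x 1,
      continuous (derive1 phi) &
      exists2 K : set R, compact K /\ K `<=` I° &
        forall x, ~ K x -> phi x = 0].

Definition real_weak_derivative (I : set R) (f g : R -> R) : Prop :=
  forall phi, test_fun I phi ->
    \int[mu]_(x in I) (f x * derive1 phi x) = - \int[mu]_(x in I) (g x * phi x).

Definition weak_derivative (I : set R) (f g : R -> R[i]) : Prop :=
  real_weak_derivative I (fun x => reC (f x)) (fun x => reC (g x)) /\
  real_weak_derivative I (fun x => imC (f x)) (fun x => imC (g x)).

Definition in_H1 (I : set R) (f : R -> R[i]) : Prop :=
  in_L2 I f /\ exists g, in_L2 I g /\ weak_derivative I f g.

(* A weak derivative of f : H^1(I); it is determined almost everywhere on I. *)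
Definition wderiv (I : set R) (f : R -> R[i]) : R -> R[i] :=
  xget (fun=> 0) [set g | in_L2 I g /\ weak_derivative I f g].

Definition in_H2 (I : set R) (f : R -> R[i]) : Prop :=
  in_H1 I f /\ in_H1 I (wderiv I f).

Definition continuous_on (I : set R) (f : R -> R[i]) : Prop :=
  {within I, continuous (fun x => reC (f x))} /\
  {within I, continuous (fun x => imC (f x))}.

End Sobolev.

Section GraphSobolev.
Variables (R : realType) (G : metric_graph R).
Notation mu := (@lebesgue_measure R).

(* Elements of H^1(G) and H^2(G) are given by their continuous representatives,
   so that their values at the vertices make sense pointwise; the
   representative of an H^2 function is C^1 up to the endpoints of the edges. *)
Definition graph_H1 (psi : graph_fun G) : Prop :=
  forall e, in_H1 (edge_dom e) (psi e) /\ continuous_on (edge_dom e) (psi e).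

Definition graph_H2 (psi : graph_fun G) : Prop :=
  forall e, in_H2 (edge_dom e) (psi e) /\ continuous_on (edge_dom e) (psi e).

Definition graph_deriv (psi : graph_fun G) : graph_fun G :=
  fun e => wderiv (edge_dom e) (psi e).

(* The q-th power of the norm of L^q(G). *)
Definition Lpow (q : R) (psi : graph_fun G) : R :=
  \sum_e \int[mu]_(x in edge_dom e) (absC (psi e x) `^ q).

Definition eq_ae (psi phi : graph_fun G) : Prop :=
  forall e, {ae mu, forall x, edge_dom e x -> psi e x = phi e x}.

End GraphSobolev.

(** Hamiltonians *)

Definition orth_projector (R : realType) (d : nat) (P : 'M[R[i]]_d) : Prop :=
  P *m P = P /\ P ^t* = P.

(* The Hermitian operator Lambda of the range of PR is represented by its
   extension by 0 to the orthogonal complement of that range. *)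
Record vertex_condition (R : realType) (d : nat) := VertexCondition {
  PD : 'M[R[i]]_d;
  PN : 'M[R[i]]_d;
  PR : 'M[R[i]]_d;
  Lam : 'M[R[i]]_d;
  PD_proj : orth_projector PD;
  PN_proj : orth_projector PN;
  PR_proj : orth_projector PR;
  PDN_orth : PD *m PN = 0;
  PDR_orth : PD *m PR = 0;
  PNR_orth : PN *m PR = 0;
  PDNR_sum : PD + PN + PR = 1%:M;
  Lam_range : PR *m Lam *m PR = Lam;
  Lam_herm : Lam ^t* = Lam;
  Lam_inv : exists M : 'M[R[i]]_d,
    [/\ PR *m M *m PR = M, Lam *m M = PR & M *m Lam = PR] }.

Definition hamiltonian (R : realType) (G : metric_graph R) : Type :=
  forall v : vertex G, vertex_condition R (degree v).

Section Hamiltonian.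
Variables (R : realType) (G : metric_graph R) (H : hamiltonian G).

Definition in_dom (psi : graph_fun G) : Prop :=
  graph_H2 psi /\
  forall v, [/\ PD (H v) *m vvals psi v = 0,
                PN (H v) *m vderivs psi v = 0 &
                PR (H v) *m vderivs psi v =
                  Lam (H v) *m (PR (H v) *m vvals psi v)].

(* The action of the operator H, on functions satisfying [in_dom]. *)
Definition ham_op (psi : graph_fun G) : graph_fun G :=
  fun e x => - graph_deriv (graph_deriv psi) e x.

Definition in_form_dom (psi : graph_fun G) : Prop :=
  graph_H1 psi /\ forall v, PD (H v) *m vvals psi v = 0.

Definition hdot (d : nat) (x y : 'cV[R[i]]_d) : R[i] :=
  \sum_i x i 0 * (y i 0)^*.

(* Lam being Hermitian, the vertex terms are real; reC only casts them. *)
Definition quad_form (psi : graph_fun G) : R :=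
  Lpow 2 (graph_deriv psi) +
  \sum_v reC (hdot (Lam (H v) *m (PR (H v) *m vvals psi v))
                   (PR (H v) *m vvals psi v)).

Definition energy (p : R) (psi : graph_fun G) : R :=
  2^-1 * quad_form psi + (p + 1)^-1 * Lpow (p + 1) psi.

Definition action_level (p omega : R) (psi : graph_fun G) : R :=
  energy p psi + omega / 2 * Lpow 2 psi.

(* H psi + omega psi + |psi|^(p-1) psi = 0, as an equation in L^2(G). *)
Definition solves (p omega : R) (psi : graph_fun G) : Prop :=
  in_dom psi /\
  eq_ae (fun e x => ham_op psi e x + omega%:C * psi e x
                    + (absC (psi e x) `^ (p - 1))%:C * psi e x)
        (fun _ _ => 0).

(** Eigenvalues with multiplicity *)

Definition ham_eigenspace (lam : R) (psi : graph_fun G) : Prop :=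
  in_dom psi /\ eq_ae (ham_op psi) (fun e x => lam%:C * psi e x).

Definition lin_comb (m : nat) (c : 'I_m -> R[i]) (phi : 'I_m -> graph_fun G) :
    graph_fun G :=
  fun e x => \sum_i c i * phi i e x.

(* The eigenspace of lam has complex dimension m (m = 0 when lam is not an
   eigenvalue): phi is a basis of it. *)
Definition has_multiplicity (lam : R) (m : nat) : Prop :=
  exists phi : 'I_m -> graph_fun G,
    [/\ forall i, ham_eigenspace lam (phi i),
        forall c, eq_on_graph (lin_comb c phi) (fun _ _ => 0) ->
          forall i, c i = 0 &
        forall psi, ham_eigenspace lam psi ->
          exists c, eq_on_graph psi (lin_comb c phi)].

(* lam_0 <= ... <= lam_(k-1) < 0 are all the negative eigenvalues of H, each
   one being repeated according to its multiplicity. *)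
Definition negative_eigenvalues (k : nat) (lam : 'I_k -> R) : Prop :=
  [/\ forall i j : 'I_k, (i <= j)%N -> lam i <= lam j,
      forall i, lam i < 0 &
      forall l : R, l < 0 -> has_multiplicity l #|[set i | lam i == l]%SET|].

End Hamiltonian.

Section Orbits.
Variables (R : realType) (G : metric_graph R).

Definition S1_orbit (u : graph_fun G) : set (graph_fun G) :=
  [set w | exists2 theta : R, 0 <= theta < 2 * pi &
    eq_on_graph w (fun e x => (cos theta +i* sin theta) * u e x)].

(* The pair {u, -u}. *)
Definition pm_pair (u : graph_fun G) : set (graph_fun G) :=
  [set w | eq_on_graph w u \/ eq_on_graph w (fun e x => - u e x)].

Definition real_valued (u : graph_fun G) : Prop :=
  forall e x, edge_dom e x -> imC (u e x) = 0.

End Orbits.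

Definition real_mx (R : realType) (d : nat) (M : 'M[R[i]]_d) : Prop :=
  forall i j, imC (M i j) = 0.

Definition real_symmetric (R : realType) (d : nat) (M : 'M[R[i]]_d) : Prop :=
  real_mx M /\ M^T = M.

(* The real case. It includes the reality of the projectors: without it the
   matrices Lam do not determine whether the operator commutes with complex
   conjugation (a condition such as f(0+) = i f(0-), f'(0+) = i f'(0-) at a
   vertex involves PD and PN only). *)
Definition real_hamiltonian (R : realType) (G : metric_graph R)
    (H : hamiltonian G) : Prop :=
  forall v, [/\ real_symmetric (Lam (H v)), real_mx (PD (H v)),
                real_mx (PN (H v)) & real_mx (PR (H v))].

(* Main.v *)
Require Import Defs.
From HB Require Import structures.
From mathcomp Require Import all_boot all_order all_algebra.
From mathcomp Require Import complex.
From mathcomp Require Import all_classical all_reals all_analysis.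
From mathcomp Require Import measurable_realfun.
From mathcomp Require Import ring lra zify.

(** The problem is reduced to finitely many variables. For prescribed values z
    at the edge ends, the equation has on every edge exactly one decaying
    solution with these end values: on a segment by a fixed point argument
    ([power_bvp]), on a half-line by an explicit formula ([halfline_solution]).
    As the nonlinearity is defocusing, the part of the action carried by the
    edges is convex, and this solution minimises it. The minimal action plus
    the vertex terms is a function J of z, with a gradient given by the outgoing
    slopes of the solution ([min_action_le]); the gradient depends continuously
    on z ([continuous_slope]), and J tends to infinity with z. A critical point
    of J on the space of the z with P_D z = 0 yields a solution of the equation
    with action J (z) ([critical_solves]).

    The critical points are counted with the Z/2 genus. If the critical orbits
    of negative level were fewer than k, say m, each of them would be detected
    by an odd map to a space of dimension d (the complex scalar product with a
    point of the orbit, d = 2; among real z the real scalar product, d = 1),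
    and deforming the sublevel sets along the gradient would give an odd map
    from a negative sublevel set to a space of dimension d m, without zeros
    ([genus_sublevel]). On the other hand the sublevel set contains a sphere of
    dimension d k - 1: on the span of the eigenfunctions the quadratic part of
    the action is negative because omega < - lambda_k, the nonlinear term is of
    higher order, and the vertex values of a function have at most the action of
    the function ([small_combo_action], [trace_sphere_negative]). This
    contradicts the theorem of Borsuk and Ulam ([borsuk_ulam]), which is proved
    by Fan's combinatorial argument on subdivided cross-polytopes.

    In the real case the real parts of the eigenfunctions are eigenfunctions
    too, and their real span has dimension at least k ([rank_real_part]); an
    orbit contains at most two real points, which differ by a sign.

    The spaces of the statement are defined by weak derivatives, and two facts
    connect them with the classical solutions used here: a classical solution
    that decays with its derivatives has these as weak derivatives
    ([edge_state_wderiv]), and an eigenfunction with a negative eigenvalue is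
    classical and decays exponentially ([eigen_classical]), by the lemma of
    du Bois-Reymond ([du_bois_reymond]). *)

Set Implicit Arguments.
Unset Strict Implicit.
Unset Printing Implicit Defensive.

Import Order.TTheory GRing.Theory Num.Theory.
Import numFieldNormedType.Exports.

Local Open Scope classical_set_scope.
Local Open Scope ring_scope.

(** * Subdivision of ordered simplices modulo 2 *)

Notation sum2 L f := (\big[addb/false]_(t <- L) f t).

Section Faces.
Variable T : Type.
Implicit Types (s t : seq T) (f : seq T -> bool).

Fixpoint faces s : seq (seq T) :=
  if s is x :: s' then s' :: map (cons x) (faces s') else [::].

Lemma sum2_flatten (L : seq (seq (seq T))) f :
  sum2 (flatten L) f = \big[addb/false]_(M <- L) sum2 M f.
Proof.
elim: L => [|M L IH] /=; first by rewrite !big_nil.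
by rewrite big_cat big_cons IH.
Qed.

Lemma sum2_faces_cons x s f :
  sum2 (faces (x :: s)) f = f s (+) sum2 (faces s) (fun t => f (x :: t)).
Proof. by rewrite /= big_cons big_map. Qed.

Lemma sum2_faces_faces s f :
  \big[addb/false]_(r <- faces s) sum2 (faces r) f = false.
Proof.
elim: s f => [|x s IH] f; first by rewrite big_nil.
rewrite (sum2_faces_cons x s (fun r => sum2 (faces r) f)).
under [X in _ (+) X]eq_bigr => r _ do rewrite sum2_faces_cons.
by rewrite big_split /= IH addbF addbb.
Qed.

Lemma sum2_faces_rcons s x f :
  sum2 (faces (rcons s x)) f = sum2 (faces s) (fun t => f (rcons t x)) (+) f s.
Proof.
elim: s f => [|y s IH] f; first by rewrite /= big_nil big_seq1.
by rewrite rcons_cons !sum2_faces_cons IH addbA.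
Qed.

End Faces.

Lemma faces_map (T U : Type) (g : T -> U) s :
  faces (map g s) = map (map g) (faces s).
Proof.
by elim: s => //= x s ->; congr (_ :: _); rewrite -!map_comp.
Qed.

Lemma size_faces (T : eqType) (s t : seq T) :
  t \in faces s -> size s = (size t).+1.
Proof.
elim: s t => //= x s IH t; rewrite inE => /predU1P[-> //|/mapP[r rs ->]] /=.
by rewrite (IH _ rs).
Qed.

Lemma faces_subseq (T : eqType) (s t : seq T) : t \in faces s -> subseq t s.
Proof.
elim: s t => //= x s IH t; rewrite inE => /predU1P[->|/mapP[r rs ->]].
  exact: subseq_cons.
by rewrite /= eqxx IH.
Qed.

Lemma sum2_faces_rem (T : eqType) (s : seq T) (f : seq T -> bool) :
  (forall t u, perm_eq t u -> f t = f u) ->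
  sum2 (faces s) f = \big[addb/false]_(x <- s) f (rem x s).
Proof.
elim: s f => [|x s IH] f fP; first by rewrite !big_nil.
rewrite sum2_faces_cons big_cons /= eqxx IH; last first.
  by move=> t u tu; apply: fP; rewrite perm_cons.
congr (_ (+) _); rewrite !big_seq; apply: eq_bigr => y ys.
case: eqP => // xy; apply: fP; rewrite xy perm_sym.
exact: perm_to_rem.
Qed.

Lemma sum2_faces_perm (T : eqType) (s t : seq T) (f : seq T -> bool) :
  (forall t u, perm_eq t u -> f t = f u) -> perm_eq s t ->
  sum2 (faces s) f = sum2 (faces t) f.
Proof.
move=> fP st; rewrite !sum2_faces_rem // (perm_big _ st) /= !big_seq.
apply: eq_bigr => x xt; apply: fP; rewrite -(perm_cons x).
have xs : x \in s by rewrite (perm_mem st).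
rewrite -(permPl (perm_to_rem xs)) (permPl st).
exact: perm_to_rem.
Qed.

Section Barycentric.
Variables (R : realType) (V : normedModType R).
Implicit Types (s t : seq V) (f : seq V -> bool).

Definition barycenter s : V := (size s)%:R^-1 *: \sum_(x <- s) x.

(* The first argument is the number of vertices of the simplex. *)
Fixpoint subdivide n s : seq (seq V) :=
  if n is n'.+1 then
    map (cons (barycenter s)) (flatten (map (subdivide n') (faces s)))
  else [:: [::]].

Lemma sum2_subdivideS n s f :
  sum2 (subdivide n.+1 s) f = \big[addb/false]_(r <- faces s)
     sum2 (subdivide n r) (fun t => f (barycenter s :: t)).
Proof. by rewrite /= big_map sum2_flatten big_map. Qed.

(** The subdivision is a cone, from the barycenter, over the subdivided
    boundary. The boundary of a cone is its base together with the cone over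
    the boundary of the base, and the boundary of a boundary vanishes. *)
Lemma sum2_faces_subdivide n s f : size s = n ->
  \big[addb/false]_(t <- subdivide n s) sum2 (faces t) f =
  \big[addb/false]_(r <- faces s) sum2 (subdivide n.-1 r) f.
Proof.
elim: n s f => [|n IH] s f sn.
  by rewrite big_seq1 (size0nil sn) !big_nil.
rewrite (sum2_subdivideS n s (fun t => sum2 (faces t) f)).
under eq_bigr => r _ do under eq_bigr => t _ do rewrite sum2_faces_cons.
under eq_bigr => r _ do rewrite big_split /=.
rewrite big_split /= [X in _ (+) X](_ : _ = false) ?addbF //.
rewrite big_seq.
under eq_bigr => r rs.
  rewrite IH; last by have := size_faces rs; rewrite sn => -[].
  over.
by rewrite -big_seq sum2_faces_faces.
Qed.

Lemma size_subdivide n s t : t \in subdivide n s -> size t = n.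
Proof.
elim: n s t => [|n IH] s t /=; first by rewrite inE => /eqP->.
by move=> /mapP[r /flattenP[L /mapP[u _ ->] ru] ->] /=; rewrite (IH _ _ ru).
Qed.

Lemma barycenterN s : barycenter (map -%R s) = - barycenter s.
Proof. by rewrite /barycenter size_map big_map sumrN scalerN. Qed.

Lemma subdivideN n s : subdivide n (map -%R s) = map (map -%R) (subdivide n s).
Proof.
elim: n s => [//|n IH] s /=.
rewrite faces_map -!map_comp barycenterN.
rewrite (@eq_map _ _ _ (map (map -%R) \o subdivide n)); last first.
  by move=> r /=; rewrite IH.
by rewrite map_comp -map_flatten -!map_comp.
Qed.

(** Used to keep the vertices of the subdivisions in a ball and in a
    hyperplane. *)
Lemma subdivide_ind (P : V -> Prop) n s t :
  (forall u, u != [::] -> {in u, forall x, P x} -> P (barycenter u)) ->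
  size s = n -> t \in subdivide n s -> {in s, forall x, P x} ->
  {in t, forall x, P x}.
Proof.
move=> PB; elim: n s t => [|n IH] s t sn /=; first by rewrite inE => /eqP->.
move=> /mapP[r /flattenP[L /mapP[u us ->] ru] ->] Ps x.
rewrite inE => /predU1P[->|xr].
  by apply: PB => //; rewrite -size_eq0 sn.
apply: IH ru _ _ xr; first by have := size_faces us; rewrite sn => -[].
by move=> y yu; apply: Ps; apply: (mem_subseq (faces_subseq us)).
Qed.

Lemma barycenterB s (c : V) : s != [::] ->
  barycenter s - c = (size s)%:R^-1 *: \sum_(x <- s) (x - c).
Proof.
move=> s0; rewrite big_split /= scalerDr; congr (_ + _).
have : (size s)%:R != 0 :> R by rewrite pnatr_eq0 size_eq0.
move=> sR; rewrite big_const_seq count_predT iter_addr_0 -[- c *+ _]scaler_nat scalerA.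
by rewrite mulVf // scale1r.
Qed.

Lemma barycenter_ball (c : V) (r : R) s : s != [::] ->
  {in s, forall x, `|x - c| <= r} -> `|barycenter s - c| <= r.
Proof.
move=> s0 sr; rewrite barycenterB // normrZ gtr0_norm ?invr_gt0 ?ltr0n; last first.
  by rewrite lt0n size_eq0.
rewrite ler_pdivrMl; last by rewrite ltr0n lt0n size_eq0.
apply: le_trans (ler_norm_sum _ _ _) _; rewrite big_seq.
apply: le_trans (ler_sum _ sr) _.
by rewrite -big_seq big_const_seq count_predT iter_addr_0 mulr_natl.
Qed.

Definition diam_le (d : R) s := {in s &, forall x y, `|x - y| <= d}.

Lemma barycenter_diam N (d : R) s : (size s <= N.+1)%N -> 0 <= d -> diam_le d s ->
  {in s, forall x, `|x - barycenter s| <= N%:R / N.+1%:R * d}.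
Proof.
move=> sN d0 sd x xs.
have s0 : s != [::] by apply: contraTneq xs => ->.
have sR : 0 < (size s)%:R :> R by rewrite ltr0n lt0n size_eq0.
rewrite distrC barycenterB // normrZ gtr0_norm ?invr_gt0 // ler_pdivrMl //.
rewrite (perm_big _ (perm_to_rem xs)) big_cons /= subrr add0r.
apply: le_trans (ler_norm_sum _ _ _) _; rewrite big_seq.
have H y : y \in rem x s -> `|y - x| <= d.
  by move=> /mem_rem ys; apply: sd.
apply: le_trans (ler_sum _ H) _.
rewrite -big_seq big_const_seq count_predT iter_addr_0 size_rem // -[d *+ _]mulr_natl.
rewrite mulrA; apply: ler_wpM2r => //.
rewrite mulrA ler_pdivlMr // -!natrM ler_nat.
by case: (size s) sN => // n nN /=; rewrite !mulnS; lia.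
Qed.

Lemma subdivide_diam N (d : R) n s t : (n <= N.+1)%N -> size s = n -> 0 <= d ->
  diam_le d s -> t \in subdivide n s -> diam_le (N%:R / N.+1%:R * d) t.
Proof.
move=> nN sn d0; elim: n s t nN sn => [|n IH] s t nN sn sd.
  by rewrite inE => /eqP->.
have cd0 : 0 <= N%:R / N.+1%:R * d by rewrite !mulr_ge0.
move=> /mapP[r /flattenP[L /mapP[u us ->] ru] ->].
have un : size u = n by have := size_faces us; rewrite sn => -[].
have usub x : x \in u -> x \in s by exact: (mem_subseq (faces_subseq us)).
have bd : {in r, forall x, `|x - barycenter s| <= N%:R / N.+1%:R * d}.
  apply: (subdivide_ind _ un ru) => [v|x /usub]; first exact: barycenter_ball.
  by apply: barycenter_diam; rewrite ?sn.
move=> x y; rewrite !inE => /predU1P[->|xr] /predU1P[->|yr].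
- by rewrite subrr normr0.
- by rewrite distrC bd.
- exact: bd.
- apply: (IH u r) => //; first exact: leq_trans (leqnSn _) nN.
  by move=> a b /usub ? /usub ?; apply: sd.
Qed.

End Barycentric.

(** * Alternating simplices *)

Fixpoint alternates (b : bool) (s : seq bool) : bool :=
  if s is c :: s' then (b == c) && alternates (~~ b) s' else true.

Lemma sum2_faces_alternates b s :
  sum2 (faces s) (alternates b) = alternates true s (+) alternates false s.
Proof.
elim: s b => [|c s IH] b; first by rewrite big_nil.
rewrite sum2_faces_cons /=; case: b c => [] []; rewrite /= ?IH ?big1_eq ?addbF //.
- by rewrite addbA addbb.
- by rewrite addbC -addbA addbb addbF.
Qed.

Lemma alternates_negb b s : alternates b (map negb s) = alternates (~~ b) s.
Proof. by elim: s b => //= c s IH b; rewrite IH; case: b c => [] []. Qed.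

(* Labels: [2 j] and [2 j + 1] are the two opposite labels of index [j]. *)
Definition flip_label (n : nat) : nat := if odd n then n.-1 else n.+1.

Lemma flip_label_double i (b : bool) : flip_label (i.*2 + b) = i.*2 + ~~ b.
Proof. by rewrite /flip_label oddD odd_double /=; case: b => /=; lia. Qed.

Lemma double_label_inj i j (b c : bool) : i.*2 + b = j.*2 + c -> i = j /\ b = c.
Proof. by case: b; case: c => /= E; split => //; lia. Qed.

Definition alt_labels (b : bool) (l : seq nat) : bool :=
  alternates b (map odd (sort leq l)).

Lemma alt_labels_perm b l m : perm_eq l m -> alt_labels b l = alt_labels b m.
Proof.
by rewrite /alt_labels => /(perm_sortP leq_total leq_trans anti_leq) ->.
Qed.

Lemma sum2_faces_alt_labels b l :
  sum2 (faces l) (alt_labels b) = alt_labels true l (+) alt_labels false l.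
Proof.
rewrite (@sum2_faces_perm _ l (sort leq l)); last 2 first.
- exact: alt_labels_perm.
- by rewrite perm_sym perm_sort.
rewrite -(sum2_faces_alternates b) faces_map big_map !big_seq.
apply: eq_bigr => r /faces_subseq rl; rewrite /alt_labels sorted_sort //.
  exact: leq_trans.
exact: (subseq_sorted leq_trans rl (sort_sorted leq_total l)).
Qed.

Lemma alt_labels_flip l : {in l &, forall x y, y != flip_label x} ->
  alt_labels true (map flip_label l) = alt_labels false l.
Proof.
move=> lN; rewrite /alt_labels.
have -> : sort leq (map flip_label l) = map flip_label (sort leq l).
  rewrite -[RHS](@sorted_sort _ leq); first last.
  - rewrite sorted_map; apply: (@sub_in_sorted _ (mem l) leq).
    + move=> x y xl yl /= xy; have := lN x y xl yl; rewrite /flip_label.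
      have [->|xNy] := eqVneq x y; first by [].
      case: ifP => ox; case: ifP => oy; lia.
    + by apply/allP => x; rewrite mem_sort.
    + exact: sort_sorted leq_total _.
  - exact: leq_trans.
  apply/(perm_sortP leq_total leq_trans anti_leq).
  by apply: perm_map; rewrite perm_sym perm_sort.
rewrite -map_comp (@eq_map _ _ _ (negb \o odd)); last first.
  by move=> n /=; rewrite /flip_label; case: ifP => [|/negbT] on /=; lia.
by rewrite map_comp alternates_negb.
Qed.

Lemma alternates_size x k l m : sorted leq (x :: l) ->
  {in x :: l &, forall x y, y != flip_label x} ->
  alternates (~~ odd x) (map odd l) -> (k <= x./2)%N ->
  {in x :: l, forall x, (x./2 < m)%N} -> (size l + k < m)%N.
Proof.
elim: l x k => [|y l IH] x k /=.
  by move=> _ _ _ kx xm; rewrite add0n; apply: leq_ltn_trans kx (xm x (mem_head _ _)).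
move=> /andP[xy yl] N /andP[/eqP oxy la] kx lm.
have Nxy : y != flip_label x by apply: N; rewrite !inE eqxx ?orbT.
have xy2 : (x./2 < y./2)%N.
  by move: Nxy oxy xy; rewrite /flip_label; case: ifP => ox; lia.
rewrite addSnnS; apply: (IH y) => //.
- by move=> a b aa bb; apply: N; rewrite in_cons ?aa ?bb orbT.
- by rewrite -oxy.
- exact: leq_ltn_trans kx xy2.
- by move=> a al; apply: lm; rewrite in_cons al orbT.
Qed.

(** Two consecutive labels of opposite parity cannot have the same index,
    since they would be opposite; hence the indices increase strictly. *)
Lemma alt_labels_size b l m : {in l &, forall x y, y != flip_label x} ->
  alt_labels b l -> {in l, forall x, (x./2 < m)%N} -> (size l <= m)%N.
Proof.
rewrite /alt_labels => lN la lm.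
rewrite -(size_sort leq l).
have {lN}: {in sort leq l &, forall x y, y != flip_label x}.
  by move=> x y; rewrite !mem_sort; exact: lN.
have {lm}: {in sort leq l, forall x, (x./2 < m)%N}.
  by move=> x; rewrite mem_sort; exact: lm.
have := sort_sorted leq_total l; move: (sort leq l) la => {}l.
case: l => // x l /= /andP[/eqP bx la] ls lm lN.
have := @alternates_size x 0 l m ls lN; rewrite -bx addn0; exact.
Qed.

(** * The Borsuk-Ulam theorem *)

Lemma uniform_continuity_on_bounded (R : realType) n (W : normedModType R)
    (f : 'rV[R]_n -> W) (M e : R) : continuous f -> 0 < e ->
  exists2 d, 0 < d & forall x y, `|x| <= M -> `|x - y| <= d -> `|f x - f y| < e.
Proof.
move=> cf e0; pose A := [set x : 'rV[R]_n | `|x| <= M].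
have cA : compact A.
  apply: bounded_closed_compact; first exists M.
    by split; [exact: num_real|move=> r Mr x /= /le_trans; apply; exact: ltW].
  apply: (@closed_comp _ _ (fun x : 'rV[R]_n => `|x|) [set r : R | r <= M]).
    by move=> x _; exact: norm_continuous.
  exact: closed_le.
have NC := (@compact_near_coveringP _ A).1 cA.
have {NC}H := NC _ (at_right (0 : R))
  (fun d x => forall y, `|x - y| <= d -> `|f x - f y| < e) _.
have {}H : \forall d \near (0 : R)^'+, A `<=` (fun x => forall y, `|x - y| <= d -> `|f x - f y| < e).
  apply: H => x Ax.
  have /cvgrPdist_lt/(_ (e / 2)) := cf x; rewrite divr_gt0// => /(_ isT).
  move=> /nbhs_ballP[r /= r0 fr].
  exists (ball x (r / 2), [set d : R | 0 < d < r / 2]); first split => /=.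
  + by apply: nbhsx_ballx; rewrite divr_gt0.
  + near=> d; apply/andP; split; near: d; first exact: nbhs_right_gt.
    by apply: nbhs_right_lt; rewrite divr_gt0.
  + move=> -[x' d] [/= xx' /andP[d0 dr]] y x'y.
    have H : `|f x - f x'| < e / 2.
      by apply: fr; apply: le_ball xx'; rewrite ler_pdivrMr // ler_peMr ?ltW // ltr1n.
    have H' : `|f x - f y| < e / 2.
      apply: fr; rewrite [r]splitr; apply: ball_triangle xx' _.
      by rewrite -ball_normE /=; apply: le_lt_trans x'y dr.
    rewrite -(subrK (f x) (f x')) -addrA (le_lt_trans (ler_normD _ _)) //.
    by rewrite [e]splitr ltrD // distrC.
have [d [Hd d0]] := filter_ex (filterI H (nbhs_right_gt (0 : R))).
by exists d => // x y /Hd; apply.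
Unshelve. all: by end_near. Qed.

Section BorsukUlam.
Variable R : realType.

Section Spheres.
Variable N : nat.
Notation V := 'rV[R]_N.+1.

Definition basis_row (i : nat) : V := delta_mx 0 (inord i).

(** The boundary of the cross-polytope of dimension [d], as the list of its
    oriented top faces; the empty face when [d = 0]. *)
Fixpoint cross_faces d : seq (seq V) :=
  if d is d'.+1 then
    map (rcons^~ (basis_row d')) (cross_faces d') ++
    map (rcons^~ (- basis_row d')) (cross_faces d')
  else [:: [::]].

Lemma cross_facesN d f :
  sum2 (cross_faces d) f = sum2 (cross_faces d) (fun s => f (map -%R s)).
Proof.
elim: d f => [|d IH] f; first by rewrite !big_seq1.
rewrite /= !big_cat !big_map /= addbC; congr (_ (+) _); rewrite IH;
  by apply: eq_bigr => s _; rewrite map_rcons ?opprK.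
Qed.

Lemma faces_cross_faces d f :
  \big[addb/false]_(s <- cross_faces d) sum2 (faces s) f = false.
Proof.
elim: d f => [|d IH] f; first by rewrite big_seq1 big_nil.
rewrite /= big_cat !big_map /=.
under eq_bigr => s _ do rewrite sum2_faces_rcons.
under [X in _ (+) X]eq_bigr => s _ do rewrite sum2_faces_rcons.
by rewrite !big_split /= !(IH (fun t => f (rcons t _))) !addFb addbb.
Qed.

Fixpoint subdivisions k (L : seq (seq V)) : seq (seq V) :=
  if k is k'.+1 then
    flatten (map (fun s => subdivide (size s) s) (subdivisions k' L))
  else L.

(* On the right, the simplices of [subdivisions k L] are the ones of which the
   boundary is taken, and [g] counts the subdivided faces. *)
Lemma sum2_faces_subdivisions k (L M : seq (seq V)) :
  (forall f, \big[addb/false]_(s <- L) sum2 (faces s) f = sum2 M f) ->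
  forall f, \big[addb/false]_(s <- subdivisions k L) sum2 (faces s) f =
  sum2 (subdivisions k M) f.
Proof.
move=> LM; elim: k => //= k IH f.
rewrite !sum2_flatten !big_map.
under eq_bigr => s _ do rewrite (sum2_faces_subdivide _ (erefl (size s))).
rewrite -(IH (fun s => sum2 (subdivide (size s) s) f)).
apply: eq_bigr => s _; rewrite !big_seq; apply: eq_bigr => t ts.
by rewrite (size_faces ts).
Qed.

Lemma sum2_subdivisions_cat k L M f :
  sum2 (subdivisions k (L ++ M)) f =
  sum2 (subdivisions k L) f (+) sum2 (subdivisions k M) f.
Proof.
elim: k f => [|k IH] f; first by rewrite big_cat.
by rewrite /= !sum2_flatten !big_map IH.
Qed.

Lemma eq_sum2_subdivisions k L M :
  (forall f, sum2 L f = sum2 M f) -> forall f,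
  sum2 (subdivisions k L) f = sum2 (subdivisions k M) f.
Proof.
by move=> LM; elim: k => //= k IH f; rewrite !sum2_flatten !big_map IH.
Qed.

Lemma subdivisionsN k L :
  subdivisions k (map (map -%R) L) = map (map -%R) (subdivisions k L).
Proof.
elim: k => //= k ->; rewrite map_flatten -!map_comp; congr flatten.
by apply: eq_map => s /=; rewrite size_map subdivideN.
Qed.

Variables (k : nat) (lab : V -> nat).

Definition alt_count d : bool :=
  sum2 (subdivisions k (cross_faces d)) (fun s => alt_labels true (map lab s)).

(** Fan's parity argument: the number of positively alternating simplices of
    the [d]-sphere is odd, by induction on [d]. A hemisphere has the
    [(d-1)]-sphere as boundary, and by antipodality the alternating simplices
    of both signs of the hemisphere are counted by the positive ones of the
    sphere. *)
Lemma alt_count_odd d :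
  (forall e s, (e <= d)%N -> s \in subdivisions k (cross_faces e) ->
     {in s, forall x, lab (- x) = flip_label (lab x)} /\
     {in s &, forall x y, lab y != flip_label (lab x)}) ->
  alt_count d.
Proof.
elim: d => [|d IH] labP; rewrite /alt_count.
  suff -> : subdivisions k (cross_faces 0) = [:: [::]] by rewrite big_seq1.
  by elim: k => //= k' ->.
pose H := map (rcons^~ (basis_row d)) (cross_faces d).
rewrite (@eq_sum2_subdivisions _ _ (H ++ map (map -%R) H)); last first.
  move=> f; rewrite /= !big_cat; congr (_ (+) _); rewrite !big_map.
  rewrite (cross_facesN d (fun s => f (rcons s _))).
  by apply: eq_bigr => s _; rewrite map_rcons.
rewrite sum2_subdivisions_cat subdivisionsN big_map -big_split /=.
have HS s : s \in subdivisions k H -> s \in subdivisions k (cross_faces d.+1).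
  have: {subset H <= cross_faces d.+1}.
    by move=> t; rewrite /= mem_cat => ->.
  move: (cross_faces d.+1) => L HL; elim: k s => [|k' IH'] s; first exact: HL.
  move=> /flattenP[M /mapP[t tk ->]] st; apply/flattenP.
  by exists (subdivide (size t) t) => //; apply/mapP; exists t => //; apply: IH'.
rewrite big_seq; under eq_bigr => s sH.
  rewrite (_ : map lab (map -%R s) = map flip_label (map lab s)); last first.
    rewrite -!map_comp; apply/eq_in_map => x xs /=.
    exact: (labP _ _ (leqnn _) (HS _ sH)).1.
  rewrite (@alt_labels_flip (map lab s)); last first.
    move=> _ _ /mapP[x xs ->] /mapP[y ys ->].
    exact: (labP _ _ (leqnn _) (HS _ sH)).2.
  rewrite -(sum2_faces_alt_labels true) faces_map big_map.
  over.
rewrite -big_seq.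
rewrite (@sum2_faces_subdivisions _ _ (cross_faces d)).
  by apply: IH => e s ed; apply: labP; rewrite ltnW.
move=> f.
rewrite /H big_map; under eq_bigr => s _ do rewrite sum2_faces_rcons.
by rewrite big_split /= (faces_cross_faces d (fun t => f (rcons t _))).
Qed.

End Spheres.

Lemma coord_le_norm n (x : 'rV[R]_n) i : `|x 0 i| <= `|x|.
Proof.
rewrite [leRHS](mx_normrE x); apply/bigmax_geP; right => /=.
by exists (0, i).
Qed.

Lemma norm_le_coord n (x : 'rV[R]_n) c :
  0 <= c -> (forall i, `|x 0 i| <= c) -> `|x| <= c.
Proof.
move=> c0 xc; rewrite [leLHS](mx_normrE x); apply/bigmax_leP; split=> //.
by move=> [i j] _ /=; rewrite ord1.
Qed.

Lemma norm_basis_row n i : `|basis_row n i| <= 1.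
Proof.
apply: norm_le_coord => // j.
by rewrite mxE; case: (_ && _); rewrite ?normr1 ?normr0.
Qed.

(** The top faces of the cross-polytope lie in hyperplanes away from 0. *)
Definition in_cross_hyperplane n (s : seq 'rV[R]_n.+1) :=
  exists2 l : 'I_n.+1 -> R, forall i, `|l i| <= 1 &
  {in s, forall x : 'rV[R]_n.+1, \sum_i l i * x 0 i = 1}.

Lemma cross_faces_props n e s : (e <= n.+1)%N -> s \in cross_faces n e ->
  [/\ size s = e, {in s, forall x, `|x| <= 1} & in_cross_hyperplane s].
Proof.
suff H : (e <= n.+1)%N -> s \in cross_faces n e ->
  [/\ size s = e, {in s, forall x, `|x| <= 1},
     {in s, forall (x : 'rV[R]_n.+1) (i : 'I_n.+1), (e <= i)%N -> x 0 i = 0}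
  & in_cross_hyperplane s].
  by move=> en se; have [] := H en se.
elim: e s => [|e IH] s /= en.
  rewrite inE => /eqP->; split=> //; exists (fun=> 0) => // i.
  by rewrite normr0.
have ee : (inord e : 'I_n.+1) = e :> nat by rewrite inordK.
have main t (c : R) : `|c| = 1 -> t \in cross_faces n e ->
  [/\ size (rcons t (c *: basis_row n e)) = e.+1,
     {in rcons t (c *: basis_row n e), forall x, `|x| <= 1},
     {in rcons t (c *: basis_row n e), forall (x : 'rV[R]_n.+1) (i : 'I_n.+1), (e < i)%N -> x 0 i = 0}
  & in_cross_hyperplane (rcons t (c *: basis_row n e))].
  move=> c1 /(IH _ (ltnW en)) [st t1 t0 [l l1 lt]]; split.
  - by rewrite size_rcons st.
  - move=> x; rewrite mem_rcons inE => /predU1P[->|/t1 //].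
    by rewrite normrZ c1 mul1r norm_basis_row.
  - move=> x; rewrite mem_rcons inE => /predU1P[-> i ei|xt i ei].
      rewrite !mxE eqxx /= (_ : (i == inord e) = false) ?mulr0 //.
      by apply/negbTE/eqP => /(congr1 val) /=; rewrite ee => ie; rewrite ie ltnn in ei.
    by apply: t0 => //; exact: ltnW.
  - exists (fun i => if i == inord e then c else l i) => [i|].
      by case: ifP => _ //; rewrite c1.
    move=> x; rewrite mem_rcons inE => /predU1P[->|xt].
      rewrite (bigD1 (inord e)) //= eqxx !mxE !eqxx /= mulr1 big1 ?addr0.
        by rewrite -expr2 -real_normK ?num_real // c1 expr1n.
      by move=> i /negbTE ie; rewrite !mxE eqxx ie /= !mulr0.
    rewrite -(lt x xt); apply: eq_bigr => i _; case: ifP => // /eqP ->.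
    by rewrite (t0 x xt) ?ee // !mulr0.
rewrite mem_cat => /orP[] /mapP[t ts ->].
  by have := main t 1 (normr1 _) ts; rewrite scale1r.
by have := main t (-1) (normrN1 _) ts; rewrite scaleN1r.
Qed.

Lemma subdivisions_props n k e s : (e <= n.+1)%N ->
  s \in subdivisions k (cross_faces n e) ->
  [/\ size s = e, {in s, forall x, `|x| <= 1}, in_cross_hyperplane s
    & diam_le ((n%:R / n.+1%:R) ^+ k * 2) s].
Proof.
move=> en; elim: k s => [|k IH] s.
  move=> /(cross_faces_props en)[se s1 ls]; split=> // x y xs ys.
  rewrite expr0 mul1r (le_trans (ler_normB _ _)) // [2](_ : _ = 1 + 1) //.
  by rewrite lerD // s1.
move=> /= /flattenP[M /mapP[t tk ->]] st.
have [te t1 [l l1 lt] td] := IH t tk.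
split.
- by rewrite (size_subdivide st).
- have := subdivide_ind (P := fun x => `|x - 0| <= 1) _ (erefl _) st.
  move=> H x xs; rewrite -[x]subr0; apply: H xs => [u u0 uP|y yt].
    exact: barycenter_ball.
  by rewrite subr0 t1.
- exists l => //; apply: (subdivide_ind _ (erefl _) st) => // u u0 uP.
  under eq_bigr => i _.
    rewrite mxE summxE mulrCA mulr_sumr; over.
  rewrite -mulr_sumr exchange_big /= big_seq (eq_bigr (fun=> 1)) //.
  rewrite -big_seq big_const_seq count_predT iter_addr_0.
  by rewrite mulVf // pnatr_eq0 size_eq0.
- rewrite exprS -mulrA; apply: subdivide_diam st => //; rewrite ?te //.
Qed.

Lemma shell_compact n : compact [set x : 'rV[R]_n.+1 | n.+1%:R^-1 <= `|x| <= 1].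
Proof.
set A := [set _ | _].
apply: bounded_closed_compact.
  exists 1; split; first exact: num_real.
  by move=> r r1 x /= /andP[_ /le_trans]; apply; exact: ltW.
rewrite (_ : A = [set x : 'rV[R]_n.+1 | n.+1%:R^-1 <= `|x|] `&` [set x : 'rV[R]_n.+1 | `|x| <= 1]); last first.
  by apply/seteqP; split => x /=; [move/andP|move=> H; apply/andP].
apply: closedI.
  apply: (@closed_comp _ _ (fun x : 'rV[R]_n.+1 => `|x|) [set r : R | n.+1%:R^-1 <= r]).
    by move=> x _; exact: norm_continuous.
  exact: closed_ge.
apply: (@closed_comp _ _ (fun x : 'rV[R]_n.+1 => `|x|) [set r : R | r <= 1]).
  by move=> x _; exact: norm_continuous.
exact: closed_le.
Qed.

(** If an odd map to a space of smaller dimension did not vanish, label each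
    point by a large coordinate of its value and the sign of that coordinate:
    on a fine subdivision opposite labels are never adjacent, while an
    alternating simplex would need more labels than there are coordinates. *)
Theorem borsuk_ulam n m (f : 'rV[R]_n.+1 -> 'rV[R]_m) : continuous f ->
  (forall x, f (- x) = - f x) ->
  (forall x, n.+1%:R^-1 <= `|x| <= 1 -> f x != 0) -> (n < m)%N.
Proof.
move=> cf fN f0.
pose A := [set x : 'rV[R]_n.+1 | n.+1%:R^-1 <= `|x| <= 1].
have cA : compact A := @shell_compact n.
have [dl dl0 fdl] : exists2 d, 0 < d & forall x, A x -> d <= `|f x|.
  have [A0|A0] := pselect (A !=set0); last first.
    by exists 1 => // x Ax; exfalso; apply: A0; exists x.
  have [|c cA' cmin] := @EVT_min_rV R _ (fun x => `|f x|) A A0 cA.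
    apply: continuous_subspaceT => x.
    by apply: continuous_comp; [exact: cf|exact: norm_continuous].
  exists `|f c|; first by rewrite normr_gt0 f0 //; move: cA'; rewrite inE.
  by move=> x Ax; apply: cmin; rewrite inE.
have [eta eta0 feta] := uniform_continuity_on_bounded 1 cf dl0.
have [k keta] : exists k, (n%:R / n.+1%:R) ^+ k * 2 <= eta :> R.
  have : (fun k => (n%:R / n.+1%:R : R) ^+ k) @ \oo --> (0 : R).
    apply: cvg_expr; rewrite ger0_norm ?mulr_ge0 // ltr_pdivrMr // mul1r.
    by rewrite ltr_nat.
  move=> /cvgrPdist_lt/(_ (eta / 2)); rewrite divr_gt0 // => /(_ isT) [k _ H].
  exists k; have := H k (leqnn k); rewrite /= sub0r normrN ltr_pdivlMr // => /ltW.
  by apply: le_trans; rewrite ler_wpM2r // ler_norm.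
pose big_coord x := [pred j : 'I_m | dl <= `|f x 0 j|].
pose lab x : nat := if [pick j | big_coord x j] is Some j
  then (j.*2 + (0 < f x 0 j)%R)%N else 0%N.
have big_coordN x : big_coord (- x) =1 big_coord x.
  by move=> j /=; rewrite fN mxE normrN.
have labE x : A x -> exists2 j, big_coord x j & lab x = (j.*2 + (0 < f x 0 j)%R)%N /\
    lab (- x) = (j.*2 + (f x 0 j < 0)%R)%N.
  move=> Ax; rewrite /lab.
  have -> : [pick j | big_coord (- x) j] = [pick j | big_coord x j].
    by apply: eq_pick => j; exact: big_coordN.
  case: pickP => [j /= jx|nj].
    by exists j => //; rewrite fN mxE oppr_gt0.
  have m0 : `|f x| < dl.
    have : `|f x| <= \big[Num.max/0]_j `|f x 0 j|.
      apply: norm_le_coord => [|i]; first by apply/bigmax_geP; left.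
      by apply/bigmax_geP; right; exists i.
    move/le_lt_trans; apply; apply/bigmax_ltP; split => // j _.
    by rewrite ltNge; apply/negbT/nj.
  by have := fdl x Ax; rewrite leNgt m0.
have subA e s : (e <= n.+1)%N -> s \in subdivisions k (cross_faces n e) ->
    {in s, forall x, A x}.
  move=> en /(subdivisions_props en)[_ s1 [l l1 ls] _] x xs.
  rewrite /A /= s1 // andbT invf_ple ?posrE //; last first.
    rewrite normr_gt0; apply: contra_eq_neq (ls x xs) => ->.
    by rewrite big1 1?eq_sym ?oner_eq0 // => i _; rewrite mxE mulr0.
  have xp : 0 < `|x|.
    rewrite normr_gt0; apply: contra_eq_neq (ls x xs) => ->.
    by rewrite big1 1?eq_sym ?oner_eq0 // => i _; rewrite mxE mulr0.
  rewrite -[`|x|^-1]mul1r ler_pdivrMr // -[leLHS](ls x xs).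
  apply: le_trans (_ : \sum_(i < n.+1) `|x| <= _); last first.
    by rewrite sumr_const card_ord -[X in X <= _]mulr_natl.
  apply: ler_sum => i _; apply: le_trans (ler_norm _) _; rewrite normrM.
  by apply: le_trans (ler_pM _ _ (l1 i) (coord_le_norm x i)) _; rewrite ?mul1r.
have labP e s : (e <= n.+1)%N -> s \in subdivisions k (cross_faces n e) ->
     {in s, forall x, lab (- x) = flip_label (lab x)} /\
     {in s &, forall x y, lab y != flip_label (lab x)}.
  move=> en sk; split=> [x xs|x y xs ys].
    have [j /= jx [-> ->]] := labE x (subA _ _ en sk x xs).
    rewrite /flip_label oddD odd_double /=.
    have : f x 0 j != 0 by rewrite -normr_gt0 (lt_le_trans dl0).
    by rewrite neq_lt => /orP[] fx; rewrite fx (lt_gtF fx) /= ?addn0 ?addn1.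
  have [i /= ix [-> _]] := labE x (subA _ _ en sk x xs).
  have [j /= jy [-> _]] := labE y (subA _ _ en sk y ys).
  rewrite flip_label_double; apply/eqP => /double_label_inj[/val_inj ij].
  subst j => sg.
  have [_ s1 _ sd] := subdivisions_props en sk.
  have fxy : `|f x 0 i - f y 0 i| < dl.
    rewrite (_ : f x 0 i - f y 0 i = (f x - f y) 0 i); last by rewrite !mxE.
    apply: le_lt_trans (coord_le_norm _ _) _; apply: feta; first exact: s1.
    exact: le_trans (sd _ _ xs ys) keta.
  move: sg ix jy fxy; case: (ltP 0 (f x 0 i)) => xi; case: (ltP 0 (f y 0 i)) => yi //= _.
    rewrite gtr0_norm // ler0_norm // => Hx Hy /(le_lt_trans (ler_norm _)) Hd.
    by exfalso; lra.
  rewrite ler0_norm // gtr0_norm // => Hx Hy; rewrite distrC => /(le_lt_trans (ler_norm _)) Hd.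
  by exfalso; lra.
have := alt_count_odd labP; rewrite /alt_count.
have /contraLR H :
    ~~ has (fun s => alt_labels true (map lab s)) (subdivisions k (cross_faces n n.+1)) ->
    ~~ sum2 (subdivisions k (cross_faces n n.+1)) (fun s => alt_labels true (map lab s)).
  move=> /hasPn H; rewrite big_seq big1 // => s sk; exact/negbTE/H.
move=> /H/hasP[s sk sa].
have [sn _ _ _] := subdivisions_props (leqnn _) sk.
have [_ sC] := labP _ _ (leqnn _) sk.
rewrite -[n.+1]sn -(size_map lab s).
apply: alt_labels_size sa _ => [_ _ /mapP[x xs ->] /mapP[y ys ->]|_ /mapP[x xs ->]].
  exact: sC.
have [j /= _ [-> _]] := labE x (subA _ _ (leqnn _) sk x xs).
by rewrite addnC half_bit_double ltn_ord.
Qed.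

End BorsukUlam.

(** * Critical orbits of a function on a Euclidean space *)

Section RowVectors.
Variable R : realType.

Definition dot n (x y : 'rV[R]_n) : R := \sum_i x 0 i * y 0 i.

Lemma dotC n (x y : 'rV[R]_n) : dot x y = dot y x.
Proof. by apply: eq_bigr => i _; rewrite mulrC. Qed.

Lemma dotDl n (x y z : 'rV[R]_n) : dot (x + y) z = dot x z + dot y z.
Proof. by rewrite -big_split; apply: eq_bigr => i _; rewrite mxE mulrDl. Qed.

Lemma dotZl n a (x y : 'rV[R]_n) : dot (a *: x) y = a * dot x y.
Proof. by rewrite mulr_sumr; apply: eq_bigr => i _; rewrite mxE mulrA. Qed.

Lemma dotNl n (x y : 'rV[R]_n) : dot (- x) y = - dot x y.
Proof. by rewrite -scaleN1r dotZl mulN1r. Qed.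

Lemma dotDr n (x y z : 'rV[R]_n) : dot z (x + y) = dot z x + dot z y.
Proof. by rewrite dotC dotDl !(dotC z). Qed.

Lemma dotZr n a (x y : 'rV[R]_n) : dot y (a *: x) = a * dot y x.
Proof. by rewrite dotC dotZl dotC. Qed.

Lemma dotNr n (x y : 'rV[R]_n) : dot y (- x) = - dot y x.
Proof. by rewrite dotC dotNl dotC. Qed.

Lemma dot0l n (x : 'rV[R]_n) : dot 0 x = 0.
Proof. by rewrite -(scale0r x) dotZl mul0r. Qed.

Lemma dot_ge0 n (x : 'rV[R]_n) : 0 <= dot x x.
Proof. by apply: sumr_ge0 => i _; rewrite -expr2 sqr_ge0. Qed.

Lemma dot_eq0 n (x : 'rV[R]_n) : (dot x x == 0) = (x == 0).
Proof.
have nn i : true -> 0 <= x 0 i * x 0 i by rewrite -expr2 sqr_ge0.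
apply/eqP/eqP => [x0|->]; last exact: dot0l.
apply/rowP => i; rewrite mxE; apply/eqP.
by have /eqP := psumr_eq0P nn x0 (i := i) isT; rewrite -expr2 sqrf_eq0.
Qed.

Lemma dot_le_norm n (x y : 'rV[R]_n) : `|dot x y| <= n%:R * (`|x| * `|y|).
Proof.
apply: le_trans (ler_norm_sum _ _ _) _.
apply: le_trans (_ : \sum_(i < n) `|x| * `|y| <= _).
  by apply: ler_sum => i _; rewrite normrM ler_pM // coord_le_norm.
by rewrite sumr_const card_ord mulr_natl.
Qed.

Lemma continuous_coordP (T : topologicalType) n (f : T -> 'rV[R]_n) :
  (forall i, continuous (fun x => f x 0 i)) -> continuous f.
Proof.
move=> cf x; apply/cvgrPdist_le => e e0.
have : \forall y \near x, forall i, `|f x 0 i - f y 0 i| <= e.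
  apply: filter_forall => i; have /cvgrPdist_le/(_ e e0) := cf i x.
  exact: filterS.
apply: filterS => y H; apply: norm_le_coord => [|i]; first exact: ltW.
by rewrite !mxE.
Qed.

Lemma continuous_coord (T : topologicalType) n (f : T -> 'rV[R]_n) i :
  continuous f -> continuous (fun x => f x 0 i).
Proof.
by move=> cf x; exact: (continuous_comp (cf x) (@coord_continuous _ _ _ _ _ _)).
Qed.

Lemma continuous_sum (T : topologicalType) (I : finType) (f : I -> T -> R) :
  (forall i, continuous (f i)) -> continuous (fun x => \sum_i f i x).
Proof.
by move=> cf; apply: continuous_big => //; exact: add_continuous.
Qed.

Lemma continuousD_fun (T : topologicalType) (f g : T -> R) :
  continuous f -> continuous g -> continuous (fun x => f x + g x).
Proof. by move=> cf cg x; apply: cvgD; [exact: cf|exact: cg]. Qed.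

Lemma continuousB_fun (T : topologicalType) (f g : T -> R) :
  continuous f -> continuous g -> continuous (fun x => f x - g x).
Proof. by move=> cf cg x; apply: cvgB; [exact: cf|exact: cg]. Qed.

Lemma continuousM_fun (T : topologicalType) (f g : T -> R) :
  continuous f -> continuous g -> continuous (fun x => f x * g x).
Proof. by move=> cf cg x; apply: cvgM; [exact: cf|exact: cg]. Qed.

Lemma continuousB_row (T : topologicalType) n (f g : T -> 'rV[R]_n) :
  continuous f -> continuous g -> continuous (fun x => f x - g x).
Proof.
move=> cf cg; apply: continuous_coordP => i.
rewrite (_ : (fun x => _) = (fun x => f x 0 i - g x 0 i)).
  by apply: continuousB_fun; exact: continuous_coord.
by apply/funext => x; rewrite !mxE.
Qed.

Lemma continuous_dot (T : topologicalType) n (f g : T -> 'rV[R]_n) :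
  continuous f -> continuous g -> continuous (fun x => dot (f x) (g x)).
Proof.
move=> cf cg; apply: continuous_sum => i.
by apply: continuousM_fun; exact: continuous_coord.
Qed.

Lemma norm_ball_compact n (M : R) : compact [set x : 'rV[R]_n | `|x| <= M].
Proof.
apply: bounded_closed_compact.
  exists M; split; first exact: num_real.
  by move=> r Mr x /= /le_trans; apply; exact: ltW.
apply: (@closed_comp _ _ (fun x : 'rV[R]_n => `|x|) [set r : R | r <= M]).
  by move=> x _; exact: norm_continuous.
exact: closed_le.
Qed.

(** The Z/2 genus, as the least dimension of a space to which the set can be
    mapped by an odd map avoiding 0. The map is defined on the whole space,
    which makes the genus subadditive without an extension theorem. *)
Definition genus_le n (A : set 'rV[R]_n) (m : nat) : Prop :=
  exists m' (f : 'rV[R]_n -> 'rV[R]_m'),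
    [/\ (m' <= m)%N, continuous f, forall x, f (- x) = - f x
      & forall x, A x -> f x != 0].

Lemma genus_le_sub n (A B : set 'rV[R]_n) m :
  A `<=` B -> genus_le B m -> genus_le A m.
Proof. by move=> AB [m' [f [? ? ? fB]]]; exists m', f; split => // x /AB/fB. Qed.

Lemma genus_leW n (A : set 'rV[R]_n) m k :
  (m <= k)%N -> genus_le A m -> genus_le A k.
Proof.
by move=> mk [m' [f [? ? ? ?]]]; exists m', f; split=> //; exact: leq_trans mk.
Qed.

Lemma genus_le0 n : genus_le (set0 : set 'rV[R]_n) 0.
Proof.
exists 0%N, (fun=> 0); split=> [//|x|x|//].
  exact: cst_continuous.
by rewrite oppr0.
Qed.

Lemma genus_leU n (A B : set 'rV[R]_n) m k :
  genus_le A m -> genus_le B k -> genus_le (A `|` B) (m + k).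
Proof.
move=> [m' [f [mm cf fN f0]]] [k' [g [kk cg gN g0]]].
exists (m' + k')%N, (fun x => row_mx (f x) (g x)); split.
- exact: leq_add.
- apply: continuous_coordP => i; case: (splitP i) => j ij.
    rewrite (_ : (fun x => _) = (fun x => f x 0 j)); first exact: continuous_coord.
    by apply/funext => x; rewrite (_ : i = lshift k' j) ?row_mxEl //; apply: val_inj.
  rewrite (_ : (fun x => _) = (fun x => g x 0 j)); first exact: continuous_coord.
  by apply/funext => x; rewrite (_ : i = rshift m' j) ?row_mxEr //; apply: val_inj.
- by move=> x; rewrite fN gN opp_row_mx.
- move=> x [/f0|/g0]; apply: contra_neq; rewrite -row_mx0 => /eq_row_mx[] //.
Qed.

Lemma genus_le_cover n d (I : finType) (phi : I -> 'rV[R]_n -> 'rV[R]_d)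
    (S : {set I}) :
  (forall i, continuous (phi i)) -> (forall i x, phi i (- x) = - phi i x) ->
  genus_le [set x | exists2 i, i \in S & phi i x != 0] (d * #|S|).
Proof.
move=> cphi phiN; rewrite cardE.
suff H (s : seq I) : genus_le [set x | exists2 i, i \in s & phi i x != 0] (d * size s).
  by apply: genus_le_sub (H (enum S)) => x [i iS ix]; exists i => //; rewrite mem_enum.
elim: s => [|i s IH].
  by rewrite muln0; apply: genus_le_sub (genus_le0 n) => x [].
rewrite /= mulnS.
have gi : genus_le [set x | phi i x != 0] d by exists d, (phi i); split.
apply: genus_le_sub (genus_leU gi IH) => x [j].
by rewrite inE => /predU1P[->|js] jx; [left|right; exists j].
Qed.

Lemma genus_le_preimage n (A : set 'rV[R]_n) (T : 'rV[R]_n -> 'rV[R]_n) m :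
  continuous T -> (forall x, T (- x) = - T x) ->
  genus_le A m -> genus_le (T @^-1` A) m.
Proof.
move=> cT TN [m' [f [mm cf fN f0]]]; exists m', (f \o T); split; first exact: mm.
- by move=> x; apply: continuous_comp; [exact: cT|exact: cf].
- by move=> x /=; rewrite TN fN.
- by move=> x /f0.
Qed.

End RowVectors.

Section Multiplicity.
Variables (R : realType) (n : nat).
Notation V := 'rV[R]_n.
(* [D] is a gradient of [J] in the weak sense of [J_grad]. *)
Variables (J : V -> R) (D : V -> V) (C M : R).
Hypothesis D_cont : continuous D.
Hypothesis D_odd : forall x, D (- x) = - D x.
Hypothesis C_ge0 : 0 <= C.
Hypothesis J_grad : forall x y,
  J y <= J x + dot (D y) (y - x) + C * dot (y - x) (y - x).
Hypothesis J_bounded : forall x, J x <= 0 -> `|x| <= M.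

(** Near a point x the function is squeezed between two continuous functions
    that agree with it at x. *)
Lemma continuous_of_grad : continuous J.
Proof.
move=> x.
pose u y := dot (D y) (y - x) + C * dot (y - x) (y - x).
pose l y := dot (D x) (y - x) - C * dot (y - x) (y - x).
have cB : continuous (fun y : V => y - x).
  by move=> y; apply: continuousB; [exact: id|exact: cst_continuous].
have cC : continuous (fun y : V => C * dot (y - x) (y - x)).
  by apply: continuousM_fun; [move=> y; exact: cst_continuous|exact: continuous_dot].
have cu : continuous u.
  exact: continuousD_fun (continuous_dot D_cont cB) cC.
have cl : continuous l.
  apply: continuousB_fun cC; apply: continuous_dot; last exact: cB.
  by move=> y; exact: cst_continuous.
have ux : u x = 0 by rewrite /u subrr dot0l dotC dot0l mulr0 addr0.
have lx : l x = 0 by rewrite /l subrr dot0l dotC dot0l mulr0 subr0.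
have cJl : continuous (fun y => J x + l y).
  by apply: continuousD_fun => // y; exact: cst_continuous.
have cJu : continuous (fun y => J x + u y).
  by apply: continuousD_fun => // y; exact: cst_continuous.
have := cJl x; have := cJu x; rewrite /continuous_at ux lx addr0.
move=> cux clx; apply: squeeze_cvgr clx cux.
near=> y; apply/andP; split; last by rewrite /u addrA.
have := J_grad y x; rewrite /l -[x - y]opprB !dotNr !dotNl opprK.
by move=> H; lra.
Unshelve. all: by end_near. Qed.

Let bounded_on_ball (W : normedModType R) (f : V -> W) : continuous f ->
  exists2 B, 0 < B & forall x, `|x| <= M -> `|f x| <= B.
Proof.
move=> cf; have /ex_strict_bound_gt0[B B0 HB] : bounded_set (f @` [set x : V | `|x| <= M]).
  apply: compact_bounded; apply: continuous_compact; last exact: norm_ball_compact.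
  exact: continuous_subspaceT.
by exists B => // x xM; apply/ltW/HB; exists x.
Qed.

(** One gradient step, switched off where the gradient is small: for a small
    step the quadratic error in [J_grad] is dominated by the first order
    decrease. *)
Lemma deformation (U : set V) (a b : R) : open U -> a <= 0 ->
  (forall x, b <= J x <= a -> D x = 0 -> U x) ->
  exists (T : V -> V) (eta : R), [/\ continuous T, forall x, T (- x) = - T x,
    0 < eta, forall x, J x <= a -> J (T x) <= J x &
    forall x, b <= J x <= a -> ~ U x -> J (T x) <= J x - eta].
Proof.
move=> oU a0 critU.
pose s x := dot (D x) (D x).
have cs : continuous s by apply: continuous_dot.
pose A := [set x : V | `|x| <= M] `&` ([set x | b <= J x] `&` [set x | J x <= a] `&` ~` U).
have cA : compact A.
  apply: compact_closedI; first exact: norm_ball_compact.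
  apply: closedI; last exact: open_closedC.
  apply: closedI.
    apply: (@closed_comp _ _ J [set r : R | b <= r]); last exact: closed_ge.
    by move=> x _; exact: continuous_of_grad.
  apply: (@closed_comp _ _ J [set r : R | r <= a]); last exact: closed_le.
  by move=> x _; exact: continuous_of_grad.
have [s0 s0_gt0 As0] : exists2 d, 0 < d & forall x, A x -> d <= s x.
  have [A0|A0] := pselect (A !=set0); last first.
    by exists 1 => // x Ax; exfalso; apply: A0; exists x.
  have [|c cA' cmin] := @EVT_min_rV R _ s A A0 cA.
    exact: continuous_subspaceT.
  exists (s c); last by move=> x Ax; apply: cmin; rewrite inE.
  rewrite lt_neqAle dot_ge0 andbT eq_sym dot_eq0; apply/eqP => Dc.
  by move: cA'; rewrite inE => -[_ [[bc ca]]]; apply; apply: critU => //; apply/andP.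
have [B B0 DB] := bounded_on_ball D_cont.
have [B' B'0 sB'] := bounded_on_ball cs.
pose e := s0 / 8 / (n.+1%:R * B).
have nB : 0 < n.+1%:R * B by rewrite mulr_gt0.
have e0 : 0 < e by rewrite !divr_gt0.
have [d d0 Dd] := uniform_continuity_on_bounded M D_cont e0.
pose t := Num.min (d / (B' * B)) (4^-1 / (C * B' + 1)).
have CB : 0 < C * B' + 1 by rewrite ltr_wpDl // mulr_ge0 // ltW.
have t0 : 0 < t by rewrite lt_min !divr_gt0 // mulr_gt0.
have td : t * (B' * B) <= d by rewrite -ler_pdivlMr ?mulr_gt0 // ge_min lexx.
have tC : t * C * B' <= 4^-1.
  have : t * (C * B' + 1) <= 4^-1 by rewrite -ler_pdivlMr // ge_min lexx orbT.
  by rewrite mulrDr mulr1 mulrA; lra.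
pose h x := t * Num.max 0 (s x - s0 / 2).
have h0 x : 0 <= h x by rewrite mulr_ge0 ?(ltW t0) // le_max lexx.
pose T (x : V) : V := x - h x *: D x.
have JT x : J x <= a -> J (T x) <= J x - h x * s x / 2.
  move=> Jx; have xM := J_bounded (le_trans Jx a0).
  have [sx|sx] := leP (s x) (s0 / 2).
    have hx : h x = 0 by rewrite /h max_l ?mulr0 // subr_le0.
    by rewrite /T hx scale0r subr0 !mul0r subr0.
  have hx : h x = t * (s x - s0 / 2) by rewrite /h max_r // subr_ge0 ltW.
  have sx0 : 0 < s x by apply: lt_trans sx; rewrite divr_gt0.
  have sxB : s x <= B' by apply: le_trans (ler_norm _) (sB' x xM).
  have hB : h x <= t * B' by rewrite hx; apply: ler_wpM2l; [exact: ltW|lra].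
  have xT : `|x - T x| <= d.
    rewrite /T opprB addrC subrK normrZ ger0_norm //.
    apply: le_trans td; rewrite mulrA; apply: ler_pM => //; exact: DB.
  have := J_grad x (T x); rewrite {2 3 4}/T.
  rewrite (_ : x - h x *: D x - x = - (h x *: D x)); last by rewrite addrAC subrr add0r.
  rewrite !dotNr !dotNl opprK !dotZr !dotZl -/(s x).
  have Ds : s x - s0 / 8 <= dot (D (T x)) (D x).
    rewrite -[D (T x)](subrK (D x)) dotDl -/(s x) addrC lerD2r.
    rewrite -lerN2 opprK -dotNl opprB.
    apply: le_trans (ler_norm _) _; apply: le_trans (dot_le_norm _ _) _.
    have De := Dd _ _ xM xT.
    apply: le_trans (_ : n.+1%:R * (e * B) <= _); last first.
      by rewrite mulrCA /e divfK // lt0r_neq0.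
    apply: ler_pM; rewrite ?mulr_ge0 ?ler_nat //.
    by apply: ler_pM => //; [exact: ltW|exact: DB].
  have CC : C * (h x * (h x * s x)) <= h x * (s x / 4).
    rewrite mulrCA; apply: ler_wpM2l => //; rewrite mulrA [leRHS]mulrC.
    apply: ler_wpM2r; first exact: ltW.
    apply: le_trans tC; rewrite -mulrA [t * _]mulrCA.
    by apply: ler_wpM2l.
  move=> H; apply: le_trans H _.
  rewrite -!addrA lerD2l.
  have : h x * (s x - s0 / 8) <= h x * dot (D (T x)) (D x) by exact: ler_wpM2l.
  have : h x * (s0 / 2) <= h x * s x by apply: ler_wpM2l => //; exact: ltW.
  by rewrite mulrBr => H1 H2; lra.
exists T, (t * (s0 / 2) * s0 / 2); split.
- have ch : continuous h.
    apply: continuousM_fun; first exact: cst_continuous.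
    move=> x; apply: (@continuous_max _ _ (fun=> 0) (fun x => s x - s0 / 2)).
      exact: cst_continuous.
    by apply: continuousB_fun => // y; exact: cst_continuous.
  have chD : continuous (fun x => h x *: D x).
    by move=> x; apply: continuousZ; [exact: ch|exact: D_cont].
  have : continuous (fun x : V => x - h x *: D x : V); last by [].
  apply: (@continuousB_row R V n (fun x => x) (fun x => h x *: D x)) => //.
  by move=> x; exact: id.
- move=> x; rewrite /T /h (_ : s (- x) = s x) ?D_odd ?scalerN ?opprD //.
  by rewrite /s D_odd dotNl dotNr opprK.
- by rewrite !mulr_gt0 // invr_gt0.
- move=> x Jx; apply: le_trans (JT x Jx) _.
  by rewrite lerBlDr lerDl divr_ge0 // mulr_ge0 // dot_ge0.
- move=> x /andP[bJ Ja] NU; apply: le_trans (JT x Ja) _; rewrite lerD2l lerN2.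
  have sx : s0 <= s x by apply: As0; split; [exact: J_bounded (le_trans Ja a0)|].
  have : t * (s0 / 2) * s0 <= h x * s x.
    apply: ler_pM => //; [by rewrite mulr_ge0 ?divr_ge0 // ltW|exact: ltW|].
    rewrite /h; apply: ler_wpM2l; first exact: ltW.
    by rewrite le_max; apply/orP; right; lra.
  by lra.
Qed.

(** By compactness the deformation decreases the values by a fixed amount,
    and finitely many iterations reach the lower level. *)
Lemma deformation_no_critical (a b : R) : a <= 0 ->
  (forall x, b <= J x <= a -> D x <> 0) ->
  exists T : V -> V, [/\ continuous T, forall x, T (- x) = - T x &
    forall x, J x <= a -> J (T x) <= b].
Proof.
move=> a0 nocrit.
have [T [eta [cT TN eta0 Ta Tb]]] :=
  @deformation set0 a b open0 a0 (fun x xab Dx => nocrit x xab Dx).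
pose Tk k := iter k T.
have Tkc k : continuous (Tk k).
  elim: k => [|k IH] x; first exact: id.
  by apply: continuous_comp; [exact: IH|exact: cT].
have TkN k x : Tk k (- x) = - Tk k x by elim: k => //= k ->.
have H k x : J x <= a -> J (Tk k x) <= Num.max b (a - k%:R * eta).
  move=> Jx; have Ja i : J (Tk i x) <= a.
    by elim: i => //= i IH; exact: le_trans (Ta _ IH) IH.
  elim: k => [|k]; first by rewrite /= mul0r subr0 le_max Jx orbT.
  rewrite !le_max => /orP[Jb|Jk].
    by apply/orP; left; exact: le_trans (Ta _ (Ja k)) Jb.
  have [bJ|Jb] := leP b (J (Tk k x)).
    apply/orP; right; have := Tb (Tk k x); rewrite bJ Ja => /(_ isT id).
    by move=> H; apply: le_trans H _; rewrite -natr1 mulrDl mul1r opprD addrA lerD2r.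
  by apply/orP; left; apply: le_trans (Ta _ (Ja k)) (ltW Jb).
have [k kN] : exists k : nat, (a - b) / eta <= k%:R.
  have [/archi_boundP/ltW ?|/ltW ?] := leP 0 ((a - b) / eta); last by exists 0%N.
  by exists (Num.bound ((a - b) / eta)).
exists (Tk k); split=> // x Jx; apply: le_trans (H k x Jx) _.
rewrite ge_max lexx /=; move: kN; rewrite ler_pdivrMr //; lra.
Qed.

(** Lusternik-Schnirelmann counting: lev lists the levels of the critical
    orbits, and phi contains for each of them an odd map to a space of
    dimension d that does not vanish on the orbit. Passing the highest level
    adds at most d for each orbit at that level, by subadditivity of the
    genus and the deformation away from these orbits. *)
Theorem genus_sublevel (d : nat) (I : finType) (lev : I -> R)
    (phi : I -> V -> 'rV[R]_d) (S : {set I}) (a : R) : a <= 0 ->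
  (forall i, continuous (phi i)) -> (forall i x, phi i (- x) = - phi i x) ->
  (forall x, J x <= a -> D x = 0 ->
     exists i, [/\ i \in S, lev i = J x & phi i x != 0]) ->
  genus_le [set x | J x <= a] (d * #|S|).
Proof.
move=> a0 cphi phiN.
have [m] := ubnP #|S|; elim: m S a a0 => // m IH S a a0 Sm crit.
have [S0|[i0 i0S]] := set_0Vmem S.
  pose L := J 0 - n%:R * (`|D 0| * M) - C * (n%:R * (M * M)).
  have JL y : J y <= 0 -> L <= J y.
    move=> /J_bounded yM; have := J_grad y 0; rewrite sub0r !dotNr dotNl opprK.
    have : - dot (D 0) y <= n%:R * (`|D 0| * M).
      rewrite -dotNr; apply: le_trans (ler_norm _) _.
      apply: le_trans (dot_le_norm _ _) _; rewrite normrN.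
      by rewrite !ler_wpM2l.
    have : C * dot y y <= C * (n%:R * (M * M)).
      rewrite ler_wpM2l //; apply: le_trans (ler_norm _) _.
      apply: le_trans (dot_le_norm _ _) _.
      by rewrite ler_wpM2l // ler_pM.
    by rewrite /L; lra.
  have [|T [_ _ Tb]] := @deformation_no_critical a (Num.min L 0 - 1) a0.
    move=> x /andP[_ Ja] Dx; have [i [iS _ _]] := crit x Ja Dx.
    by rewrite S0 inE in iS.
  apply: genus_leW (leq0n _) (genus_le_sub _ (genus_le0 R n)) => x /= /Tb.
  have [m0 mL] : Num.min L 0 <= 0 /\ Num.min L 0 <= L by rewrite !ge_min !lexx orbT.
  move=> Jb; have : L <= J (T x) by apply: JL; lra.
  by lra.
pose i1 := [arg max_(i > i0 in S) lev i]%O.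
have [i1S i1max] : i1 \in S /\ forall i, i \in S -> lev i <= lev i1.
  by rewrite /i1; case: arg_maxP.
pose c := lev i1.
pose S' := [set i in S | lev i < c].
have S'S : (#|S'| < #|S|)%N.
  apply: proper_card; apply/properP; split.
    by apply/fintype.subsetP => i; rewrite inE => /andP[].
  by exists i1 => //; rewrite inE i1S ltxx.
have S'm : (#|S'| < m)%N by exact: leq_trans S'S _.
have [ac|ca] := ltP a c.
  apply: genus_leW (IH S' a a0 S'm _); first by rewrite leq_mul2l ltnW ?orbT.
  move=> x Ja Dx; have [i [iS iJ ix]] := crit x Ja Dx.
  by exists i; rewrite inE iS iJ (le_lt_trans Ja ac).
have [dl dl0 dlP] : exists2 dl, 0 < dl & forall i, i \in S' -> lev i <= c - dl.
  have [S'0|[j0 j0S]] := set_0Vmem S'.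
    by exists 1 => // i; rewrite S'0 inE.
  pose j1 := [arg max_(i > j0 in S') lev i]%O.
  have [j1S j1max] : j1 \in S' /\ forall i, i \in S' -> lev i <= lev j1.
    by rewrite /j1; case: arg_maxP.
  exists (c - lev j1); first by move: j1S; rewrite inE subr_gt0 => /andP[].
  by move=> i /j1max; rewrite opprB addrC subrK.
pose Sc := S :\: S'.
have ScP i : i \in Sc -> lev i = c.
  rewrite !inE => /andP[/nandP[/negbTE->//|]]; rewrite -leNgt => ci iS.
  by apply/eqP; rewrite eq_le ci i1max.
pose U := [set x : V | exists2 i, i \in Sc & phi i x != 0].
have oU : open U.
  rewrite (_ : U = \bigcup_(i in [set i | i \in Sc])
      ((fun x => `|phi i x|) @^-1` [set r : R | 0 < r])).
    apply: bigcup_open => i _; apply: open_comp; last exact: open_gt.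
    move=> x _; apply: (continuous_comp (cphi i x)).
    exact: norm_continuous.
  by apply/seteqP; split => x [i iS ix]; exists i => //=; move: ix;
    rewrite /= normr_gt0.
have critc x : c - dl < J x <= a -> D x = 0 -> J x = c /\ U x.
  move=> /andP[cJ Ja] Dx; have [i [iS iJ ix]] := crit x Ja Dx.
  have iSc : i \in Sc.
    rewrite !inE iS andbT /=; apply/negP => ic.
    by have := dlP i; rewrite inE iS ic iJ => /(_ isT); rewrite leNgt cJ.
  by split; [rewrite -iJ ScP|exists i].
have dl2 : 0 < dl / 2 by rewrite divr_gt0.
have [|T2 [eta [cT2 T2N eta0 T2a T2b]]] := @deformation U a (c - dl / 2) oU a0.
  move=> x /andP[bJ Ja] Dx; apply: (critc x _ Dx).2.
  by rewrite Ja andbT; lra.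
have [T1 [cT1 T1N T1a]] : exists T1 : V -> V, [/\ continuous T1,
    forall x, T1 (- x) = - T1 x &
    forall x, J x <= a -> J (T1 x) <= a /\ J (T1 x) <= c + eta / 2].
  have [ca2|ac2] := leP (c + eta / 2) a; last first.
    exists id; split=> // [x|x Jx]; first exact: id.
    by split=> //; exact: le_trans Jx (ltW ac2).
  have [|T1 [cT1 T1N T1a]] := @deformation_no_critical a (c + eta / 2) a0.
    move=> x /andP[bJ Ja] Dx.
    have [|Jc _] := critc x _ Dx; first by rewrite Ja andbT; lra.
    by move: bJ; rewrite Jc; lra.
  exists T1; split=> // x /T1a Jx; split=> //; exact: le_trans Jx ca2.
pose a' := c - Num.min (dl / 2) (eta / 2).
have a'c : a' < c by rewrite /a' ltrBlDr ltrDl lt_min dl2 divr_gt0.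
have a'dl : c - dl / 2 <= a' by rewrite lerD2l lerN2 ge_min lexx.
have a'eta : c - eta / 2 <= a' by rewrite lerD2l lerN2 ge_min lexx orbT.
have gS' : genus_le [set x | J x <= a'] (d * #|S'|).
  apply: IH => //; first by rewrite (le_trans (ltW a'c)) // (le_trans ca).
  move=> x Ja' Dx; have [|i [iS iJ ix]] := crit x _ Dx.
    by rewrite (le_trans Ja') // (le_trans (ltW a'c)).
  by exists i; rewrite inE iS iJ (le_lt_trans Ja' a'c).
have -> : (d * #|S| = d * #|Sc| + d * #|S'|)%N.
  rewrite -mulnDr -(cardsID S' S) (finset.setIidPr _) 1?addnC //.
  by apply/fintype.subsetP => i; rewrite inE => /andP[].
have := genus_le_preimage cT1 T1N
  (genus_leU (genus_le_cover Sc cphi phiN) (genus_le_preimage cT2 T2N gS')).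
apply: genus_le_sub => x /= /T1a [Ja Jc].
have [Ux|NU] := pselect (U (T1 x)); [by left|right].
have [cJ|Jc'] := leP (c - dl / 2) (J (T1 x)); last first.
  by apply: le_trans (T2a _ Ja) _; apply: le_trans (ltW Jc') _.
by apply: le_trans (T2b (T1 x) _ NU) _; [rewrite cJ|lra].
Qed.

End Multiplicity.

(** * Calculus on the line *)

Section Calculus.
Variable R : realType.
Implicit Types (f g F h : R -> R) (x a b c d : R).

Notation der x f d := (is_derive (x : R) (1 : R) (f : R -> R) (d : R)).

Lemma der_eq x f a b : der x f a -> a = b -> der x f b.
Proof. by move=> ? <-. Qed.

Lemma der_cst x c : der x (fun=> c) 0.
Proof. exact: is_derive_cst. Qed.

Lemma der_id x : der x (fun y => y) 1.
Proof. exact: is_derive_id. Qed.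

Lemma derD x f g a b : der x f a -> der x g b ->
  der x (fun y => f y + g y) (a + b).
Proof. by move=> ? ?; exact: is_deriveD. Qed.

Lemma derN x f a : der x f a -> der x (fun y => - f y) (- a).
Proof. by move=> ?; exact: is_deriveN. Qed.

Lemma derB x f g a b : der x f a -> der x g b ->
  der x (fun y => f y - g y) (a - b).
Proof. by move=> ? ?; exact: is_deriveB. Qed.

Lemma derM x f g a b : der x f a -> der x g b ->
  der x (fun y => f y * g y) (a * g x + f x * b).
Proof.
move=> fa gb; apply: der_eq (is_deriveM (f := f) (g := g) fa gb) _.
by rewrite /GRing.scale /= addrC mulrC [X in _ + X]mulrC [b * _]mulrC mulrC addrC.
Qed.

Lemma derZ x f a c : der x f a -> der x (fun y => c * f y) (c * a).
Proof. by move=> fa; apply: der_eq (derM (der_cst x c) fa) _; rewrite mul0r add0r. Qed.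

Lemma der_comp x f g a b : der (g x) f a -> der x g b ->
  der x (fun y => f (g y)) (a * b).
Proof. by move=> fa gb; exact: is_derive1_comp. Qed.

Lemma der_exp x c : der x (fun y => expR (c * y)) (c * expR (c * x)).
Proof.
have H : der (c * x) (@expR R) (expR (c * x)) by exact: is_derive_expR.
apply: der_eq (der_comp H (derZ c (der_id x))) _.
by rewrite mulr1 mulrC.
Qed.

Lemma der_continuous x f a : der x f a -> {for x, continuous f}.
Proof.
by move=> fa; apply: differentiable_continuous; apply/derivable1_diffP; case: fa.
Qed.

Lemma der_within_continuous f (df : R -> R) a b :
  (forall x, a <= x <= b -> der x f (df x)) -> {within `[a, b], continuous f}.
Proof.
move=> fd; apply: derivable_within_continuous => x; rewrite in_itv /= => xab.
by case: (fd x xab).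
Qed.

Lemma mean_value f (df : R -> R) a b : a <= b ->
  (forall x, a <= x <= b -> der x f (df x)) ->
  exists2 c, a <= c <= b & f b - f a = df c * (b - a).
Proof.
move=> ab fd.
have fdo x : x \in `]a, b[ -> der x f (df x).
  by rewrite in_itv /= => /andP[ax xb]; apply: fd; rewrite !ltW.
have [c] := MVT_segment ab fdo (der_within_continuous fd).
by rewrite in_itv /= => cab ->; exists c.
Qed.

Lemma der_lipschitz f (df : R -> R) a b B :
  (forall x, a <= x <= b -> der x f (df x)) ->
  (forall x, a <= x <= b -> `|df x| <= B) ->
  forall x y, a <= x <= b -> a <= y <= b -> `|f x - f y| <= B * `|x - y|.
Proof.
move=> fd dB; suff H x y : a <= x <= b -> a <= y <= b -> x <= y ->
    `|f x - f y| <= B * `|x - y|.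
  move=> x y xab yab; have [xy|/ltW yx] := leP x y; first exact: H.
  by rewrite distrC [`|x - y|]distrC H.
move=> /andP[ax xb] /andP[ay yb] xy; have [|c /andP[xc cy] E] := @mean_value f df x y xy.
  by move=> z /andP[xz zy]; apply: fd; rewrite (le_trans ax xz) (le_trans zy yb).
rewrite distrC E normrM [`|x - y|]distrC; apply: ler_wpM2r => //.
by apply: dB; rewrite (le_trans ax xc) (le_trans cy yb).
Qed.

Lemma exists_primitive h a : continuous h ->
  exists F : R -> R, forall x, a < x -> der x F (h x).
Proof.
move=> ch; exists (fun x => \int[lebesgue_measure]_(t in `[a, x]) h t) => x ax.
have x1 : x < x + 1 by rewrite ltrDl.
have [|d dE] := @continuous_FTC1_closed R h a x (x + 1) x1 _ ax (ch x).
  by apply: continuous_compact_integrable; [exact: segment_compact|exact: continuous_subspaceT].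
by split; [exact: d|rewrite -derive1E; exact: dE].
Qed.

(** Maximum principle: at an interior maximum above [c] the function would be
    strictly convex. *)
Lemma max_principle f (f1 f2 : R -> R) a b c :
  (forall x, a <= x <= b -> der x f (f1 x)) ->
  (forall x, a <= x <= b -> der x f1 (f2 x)) ->
  (forall x, a <= x <= b -> c < f x -> 0 < f2 x) ->
  f a <= c -> f b <= c -> forall x, a <= x <= b -> f x <= c.
Proof.
move=> fd fd1 f2c fa fb x0 /andP[ax0 x0b].
have ab : a <= b by exact: le_trans ax0 x0b.
have [m mab fm] := EVT_max ab (der_within_continuous fd).
have {fm}fm x : a <= x <= b -> f x <= f m by move=> xab; apply: fm; rewrite in_itv.
move: mab; rewrite in_itv /= => /andP[am mb].
rewrite (le_trans (fm x0 _)) ?ax0 // leNgt; apply/negP => cm.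
have am' : a < m by rewrite lt_neqAle am andbT; apply: contraTneq cm => <-; rewrite -leNgt.
have mb' : m < b by rewrite lt_neqAle mb andbT; apply: contraTneq cm => ->; rewrite -leNgt.
have cf : {for m, continuous f} by apply: der_continuous (fd m _); rewrite am.
have /cvgrPdist_lt/(_ (f m - c)) := cf.
rewrite subr_gt0 cm => /(_ isT)/nbhs_ballP[r /= r0 rP].
pose s := Num.min (r / 2) (Num.min (m - a) (b - m)).
have s0 : 0 < s by rewrite !lt_min divr_gt0 // !subr_gt0 am' mb'.
have [sr sa sb] : [/\ s <= r / 2, s <= m - a & s <= b - m].
  by rewrite !ge_min !lexx ?orbT.
have sP x : m - s <= x <= m + s -> a <= x <= b /\ c < f x.
  move=> /andP[x1 x2]; split; first by apply/andP; split; lra.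
  suff /rP /= : ball m r x by move=> /(le_lt_trans (ler_norm _)) /=; lra.
  by rewrite /ball /= ltr_norml; apply/andP; split; lra.
have incr x y : m - s <= x -> x < y -> y <= m + s -> f1 x < f1 y.
  move=> sx xy ys; have [|z /andP[xz zy] E] := @mean_value f1 f2 x y (ltW xy).
    by move=> z /andP[xz zy]; apply: fd1; apply: (sP z _).1; apply/andP; split; lra.
  rewrite -subr_gt0 E mulr_gt0 ?subr_gt0 //.
  have [zab cz] : a <= z <= b /\ c < f z by apply: sP; apply/andP; split; lra.
  exact: f2c.
have mv x y : m - s <= x -> x < y -> y <= m + s ->
    exists2 z, x <= z <= y & f y - f x = f1 z * (y - x).
  move=> sx xy ys; apply: mean_value (ltW xy) _.
  by move=> z /andP[xz zy]; apply: fd; apply: (sP z _).1; apply/andP; split; lra.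
have [f10|f10] := leP 0 (f1 m).
  have [||| z /andP[mz zs] E] := mv (m + s / 2) (m + s); [lra|lra|lra|].
  have z0 : 0 < f1 z by apply: le_lt_trans f10 _; apply: incr; lra.
  have [||| z' /andP[mz' zs'] E'] := mv m (m + s / 2); [lra|lra|lra|].
  have z'0 : 0 <= f1 z'.
    have [->//|mz'n] := eqVneq z' m.
    by apply: le_trans f10 _; apply: ltW; apply: incr; rewrite ?lt_neqAle; try lra; rewrite eq_sym mz'n.
  have : f (m + s) <= f m by apply: fm; apply/andP; split; lra.
  have : 0 < f1 z * (m + s - (m + s / 2)) by rewrite mulr_gt0 //; lra.
  have : 0 <= f1 z' * (m + s / 2 - m) by rewrite mulr_ge0 //; lra.
  by lra.
have [||| z /andP[mz zs] E] := mv (m - s) (m - s / 2); [lra|lra|lra|].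
have z0 : f1 z < 0 by apply: lt_trans f10; apply: incr; lra.
have [||| z' /andP[mz' zs'] E'] := mv (m - s / 2) m; [lra|lra|lra|].
have z'0 : f1 z' <= 0.
  have [->|mz'n] := eqVneq z' m; first exact: ltW.
  by apply: ltW; apply: lt_trans f10; apply: incr; rewrite ?lt_neqAle; try lra; rewrite mz'n.
have : f (m - s) <= f m by apply: fm; apply/andP; split; lra.
have : 0 < - f1 z * (m - s / 2 - (m - s)) by rewrite mulr_gt0 //; lra.
have : 0 <= - f1 z' * (m - (m - s / 2)) by rewrite mulr_ge0 //; lra.
by lra.
Qed.

(** Variation of constants. *)
Lemma linear_bvp (m L : R) h (a b : R) : 0 < m -> 0 < L -> continuous h ->
  exists u v : R -> R, [/\ u 0 = a, u L = b &
    forall x, 0 <= x <= L ->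
      der x u (v x) /\ der x v (m ^+ 2 * u x - h x)].
Proof.
move=> m0 L0 ch.
have cexp c : continuous (fun y => expR (c * y) * h y).
  move=> y; apply: cvgM; last exact: ch.
  exact: der_continuous (der_exp y c).
have [A dA] := @exists_primitive _ (-1) (cexp m).
have [B dB] := @exists_primitive _ (-1) (cexp (- m)).
pose P x := (2 * m)^-1 * (expR (- m * x) * A x - expR (m * x) * B x).
pose P1 x := - 2^-1 * (expR (- m * x) * A x + expR (m * x) * B x).
have EE x : expR (- m * x) * expR (m * x) = 1.
  by rewrite -expRD mulNr addNr expR0.
have dP x : 0 <= x <= L -> der x P (P1 x).
  move=> /andP[x0 _]; have xI : -1 < x by lra.
  apply: der_eq (derZ _ (derB (derM (der_exp x (- m)) (dA x xI))
                             (derM (der_exp x m) (dB x xI)))) _.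
  rewrite /P1 !mulrA EE [expR (m * x) * _]mulrC EE.
  by field; rewrite lt0r_neq0.
have dP1 x : 0 <= x <= L -> der x P1 (m ^+ 2 * P x - h x).
  move=> /andP[x0 _]; have xI : -1 < x by lra.
  apply: der_eq (derZ _ (derD (derM (der_exp x (- m)) (dA x xI))
                             (derM (der_exp x m) (dB x xI)))) _.
  rewrite /P !mulrA EE [expR (m * x) * _]mulrC EE.
  by field; rewrite lt0r_neq0.
pose E := expR (m * L) - expR (- m * L).
have E0 : 0 < E by rewrite subr_gt0 ltr_expR mulNr; have := mulr_gt0 m0 L0; lra.
pose al := (b - P L - (a - P 0) * expR (- m * L)) / E.
pose be := ((a - P 0) * expR (m * L) - (b - P L)) / E.
exists (fun x => P x + (al * expR (m * x) + be * expR (- m * x))).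
exists (fun x => P1 x + (al * (m * expR (m * x)) + be * (- m * expR (- m * x)))).
split.
- rewrite !mulr0 expR0 !mulr1 (_ : al + be = a - P 0); first by ring.
  by rewrite /al /be /E; field; exact: lt0r_neq0 E0.
- rewrite (_ : al * _ + _ = b - P L); first by ring.
  by rewrite /al /be /E; field; exact: lt0r_neq0 E0.
move=> x xL; split.
  apply: der_eq (derD (dP x xL) (derD (derZ al (der_exp x m)) (derZ be (der_exp x (- m))))) _.
  by [].
apply: der_eq (derD (dP1 x xL) (derD (derZ al (derZ m (der_exp x m)))
   (derZ be (derZ (- m) (der_exp x (- m)))))) _.
by ring.
Qed.

(* The limit is the supremum of the lower bounds [x n - K th^n / (1 - th)]. *)
Lemma geometric_limit (x : nat -> R) (K th : R) : 0 <= K -> 0 <= th < 1 ->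
  (forall n, `|x n.+1 - x n| <= K * th ^+ n) ->
  exists l, forall n, `|x n - l| <= K / (1 - th) * th ^+ n.
Proof.
move=> K0 /andP[th0 th1] xP.
pose e n := K / (1 - th) * th ^+ n.
have th1' : 0 < 1 - th by lra.
have eE n : e n - e n.+1 = K * th ^+ n.
  rewrite /e exprS; field; exact: lt0r_neq0.
have e0 n : 0 <= e n by rewrite !mulr_ge0 ?invr_ge0 ?exprn_ge0 // ltW.
have dec n m : (n <= m)%N -> x m + e m <= x n + e n.
  move=> /subnK <-; elim: (m - n)%N => //= k IH; apply: le_trans IH.
  rewrite addSn; have := xP (k + n)%N; rewrite -eE ler_norml => /andP[]; lra.
have inc n m : (n <= m)%N -> x n - e n <= x m - e m.
  move=> /subnK <-; elim: (m - n)%N => //= k IH; apply: le_trans IH _.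
  rewrite addSn; have := xP (k + n)%N; rewrite -eE ler_norml => /andP[]; lra.
have xe n m : x n - e n <= x m + e m.
  apply: le_trans (inc _ _ (leq_maxl n m)) _.
  apply: le_trans (dec _ _ (leq_maxr n m)); have := e0 (maxn n m); lra.
pose A := [set x n - e n | n in [set: nat]].
have Aub m : ubound A (x m + e m) by move=> _ [n _ <-].
have hA : has_sup A.
  by split; [exists (x 0%N - e 0%N), 0%N|exists (x 0%N + e 0%N)].
exists (sup A) => n; rewrite ler_distl; apply/andP; split.
  by have := ge_sup hA.1 (Aub n); rewrite lerBlDr.
have : x n - e n <= sup A by apply: sup_upper_bound => //; exists n.
by rewrite lerBlDr.
Qed.

End Calculus.

Notation der x f d := (is_derive x (1 : _) f d).

(** * Planar vectors *)

(* A complex number, as its pair of coordinates. *)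
Notation plane R := (bool -> R).

Section Plane.
Variable R : realType.
Implicit Types a b : plane R.

Definition ip a b : R := a false * b false + a true * b true.
Definition nm a : R := Num.sqrt (ip a a).

Lemma ip_ge0 a : 0 <= ip a a.
Proof. by rewrite /ip -!expr2 addr_ge0 // sqr_ge0. Qed.

Lemma nm_ge0 a : 0 <= nm a. Proof. exact: sqrtr_ge0. Qed.

Lemma nm_sqr a : nm a ^+ 2 = ip a a. Proof. by rewrite sqr_sqrtr // ip_ge0. Qed.

Lemma ip_le_nm a b : ip a b <= nm a * nm b.
Proof.
have [|i0] := leP (ip a b) 0.
  by move/le_trans; apply; rewrite mulr_ge0 // nm_ge0.
rewrite -(ler_pXn2r (ltn0Sn 1)) ?nnegrE ?mulr_ge0 ?nm_ge0 //; last exact: ltW.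
rewrite exprMn !nm_sqr -subr_ge0.
rewrite (_ : _ - _ = (a false * b true - a true * b false) ^+ 2) ?sqr_ge0 //.
by rewrite /ip; ring.
Qed.

Lemma nm_leP a K : 0 <= K -> (nm a <= K) = (ip a a <= K ^+ 2).
Proof. by move=> K0; rewrite -nm_sqr ler_pXn2r // nnegrE nm_ge0. Qed.

Lemma coord_le_nm a c : `|a c| <= nm a.
Proof.
rewrite -(ler_pXn2r (ltn0Sn 1)) ?nnegrE ?nm_ge0 ?normr_ge0 // nm_sqr.
rewrite real_normK ?num_real // /ip -!expr2.
by case: c; rewrite ?lerDl ?lerDr sqr_ge0.
Qed.

Lemma nm0 : nm (fun=> 0) = 0.
Proof. by rewrite /nm /ip mulr0 addr0 sqrtr0. Qed.

Lemma ip_zero a : ip a a <= 0 -> forall c, a c = 0.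
Proof.
move=> a0 c; apply/eqP; rewrite -normr_le0.
by apply: le_trans (coord_le_nm a c) _; rewrite nm_leP // expr0n.
Qed.

End Plane.

(** * The nonlinear boundary value problem on a segment *)

Lemma vector_max_principle (R : realType) (w v a : bool -> R -> R) (L K : R) :
  (forall c x, 0 <= x <= L -> der x (w c) (v c x) /\ der x (v c) (a c x)) ->
  ip (w^~ 0) (w^~ 0) <= K -> ip (w^~ L) (w^~ L) <= K ->
  (forall x, 0 <= x <= L -> K < ip (w^~ x) (w^~ x) -> 0 < ip (w^~ x) (a^~ x)) ->
  forall x, 0 <= x <= L -> ip (w^~ x) (w^~ x) <= K.
Proof.
move=> wva w0 wL wa.
apply: (@max_principle _ (fun x => ip (w^~ x) (w^~ x))
  (fun x => 2 * ip (w^~ x) (v^~ x))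
  (fun x => 2 * (ip (v^~ x) (v^~ x) + ip (w^~ x) (a^~ x)))) => // x xL.
- have [d0 _] := wva false x xL; have [d1 _] := wva true x xL.
  by apply: der_eq (derD (derM d0 d0) (derM d1 d1)) _; rewrite /ip; ring.
- have [d0 e0] := wva false x xL; have [d1 e1] := wva true x xL.
  by apply: der_eq (derZ 2 (derD (derM d0 e0) (derM d1 e1))) _; rewrite /ip; ring.
- by move=> /(wa x xL) wx; rewrite mulr_gt0 // ltr_wpDl // ip_ge0.
Qed.

(** Profiles [phi] of the radial maps [a |-> phi |a| a]; these conditions make
    the radial map monotone and Lipschitz continuous. *)
Definition tame (R : realType) (phi : R -> R) (B K : R) : Prop :=
  [/\ forall s, 0 <= phi s, forall s, 0 <= s -> phi s <= B,
      forall r s, 0 <= r -> r <= s -> phi r <= phi s, 0 <= K &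
      forall r s, 0 <= r -> r <= s -> (phi s - phi r) * r <= K * (s - r)].

Definition radial (R : realType) (phi : R -> R) (a : plane R) : plane R :=
  fun c => phi (nm a) * a c.

Section TameNonlinearity.
Variables (R : realType) (phi : R -> R) (B K : R).
Hypothesis phiT : tame phi B K.

Let phi_ge0 s : 0 <= phi s. Proof. by case: phiT. Qed.
Let phi_le s : 0 <= s -> phi s <= B. Proof. by case: phiT => _ + _ _ _; exact. Qed.
Let phi_mono r s : 0 <= r -> r <= s -> phi r <= phi s.
Proof. by case: phiT => _ _ + _ _; exact. Qed.
Let K_ge0 : 0 <= K. Proof. by case: phiT. Qed.
Let phi_lip r s : 0 <= r -> r <= s -> (phi s - phi r) * r <= K * (s - r).
Proof. by case: phiT => _ _ _ _; exact. Qed.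

Definition lip2 : R := 2 * (B ^+ 2 + K ^+ 2).

Let F := radial phi.
Notation "a - b" := (fun c => a c - b c) (only parsing) : plane_scope.
Local Delimit Scope plane_scope with P.

Lemma radial_monotone a b : 0 <= ip (F a - F b)%P (a - b)%P.
Proof.
rewrite (_ : ip _ _ = phi (nm a) * nm a ^+ 2 + phi (nm b) * nm b ^+ 2
  - (phi (nm a) + phi (nm b)) * ip a b); last first.
  by rewrite !nm_sqr /ip /F /radial; ring.
have : (phi (nm a) + phi (nm b)) * ip a b <=
    (phi (nm a) + phi (nm b)) * (nm a * nm b).
  by rewrite ler_wpM2l ?ip_le_nm // addr_ge0.
suff : 0 <= (phi (nm a) * nm a - phi (nm b) * nm b) * (nm a - nm b) by lra.
have := nm_ge0 a; have := nm_ge0 b; move: (nm a) (nm b) => s r r0 s0.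
have [rs|sr] := leP r s.
  apply: mulr_ge0; rewrite subr_ge0 //.
  by apply: ler_pM => //; exact: phi_mono.
rewrite -mulrNN mulr_ge0 // oppr_ge0 subr_le0; last exact: ltW.
by apply: ler_pM => //; [exact: phi_mono (ltW sr)|exact: ltW].
Qed.

Lemma radial_lipschitz a b :
  ip (F a - F b)%P (F a - F b)%P <= lip2 * ip (a - b)%P (a - b)%P.
Proof.
wlog ba : a b / nm b <= nm a.
  move=> H; have [/H//|/ltW/H] := leP (nm b) (nm a).
  by rewrite /ip; lra.
have b0 := nm_ge0 b.
have H1 : ((phi (nm a) - phi (nm b)) * nm b) ^+ 2 <= K ^+ 2 * ip (a - b)%P (a - b)%P.
  apply: (@le_trans _ _ ((K * (nm a - nm b)) ^+ 2)).
    rewrite ler_pXn2r ?nnegrE ?phi_lip //.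
      by rewrite mulr_ge0 // subr_ge0 phi_mono.
    by rewrite mulr_ge0 // subr_ge0.
  rewrite exprMn ler_wpM2l ?sqr_ge0 //.
  rewrite (_ : ip _ _ = nm a ^+ 2 + nm b ^+ 2 - 2 * ip a b); last first.
    by rewrite !nm_sqr /ip; ring.
  by have := ip_le_nm a b; lra.
have H2 : phi (nm a) ^+ 2 * ip (a - b)%P (a - b)%P <= B ^+ 2 * ip (a - b)%P (a - b)%P.
  by rewrite ler_wpM2r ?ip_ge0 // ler_pXn2r ?nnegrE ?phi_le ?nm_ge0 // (le_trans (phi_ge0 0)) ?phi_le.
have : ip (F a - F b)%P (F a - F b)%P <=
  2 * (phi (nm a) ^+ 2 * ip (a - b)%P (a - b)%P) +
  2 * ((phi (nm a) - phi (nm b)) * nm b) ^+ 2.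
  rewrite exprMn nm_sqr -subr_ge0.
  rewrite (_ : _ - _ = ip (fun c => phi (nm a) * (a c - b c) - (phi (nm a) - phi (nm b)) * b c)
    (fun c => phi (nm a) * (a c - b c) - (phi (nm a) - phi (nm b)) * b c)).
    exact: ip_ge0.
  by rewrite /ip /F /radial; ring.
by rewrite /lip2; lra.
Qed.

Lemma lip2_ge0 : 0 <= lip2.
Proof. by rewrite mulr_ge0 // addr_ge0 // sqr_ge0. Qed.

Lemma continuous_radial (T : topologicalType) (g : bool -> T -> R) :
  (forall c, continuous (g c)) -> forall c, continuous (fun x => F (g^~ x) c).
Proof.
move=> cg c x; apply/cvgrPdist_le => e e0.
pose d := e / (2 * (lip2 + 1)).
have l0 : 0 < lip2 + 1 by rewrite ltr_wpDl // lip2_ge0.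
have d0 : 0 < d by rewrite divr_gt0 // mulr_gt0.
have /cvgrPdist_le/(_ _ d0) c0 := cg false x.
have /cvgrPdist_le/(_ _ d0) c1 := cg true x.
near=> y; have y0 : `|g false x - g false y| <= d by near: y.
have y1 : `|g true x - g true y| <= d by near: y.
apply: le_trans (coord_le_nm (F (g^~ x) - F (g^~ y))%P c) _.
rewrite nm_leP; last exact: ltW.
apply: le_trans (radial_lipschitz _ _) _.
have : ip ((g^~ x) - (g^~ y))%P ((g^~ x) - (g^~ y))%P <= 2 * d ^+ 2.
  rewrite /ip /= -!expr2 -[X in X + _]real_normK ?num_real // -[X in _ + X]real_normK ?num_real //.
  by rewrite mulr2n mulrDl !mul1r lerD // ler_pXn2r // nnegrE // ltW.
move=> /(ler_wpM2l lip2_ge0)/le_trans; apply.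
have -> : e = 2 * (lip2 + 1) * d by rewrite /d; field; exact: lt0r_neq0.
rewrite [leRHS]exprMn [leLHS]mulrA; apply: ler_wpM2r; first exact: sqr_ge0.
by have := lip2_ge0; nra.
Unshelve. all: by end_near. Qed.

Variables (om L : R).
Hypothesis om_gt0 : 0 < om.
Hypothesis L_gt0 : 0 < L.

Definition segment_solution (u v : bool -> R -> R) := forall c x, 0 <= x <= L ->
  der x (u c) (v c x) /\ der x (v c) (om * u c x + F (u^~ x) c).

(** By monotonicity of the nonlinearity the squared distance of two solutions
    is convex. *)
Lemma segment_solution_dist u v u' v' d : 0 <= d ->
  segment_solution u v -> segment_solution u' v' ->
  ip (u^~ 0 - u'^~ 0)%P (u^~ 0 - u'^~ 0)%P <= d ->
  ip (u^~ L - u'^~ L)%P (u^~ L - u'^~ L)%P <= d ->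
  forall x, 0 <= x <= L -> ip (u^~ x - u'^~ x)%P (u^~ x - u'^~ x)%P <= d.
Proof.
move=> d0 uv uv' e0 eL.
apply: (@vector_max_principle _ (fun c x => u c x - u' c x) (fun c x => v c x - v' c x)
  (fun c x => om * u c x + F (u^~ x) c - (om * u' c x + F (u'^~ x) c))) => //.
  by move=> c x xL; have [? ?] := uv c x xL; have [? ?] := uv' c x xL;
    split; apply: derB.
move=> x xL dx; have := radial_monotone (u^~ x) (u'^~ x).
have : 0 < om * ip (u^~ x - u'^~ x)%P (u^~ x - u'^~ x)%P.
  by rewrite mulr_gt0 // (le_lt_trans d0).
by rewrite /ip /=; lra.
Qed.

Definition dtn_lip : R := 2 / L + (om + lip2 + 1) * L.

(** For the difference w of two solutions both |w| and |w''| are bounded by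
    multiples of d, and a function bounded by d has somewhere a slope of at
    most 2 d / L. *)
Lemma segment_solution_slope u v u' v' d :
  segment_solution u v -> segment_solution u' v' -> 0 <= d ->
  ip (u^~ 0 - u'^~ 0)%P (u^~ 0 - u'^~ 0)%P <= d ^+ 2 ->
  ip (u^~ L - u'^~ L)%P (u^~ L - u'^~ L)%P <= d ^+ 2 ->
  forall c, `|v c 0 - v' c 0| <= dtn_lip * d /\ `|v c L - v' c L| <= dtn_lip * d.
Proof.
move=> uv uv' d0 e0 eL c.
have H := segment_solution_dist (sqr_ge0 d) uv uv' e0 eL.
have w x : 0 <= x <= L -> `|u c x - u' c x| <= d.
  move=> xL; apply: le_trans (coord_le_nm (u^~ x - u'^~ x)%P c) _.
  by rewrite nm_leP // H.
have dw x : 0 <= x <= L -> der x (fun x => u c x - u' c x) (v c x - v' c x).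
  by move=> xL; have [? _] := uv c x xL; have [? _] := uv' c x xL; apply: derB.
have [xi xiL E] := mean_value (ltW L_gt0) dw.
have xi_le : `|v c xi - v' c xi| <= 2 / L * d.
  rewrite -(ler_pM2r L_gt0) -[X in _ * X](gtr0_norm L_gt0) -normrM.
  move: E; rewrite subr0 => <-.
  rewrite (_ : 2 / L * d * L = d + d); last by field; exact: lt0r_neq0.
  apply: le_trans (ler_normB _ _) _; apply: lerD; apply: w; rewrite lexx ?ltW //.
have dv x : 0 <= x <= L -> der x (fun x => v c x - v' c x)
    (om * u c x + F (u^~ x) c - (om * u' c x + F (u'^~ x) c)).
  by move=> xL; have [_ ?] := uv c x xL; have [_ ?] := uv' c x xL; apply: derB.
have bound x : 0 <= x <= L ->
    `|om * u c x + F (u^~ x) c - (om * u' c x + F (u'^~ x) c)| <= (om + lip2 + 1) * d.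
  move=> xL; rewrite opprD addrACA -mulrBr -addrA mulrDl.
  apply: le_trans (ler_normD _ _) _; apply: lerD.
    by rewrite normrM gtr0_norm // ler_wpM2l ?w // ltW.
  apply: le_trans (coord_le_nm (F (u^~ x) - F (u'^~ x))%P c) _.
  have l0 := lip2_ge0.
  rewrite nm_leP ?mulr_ge0 ?addr_ge0 //; apply: le_trans (radial_lipschitz _ _) _.
  apply: le_trans (ler_wpM2l l0 (H x xL)) _.
  rewrite exprMn ler_wpM2r ?sqr_ge0 //; nra.
have lip := der_lipschitz dv bound.
have Lb (y : R) : 0 <= y <= L -> `|y - xi| <= L.
  move=> /andP[y0 yL]; move/andP: xiL => [? ?]; rewrite ler_norml; apply/andP; split; lra.
have main y : 0 <= y <= L -> `|v c y - v' c y| <= dtn_lip * d.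
  move=> yL; rewrite -[X in `|X|](subrK (v c xi - v' c xi)) addrC.
  apply: le_trans (ler_normD _ _) _; rewrite /dtn_lip mulrDl lerD //.
  apply: le_trans (lip y xi yL xiL) _; rewrite -!mulrA [L * d]mulrC.
  rewrite mulrA [leRHS]mulrA; apply: ler_wpM2l; last exact: Lb.
  by rewrite mulr_ge0 // !addr_ge0 ?lip2_ge0 // ltW.
by split; apply: main; rewrite lexx ltW.
Qed.

End TameNonlinearity.

Section SegmentExistence.
Variables (R : realType) (phi : R -> R) (B K om L : R).
Hypothesis phiT : tame phi B K.
Hypothesis om_gt0 : 0 < om.
Hypothesis L_gt0 : 0 < L.
Variables al be : plane R.

Notation "a - b" := (fun c => a c - b c) (only parsing) : plane_scope.
Local Delimit Scope plane_scope with P.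
Notation paths := (bool -> R -> R).
Notation F := (radial phi).
Notation lip2 := (lip2 B K).

Let l0 : 0 <= lip2. Proof. exact: lip2_ge0. Qed.

(* The equation is written u'' = m2 u - (kap u - F u). The constant [kap] is so
   large that [th] is less than 1, where [m2 * th] is a Lipschitz constant of
   [kap id - F]. *)
Let kap : R := lip2 / om + 1.
Let m2 : R := om + kap.
Let th2 : R := (kap ^+ 2 + lip2) / m2 ^+ 2.

Let kap_gt0 : 0 < kap.
Proof. by rewrite ltr_wpDl // divr_ge0 // ltW. Qed.

Let m2_gt0 : 0 < m2. Proof. by rewrite addr_gt0. Qed.

Let th2_itv : 0 <= th2 < 1.
Proof.
apply/andP; split; first by rewrite divr_ge0 // ?sqr_ge0 // addr_ge0 // sqr_ge0.
rewrite ltr_pdivrMr ?exprn_gt0 // mul1r /m2.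
have E : om * kap = lip2 + om by rewrite /kap; field; exact: lt0r_neq0.
have -> : (om + kap) ^+ 2 = om ^+ 2 + 2 * (om * kap) + kap ^+ 2 by ring.
by rewrite E; have := sqr_ge0 om; move: l0 om_gt0; lra.
Qed.

Let clamp (x : R) : R := Num.max 0 (Num.min x L).

Let clampE x : 0 <= x <= L -> clamp x = x.
Proof. by move=> /andP[x0 xL]; rewrite /clamp min_l // max_r. Qed.

Let clamp_itv x : 0 <= clamp x <= L.
Proof. by rewrite le_max lexx /= ge_max ge_min lexx orbT (ltW L_gt0). Qed.

Let clamp_continuous : continuous clamp.
Proof.
move=> x; apply: (@continuous_max _ _ (fun=> 0) (fun x => Num.min x L)).
  exact: cst_continuous.
apply: (@continuous_min _ _ (fun x => x) (fun=> L)); first exact: id.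
exact: cst_continuous.
Qed.

Let admissible (u : paths) := forall c, continuous (fun x => u c (clamp x)).

Let rhs (u : paths) c x := kap * u c x - F (u^~ x) c.

Let picard_step (u : paths) (w : paths * paths) :=
  (forall c, w.1 c 0 = al c /\ w.1 c L = be c) /\
  forall c x, 0 <= x <= L ->
    der x (w.1 c) (w.2 c x) /\ der x (w.2 c) (m2 * w.1 c x - rhs u c x).

Let picard_step_exists u : admissible u -> exists w, picard_step u w.
Proof.
move=> au.
have ch c : continuous (fun x => rhs u c (clamp x)).
  move=> x; apply: cvgB.
    by apply: cvgM; [exact: cst_continuous|exact: au].
  exact: (continuous_radial phiT (g := fun c x => u c (clamp x)) au).
have sm : 0 < Num.sqrt m2 by rewrite sqrtr_gt0.
have lin c : exists w : (R -> R) * (R -> R), [/\ w.1 0 = al c, w.1 L = be c &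
    forall x, 0 <= x <= L -> der x w.1 (w.2 x) /\
      der x w.2 (m2 * w.1 x - rhs u c x)].
  have [w [w' [? ? H]]] := linear_bvp (al c) (be c) sm L_gt0 (ch c).
  exists (w, w'); split=> // x xL; have [d1 d2] := H x xL; split=> //=.
  by apply: der_eq d2 _; rewrite sqr_sqrtr ?ltW // clampE.
have [w wP] := choice lin.
exists (fun c => (w c).1, fun c => (w c).2); split=> c; first by have [] := wP c.
by have [_ _] := wP c.
Qed.

Let picard_admissible u w : picard_step u w -> admissible w.1.
Proof.
move=> [_ uw] c x; apply: (@continuous_comp _ _ _ clamp (w.1 c)).
  exact: clamp_continuous.
have [d _] := uw c (clamp x) (clamp_itv x); exact: der_continuous d.
Qed.

(** By monotonicity and the Lipschitz bound of [F], the maximum principle gives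
    a contraction of the sup norm for this choice of [kap]. *)
Let picard_contraction u u' w w' d : 0 <= d ->
  picard_step u w -> picard_step u' w' ->
  (forall x, 0 <= x <= L -> ip (u^~ x - u'^~ x)%P (u^~ x - u'^~ x)%P <= d) ->
  forall x, 0 <= x <= L ->
    ip (w.1^~ x - w'.1^~ x)%P (w.1^~ x - w'.1^~ x)%P <= th2 * d.
Proof.
move=> d0 [wb uw] [wb' uw'] uu'.
have [th0 _] := andP th2_itv.
have ends (y : R) : (forall c, w.1 c y = w'.1 c y) ->
    ip (w.1^~ y - w'.1^~ y)%P (w.1^~ y - w'.1^~ y)%P <= th2 * d.
  by move=> e; rewrite /ip !e !subrr !mulr0 addr0 mulr_ge0.
apply: (@vector_max_principle _ (fun c x => w.1 c x - w'.1 c x)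
  (fun c x => w.2 c x - w'.2 c x)
  (fun c x => m2 * w.1 c x - rhs u c x - (m2 * w'.1 c x - rhs u' c x))).
- by move=> c x xL; have [? ?] := uw c x xL; have [? ?] := uw' c x xL;
    split; apply: derB.
- by apply: ends => c; rewrite (wb c).1 (wb' c).1.
- by apply: ends => c; rewrite (wb c).2 (wb' c).2.
move=> x xL; set W := (fun c => w.1 c x - w'.1 c x) => dW.
pose h : plane R := fun c => rhs u c x - rhs u' c x.
have hh : ip h h <= m2 ^+ 2 * (th2 * d).
  have -> : m2 ^+ 2 * (th2 * d) = (kap ^+ 2 + lip2) * d.
    by rewrite /th2; field; exact: lt0r_neq0.
  apply: le_trans (ler_wpM2l _ (uu' x xL)); last by rewrite addr_ge0 // sqr_ge0.
  have := radial_lipschitz phiT (u^~ x) (u'^~ x).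
  have := mulr_ge0 (ltW kap_gt0) (radial_monotone phiT (u^~ x) (u'^~ x)).
  rewrite /h /rhs /ip /=; lra.
have W0 : 0 < nm W by rewrite lt_def nm_ge0 andbT -sqrf_eq0 nm_sqr gt_eqF // (le_lt_trans _ dW) // mulr_ge0.
have hW : nm h < m2 * nm W.
  rewrite -(ltr_pXn2r (ltn0Sn 1)) ?nnegrE ?nm_ge0 ?mulr_ge0 ?nm_ge0 ?(ltW m2_gt0) //.
  rewrite exprMn !nm_sqr; apply: le_lt_trans hh _.
  by rewrite ltr_pM2l // exprn_gt0.
have -> : ip W (fun c => m2 * w.1 c x - rhs u c x - (m2 * w'.1 c x - rhs u' c x)) =
    m2 * nm W ^+ 2 - ip W h.
  by rewrite nm_sqr /ip /W /h; ring.
rewrite subr_gt0; apply: le_lt_trans (ip_le_nm _ _) _.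
by rewrite expr2 mulrCA ltr_pM2l.
Qed.

Theorem segment_solution_exists : exists u v,
  segment_solution phi om L u v /\ forall c, u c 0 = al c /\ u c L = be c.
Proof.
have [T TP] : {T : paths -> paths * paths & forall u, admissible u -> picard_step u (T u)}.
  apply: (@choice _ _ (fun u w => admissible u -> picard_step u w)) => u.
  have [/picard_step_exists[w ?]|?] := pselect (admissible u); first by exists w.
  by exists (u, u).
pose us n := iter n (fun u => (T u).1) (fun _ _ => 0).
have us_adm n : admissible (us n).
  elim: n => [|n IH]; first by move=> c; exact: cst_continuous.
  exact: picard_admissible (TP _ IH).
have [D D0 DP] : exists2 D, 0 <= D & forall x, 0 <= x <= L ->
    ip (us 1%N^~ x - us 0%N^~ x)%P (us 1%N^~ x - us 0%N^~ x)%P <= D ^+ 2.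
  have [_ dT] := TP _ (us_adm 0%N).
  have bd c : exists2 M, 0 <= M & forall x, 0 <= x <= L -> `|us 1%N c x| <= M.
    have cw : {within `[0, L], continuous (fun x => `|us 1%N c x|)}.
      move=> x; apply: continuous_comp; last exact: norm_continuous.
      by apply: (@der_within_continuous _ _ ((T (us 0%N)).2 c)) => y /(dT c y)[].
    have [m _ mP] := EVT_max (ltW L_gt0) cw.
    by exists `|us 1%N c m| => // x xL; apply: mP; rewrite in_itv.
  have [M0 M00 M0P] := bd false; have [M1 M10 M1P] := bd true.
  exists (M0 + M1); first exact: addr_ge0.
  move=> x xL; have := M0P x xL; have := M1P x xL.
  rewrite /ip /= !subr0 -!expr2 -[X in _ -> _ -> X + _ <= _]real_normK ?num_real //.
  rewrite -[X in _ -> _ -> _ + X <= _]real_normK ?num_real //.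
  have := normr_ge0 (us 1%N false x); have := normr_ge0 (us 1%N true x).
  by move: `|_| `|_| => p q; nra.
pose th := Num.sqrt th2.
have [t0 t1] := andP th2_itv.
have th_itv : 0 <= th < 1.
  by rewrite sqrtr_ge0 /= -sqrtr1 ltr_sqrt.
have thE : th ^+ 2 = th2 by rewrite sqr_sqrtr.
have th0 : 0 <= th by case/andP: th_itv.
have geo n x : 0 <= x <= L ->
    ip (us n.+1^~ x - us n^~ x)%P (us n.+1^~ x - us n^~ x)%P <= (D * th ^+ n) ^+ 2.
  elim: n x => [|n IH] x xL; first by rewrite expr0 mulr1; exact: DP.
  have := picard_contraction _ (TP _ (us_adm n.+1)) (TP _ (us_adm n)) IH xL.
  rewrite sqr_ge0 => /(_ isT) /le_trans; apply.
  have -> : D * th ^+ n.+1 = th * (D * th ^+ n) by rewrite exprS mulrCA.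
  by rewrite [leRHS]exprMn thE.
have lim c x : exists l, 0 <= x <= L -> forall n, `|us n c x - l| <= D / (1 - th) * th ^+ n.
  have [xL|xL] := pselect (is_true (0 <= x <= L)); last by exists 0.
  have [|l lP] := @geometric_limit _ (fun n => us n c x) D th D0 th_itv.
    move=> n; apply: le_trans (coord_le_nm (us n.+1^~ x - us n^~ x)%P c) _.
    by rewrite nm_leP ?geo // mulr_ge0 // exprn_ge0.
  by exists l.
pose uu c x := projT1 (choice (lim c)) x.
have uuP c x : 0 <= x <= L -> forall n, `|us n c x - uu c x| <= D / (1 - th) * th ^+ n.
  by move=> xL n; rewrite /uu; case: (choice (lim c)) => /= f; apply.
pose C := D / (1 - th).
have C0 : 0 <= C by rewrite divr_ge0 // subr_ge0; case/andP: th_itv => _ /ltW.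
have th_cvg : (fun n => C * th ^+ n) @ \oo --> 0.
  rewrite -[X in _ --> X](mulr0 C); apply: cvgM; first exact: cvg_cst.
  by apply: cvg_expr; rewrite ger0_norm //; case/andP: th_itv.
have uu_adm : admissible uu.
  move=> c x; apply/cvgrPdist_lt => e e0.
  have e3 : 0 < e / 3 by rewrite divr_gt0.
  have /cvgrPdist_lt/(_ _ e3) [n _ nP] := th_cvg.
  have {}nP : C * th ^+ n < e / 3.
    by have := nP n (leqnn n); rewrite /= sub0r normrN; apply: le_lt_trans; exact: ler_norm.
  have /cvgrPdist_lt/(_ _ e3) := us_adm n c x.
  apply: filterS => y us_xy.
  have ux := uuP c _ (clamp_itv x) n; have uy := uuP c _ (clamp_itv y) n.
  rewrite (_ : uu c (clamp x) - uu c (clamp y) =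
    (us n c (clamp x) - us n c (clamp y)) - (us n c (clamp x) - uu c (clamp x))
    + (us n c (clamp y) - uu c (clamp y))); last by ring.
  apply: le_lt_trans (ler_normD _ _) _.
  have := ler_normB (us n c (clamp x) - us n c (clamp y)) (us n c (clamp x) - uu c (clamp x)).
  by move: us_xy ux uy nP; rewrite /C; lra.
have step_uu := TP _ uu_adm; pose ut := (T uu).1.
have utE x : 0 <= x <= L -> forall c, ut c x = uu c x.
  move=> xL c; apply/eqP; rewrite -subr_eq0 -normr_le0.
  have uu_us n y : 0 <= y <= L ->
      ip (us n^~ y - uu^~ y)%P (us n^~ y - uu^~ y)%P <= (2 * (C * th ^+ n)) ^+ 2.
    move=> yL; have := uuP false y yL n; have := uuP true y yL n; rewrite -/C /ip /=.
    rewrite -!expr2 -[X in _ -> _ -> X + _ <= _]real_normK ?num_real //.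
    rewrite -[X in _ -> _ -> _ + X <= _]real_normK ?num_real //.
    have := normr_ge0 (us n false y - uu false y).
    have := normr_ge0 (us n true y - uu true y).
    by move: `|_| `|_| (C * _) => p q r; nra.
  have small n : `|ut c x - uu c x| <= 3 * (C * th ^+ n).
    have H := picard_contraction (sqr_ge0 _) (TP _ (us_adm n)) step_uu (uu_us n) xL.
    have Ct0 : 0 <= C * th ^+ n by rewrite mulr_ge0 // exprn_ge0.
    have {H} : `|us n.+1 c x - ut c x| <= 2 * (C * th ^+ n).
      apply: le_trans (coord_le_nm (us n.+1^~ x - ut^~ x)%P c) _.
      rewrite nm_leP; last exact: mulr_ge0.
      apply: le_trans H _.
      by rewrite ler_piMl ?sqr_ge0 // ltW //; case/andP: th2_itv.
    have : `|us n.+1 c x - uu c x| <= C * th ^+ n.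
      apply: le_trans (uuP c x xL n.+1) _; rewrite -/C exprS mulrCA.
      by rewrite ler_piMl // ltW //; case/andP: th_itv.
    rewrite (_ : ut c x - uu c x =
      (us n.+1 c x - uu c x) - (us n.+1 c x - ut c x)); last by ring.
    by have := ler_normB (us n.+1 c x - uu c x) (us n.+1 c x - ut c x); lra.
  have : (fun n => 3 * (C * th ^+ n)) @ \oo --> 0.
    by rewrite -[X in _ --> X](mulr0 3); apply: cvgM; [exact: cvg_cst|].
  by move=> lim0; apply: (@cvgr_to_ge _ _ _ _ _ _ _ lim0); near=> n; exact: small.
have [tb tP] := step_uu.
exists ut, (T uu).2; split=> // c x xL; have [d1 d2] := tP c x xL.
split=> //; apply: der_eq d2 _; rewrite /rhs.
rewrite (_ : (uu^~ x) = (ut^~ x)); last by apply/funext => b; rewrite utE.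
by rewrite -(utE x xL) -/ut /m2; ring.
Unshelve. all: by end_near. Qed.

End SegmentExistence.

(** * Power nonlinearity *)

Section PowerNonlinearity.
Variables (R : realType) (p : R).
Hypothesis p_gt1 : 1 < p.

Definition pow_profile (s : R) : R := s `^ (p - 1).
Definition truncated_profile (M s : R) : R := pow_profile (Num.min s M).

Let p1 : 0 < p - 1. Proof. by rewrite subr_gt0. Qed.

Lemma pow_profile_mono r s : 0 <= r -> r <= s -> pow_profile r <= pow_profile s.
Proof.
by move=> r0 rs; apply: ge0_ler_powR; rewrite ?nnegrE ?(ltW p1) ?(le_trans r0).
Qed.

(* With [t = r / s] this is [1 - t^(p-1) <= 1 - t^N <= N (1 - t)], where [N] is
   an integer above [p - 1]. *)
Lemma pow_profile_lip : exists2 N, 0 <= N & forall r s, 0 <= r -> r <= s ->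
  (pow_profile s - pow_profile r) * r <= N * pow_profile s * (s - r).
Proof.
have [n np] : exists n : nat, p - 1 <= n%:R.
  by exists (Num.bound (p - 1)); apply/ltW/archi_boundP/ltW.
exists n%:R => // r s r0 rs.
have [s0|s0] := leP s 0.
  have -> : s = r by apply/eqP; rewrite eq_le rs andbT (le_trans s0).
  by rewrite !subrr mul0r mulr0.
have ps0 : 0 <= pow_profile s by exact: powR_ge0.
pose t := r / s.
have rE : r = t * s by rewrite /t divfK // lt0r_neq0.
have t0 : 0 <= t by rewrite divr_ge0 // ltW.
have t1 : t <= 1 by rewrite ler_pdivrMr // mul1r.
have prE : pow_profile r = t `^ (p - 1) * pow_profile s.
  by rewrite {1}rE /pow_profile powRM // ltW.
have tn : t ^+ n <= t `^ (p - 1).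
  rewrite -powR_mulrn //; have [->|tn0] := eqVneq t 0.
    rewrite [X in _ <= X]powR0 ?lt0r_neq0 // powR0 // gt_eqF //.
    exact: lt_le_trans p1 np.
  by apply: ger_powR => //; rewrite lt_def tn0 t0.
have bern : 1 - t ^+ n <= n%:R * (1 - t).
  elim: (n) => [|k IH]; first by rewrite expr0 subrr mul0r.
  have tk : t ^+ k <= 1 by rewrite exprn_ile1.
  have tk0 : 0 <= t ^+ k by rewrite exprn_ge0.
  by rewrite exprS -natr1; move: (t ^+ k) IH tk tk0 => q; nra.
have -> : (pow_profile s - pow_profile r) * r = pow_profile s * ((1 - t `^ (p - 1)) * r).
  by rewrite prE; ring.
rewrite [n%:R * _]mulrC -mulrA ler_wpM2l //.
have -> : n%:R * (s - r) = n%:R * (1 - t) * s by rewrite {1}rE; ring.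
apply: ler_pM => //; rewrite ?subr_ge0.
  by have := pow_profile_mono t0 t1; rewrite /pow_profile powR1.
by apply: le_trans bern; rewrite lerD2l lerN2.
Qed.

Lemma truncated_tame M : 0 <= M ->
  exists K, tame (truncated_profile M) (pow_profile M) K.
Proof.
move=> M0; have [N N0 lip] := pow_profile_lip.
have min_ge0 r : 0 <= r -> 0 <= Num.min r M by move=> r0; rewrite le_min r0.
exists (N * pow_profile M); split.
- by move=> s; exact: powR_ge0.
- move=> s s0; apply: pow_profile_mono; first exact: min_ge0.
  by rewrite ge_min lexx orbT.
- move=> r s r0 rs; apply: pow_profile_mono; first exact: min_ge0.
  by rewrite le_min !ge_min lexx rs orbT.
- by rewrite mulr_ge0 // powR_ge0.
move=> r s r0 rs; rewrite /truncated_profile.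
have [Mr|rM] := leP M r.
  rewrite min_r; last exact: le_trans rs.
  by rewrite subrr mul0r !mulr_ge0 ?powR_ge0 ?subr_ge0.
have rm : r <= Num.min s M by rewrite le_min rs ltW.
apply: le_trans (lip _ _ r0 rm) _.
have pM : pow_profile (Num.min s M) <= pow_profile M.
  by apply: pow_profile_mono; [exact: le_trans rm|rewrite ge_min lexx orbT].
apply: ler_pM; rewrite ?mulr_ge0 ?powR_ge0 ?subr_ge0 ?ler_wpM2l //.
by rewrite lerD2r ge_min lexx.
Qed.

Lemma radial_truncated M a : nm a <= M ->
  radial (truncated_profile M) a = radial pow_profile a.
Proof. by move=> aM; rewrite /radial /truncated_profile min_l. Qed.

Variables (om L : R).
Hypothesis om_gt0 : 0 < om.
Hypothesis L_gt0 : 0 < L.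

Lemma zero_segment_solution phi : segment_solution phi om L (fun _ _ => 0) (fun _ _ => 0).
Proof.
move=> c x _; split; first exact: der_cst.
by apply: der_eq (der_cst x 0) _; rewrite /radial !mulr0 addr0.
Qed.

Lemma sub0_plane (a : plane R) : (fun c => a c - (fun=> 0 : R) c) = a.
Proof. by apply/funext => c; rewrite subr0. Qed.

Lemma segment_solution_truncate M u v :
  (forall x, 0 <= x <= L -> nm (u^~ x) <= M) ->
  segment_solution (truncated_profile M) om L u v <->
  segment_solution pow_profile om L u v.
Proof.
move=> uM; split=> uv c x xL; have [d1 d2] := uv c x xL; split=> //;
  by apply: der_eq d2 _; rewrite radial_truncated ?uM.
Qed.

(** A truncation far away is harmless, since [|u|] is largest at the ends. *)
Theorem power_bvp (al be : plane R) : exists u v,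
  segment_solution pow_profile om L u v /\ forall c, u c 0 = al c /\ u c L = be c.
Proof.
pose M := Num.max (nm al) (nm be).
have M0 : 0 <= M by rewrite le_max nm_ge0.
have [K tm] := truncated_tame M0.
have [u [v [uv e]]] := segment_solution_exists tm om_gt0 L_gt0 al be.
have e0 : u^~ 0 = al by apply/funext => c; have [] := e c.
have eL : u^~ L = be by apply/funext => c; have [] := e c.
have uM x : 0 <= x <= L -> nm (u^~ x) <= M.
  move=> xL; rewrite nm_leP // -(sub0_plane (u^~ x)).
  apply: (segment_solution_dist tm om_gt0 (sqr_ge0 M) uv (zero_segment_solution _)) => //;
    by rewrite sub0_plane -nm_leP // ?e0 ?eL le_max lexx ?orbT.
exists u, v; split=> //; exact: (segment_solution_truncate _ uM).1 uv.
Qed.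

Lemma power_solution_bound u v M : 0 <= M ->
  segment_solution pow_profile om L u v -> nm (u^~ 0) <= M -> nm (u^~ L) <= M ->
  forall x, 0 <= x <= L -> nm (u^~ x) <= M.
Proof.
move=> M0 uv u0 uL x xL; rewrite nm_leP //.
apply: (vector_max_principle (w := u) uv); rewrite -?nm_leP // => y yL uy.
have -> : ip (u^~ y) (fun c => om * u c y + radial pow_profile (u^~ y) c) =
   (om + pow_profile (nm (u^~ y))) * ip (u^~ y) (u^~ y).
  by rewrite /ip /radial; ring.
rewrite mulr_gt0 //; first by rewrite ltr_wpDr // powR_ge0.
by apply: le_lt_trans uy; exact: sqr_ge0.
Qed.

Lemma power_solution_slope M : 0 <= M -> exists2 C, 0 <= C &
  forall u v u' v' d, 0 <= d ->
  segment_solution pow_profile om L u v -> segment_solution pow_profile om L u' v' ->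
  [/\ nm (u^~ 0) <= M, nm (u^~ L) <= M, nm (u'^~ 0) <= M & nm (u'^~ L) <= M] ->
  nm (fun c => u c 0 - u' c 0) <= d -> nm (fun c => u c L - u' c L) <= d ->
  [/\ forall x, 0 <= x <= L -> nm (fun c => u c x - u' c x) <= d,
    forall c, `|v c 0 - v' c 0| <= C * d & forall c, `|v c L - v' c L| <= C * d].
Proof.
move=> M0; have [K tm] := truncated_tame M0.
exists (dtn_lip (pow_profile M) K om L).
  rewrite /dtn_lip addr_ge0 ?mulr_ge0 ?invr_ge0 ?addr_ge0 ?lip2_ge0 // ltW //.
move=> u v u' v' d d0 uv uv' [u0 uL u'0 u'L]; rewrite !nm_leP // => d0' dL.
have H := power_solution_bound M0 uv u0 uL.
have H' := power_solution_bound M0 uv' u'0 u'L.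
have {}uv := (segment_solution_truncate _ H).2 uv.
have {}uv' := (segment_solution_truncate _ H').2 uv'.
have sl := segment_solution_slope tm om_gt0 L_gt0 uv uv' d0 d0' dL.
split=> [x xL|c|c]; [|by have [] := sl c|by have [] := sl c].
rewrite nm_leP //.
exact: (segment_solution_dist tm om_gt0 (sqr_ge0 d) uv uv' d0' dL).
Qed.
End PowerNonlinearity.

(** * The decaying solution on the half-line *)

Section HalfLine.
Variables (R : realType) (p om : R).
Hypothesis p_gt1 : 1 < p.
Hypothesis om_gt0 : 0 < om.

Let sw : R := Num.sqrt om.
Let q : R := 2 / (p - 1).
Let bet : R := (p - 1) * sw / 2.

Let p1 : 0 < p - 1. Proof. by rewrite subr_gt0. Qed.
Let p0 : 0 < p + 1. Proof. by rewrite addr_gt0 // (lt_trans _ p_gt1). Qed.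
Let sw_gt0 : 0 < sw. Proof. by rewrite sqrtr_gt0. Qed.
Let swE : sw ^+ 2 = om. Proof. by rewrite sqr_sqrtr // ltW. Qed.
Let bet_gt0 : 0 < bet. Proof. by rewrite divr_gt0 // mulr_gt0. Qed.
Let q_gt0 : 0 < q. Proof. by rewrite divr_gt0. Qed.
Let qbet : q * bet = sw.
Proof. by rewrite /q /bet; field; exact: lt0r_neq0. Qed.

(* The number g for which a (cosh (bet x) + g sinh (bet x))^(-q) is a
   solution with initial value of norm s; see E below. *)
Definition halfline_slope (s : R) : R :=
  Num.sqrt (1 + 2 * pow_profile p s / ((p + 1) * om)).

Notation gam := halfline_slope.

Lemma halfline_slope_sqr s :
  gam s ^+ 2 = 1 + 2 * pow_profile p s / ((p + 1) * om).
Proof.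
rewrite sqr_sqrtr // addr_ge0 // divr_ge0 // mulr_ge0 ?powR_ge0 //; exact: ltW.
Qed.

Lemma halfline_slope_ge1 s : 1 <= gam s.
Proof.
have H : 0 <= 2 * pow_profile p s / ((p + 1) * om).
  by rewrite divr_ge0 // ?mulr_ge0 ?powR_ge0 //; exact: ltW.
by rewrite -[leLHS]sqrtr1 ler_wsqrtr // lerDl.
Qed.

Variable a : plane R.
Notation g := (gam (nm a)).

(* cosh (bet x) + g sinh (bet x), and its derivative *)
Let E x : R := 2^-1 * ((1 + g) * expR (bet * x) + (1 - g) * expR (- bet * x)).
Let E1 x : R := 2^-1 * ((1 + g) * (bet * expR (bet * x)) + (1 - g) * (- bet * expR (- bet * x))).

Let dE (x : R) : der x E (E1 x).
Proof. exact: (derZ _ (derD (derZ _ (der_exp x bet)) (derZ _ (der_exp x (- bet))))). Qed.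

Let dE1 (x : R) : der x E1 (bet ^+ 2 * E x).
Proof.
apply: der_eq (derZ _ (derD (derZ _ (derZ _ (der_exp x bet)))
  (derZ _ (derZ _ (der_exp x (- bet)))))) _.
by rewrite /E; ring.
Qed.

Let EE x : expR (bet * x) * expR (- bet * x) = 1.
Proof. by rewrite -expRD mulNr addrN expR0. Qed.

Let E1_sqr x : E1 x ^+ 2 = bet ^+ 2 * (E x ^+ 2 + (g ^+ 2 - 1)).
Proof.
apply/eqP; rewrite -subr_eq0.
rewrite (_ : _ - _ = bet ^+ 2 * (g ^+ 2 - 1) * (expR (bet * x) * expR (- bet * x) - 1)).
  by rewrite EE subrr mulr0.
by rewrite /E1 /E; field.
Qed.

Let E_ge x : 0 <= x -> expR (bet * x) <= E x.
Proof.
move=> x0; have g1 := halfline_slope_ge1 (nm a).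
have : expR (- bet * x) <= expR (bet * x).
  rewrite ler_expR mulNr; have := mulr_ge0 (ltW bet_gt0) x0; lra.
by rewrite /E; move: (expR _) (expR _) => s t; nra.
Qed.

Let E_gt0 x : 0 <= x -> 0 < E x.
Proof. by move=> x0; apply: lt_le_trans (E_ge x0); exact: expR_gt0. Qed.

Let E1_bound x : 0 <= x -> 0 <= E1 x <= bet * g * E x.
Proof.
move=> x0; have g1 := halfline_slope_ge1 (nm a).
have : expR (- bet * x) <= expR (bet * x).
  rewrite ler_expR mulNr; have := mulr_ge0 (ltW bet_gt0) x0; lra.
have := expR_gt0 (- bet * x).
rewrite (_ : E1 x = bet * (2^-1 * ((1 + g) * expR (bet * x) - (1 - g) * expR (- bet * x)))); last first.
  by rewrite /E1; ring.
rewrite -mulrA; move=> t0 ts; apply/andP; split.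
  apply: mulr_ge0; first exact: ltW.
  by move: (expR _) (expR _) t0 ts => s t t0 ts; nra.
apply: ler_wpM2l; first exact: ltW.
rewrite /E; move: (expR _) (expR _) t0 ts => s t t0 ts.
have := mulr_ge0 (mulr_ge0 (_ : 0 <= g - 1) (_ : 0 <= g + 1)) (_ : 0 <= s - t).
have h1 : 0 <= g - 1 by rewrite subr_ge0.
have h2 : 0 <= g + 1 by lra.
have h3 : 0 <= s - t by rewrite subr_ge0.
by move=> /(_ h1 h2 h3); move: (g) => z; lra.
Qed.

Let Y x := E x `^ (- q).

Let dY (x : R) : 0 <= x -> der x Y (- q * (Y x / E x) * E1 x).
Proof.
move=> x0; have Ex := E_gt0 x0.
have H : der (E x) (fun y => y `^ (- q)) (- q * E x `^ (- q - 1)) by exact: is_derive1_powR.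
apply: der_eq (der_comp H (dE x)) _; congr (_ * _ * _).
by rewrite powRB ?powRr1 ?(ltW Ex) // (lt0r_neq0 Ex) implybT.
Qed.

Definition halfline_u (c : bool) (x : R) : R := a c * Y x.
Definition halfline_v (c : bool) (x : R) : R := a c * (- q * (Y x / E x) * E1 x).

(** Since E1^2 = bet^2 (E^2 + g^2 - 1), the second derivative of E^(-q) is
    the sum of q^2 bet^2 E^(-q) = om E^(-q) and of q (q + 1) bet^2 (g^2 - 1)
    E^(-q - 2); now q + 2 = q p, and g makes the last coefficient equal to
    |a|^(p - 1). *)
Lemma halfline_solution c (x : R) : 0 <= x ->
  der x (halfline_u c) (halfline_v c x) /\
  der x (halfline_v c) (om * halfline_u c x + radial (pow_profile p) (halfline_u^~ x) c).
Proof.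
move=> x0; have Ex := E_gt0 x0; have E0 := lt0r_neq0 Ex.
split; first exact: (derZ _ (dY x0)).
have dEV : der x (fun x => (E x)^-1) (- E1 x / E x ^+ 2).
  apply: der_eq (is_deriveV _ (dE x)) _ => //.
  by rewrite /GRing.scale /= mulrC mulrN mulNr.
apply: der_eq (derZ _ (derM (derZ (- q) (derM (dY x0) dEV)) (dE1 x))) _.
have Y0 : 0 < Y x by exact: powR_gt0.
have -> : radial (pow_profile p) (halfline_u^~ x) c =
    pow_profile p (nm a) / E x ^+ 2 * (a c * Y x).
  rewrite /radial; congr (_ * _).
  have -> : nm (halfline_u^~ x) = nm a * Y x.
    rewrite /nm (_ : ip _ _ = Y x ^+ 2 * ip a a); last by rewrite /ip /halfline_u; ring.
    by rewrite sqrtrM ?sqr_ge0 // sqrtr_sqr gtr0_norm // mulrC.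
  rewrite /pow_profile powRM ?nm_ge0 ?(ltW Y0) //; congr (_ * _).
  rewrite -powRrM (_ : - q * (p - 1) = - 2%:R).
    by rewrite powR_invn // ltW.
  by rewrite /q; field; exact: lt0r_neq0.
have E1E := E1_sqr x; have gE := halfline_slope_sqr (nm a).
rewrite /halfline_u.
have betE : bet ^+ 2 = (p - 1) ^+ 2 * om / 4 by rewrite /bet -swE; field.
transitivity (a c * Y x * (q * (q + 1) * E1 x ^+ 2 / E x ^+ 2 - q * bet ^+ 2)).
  by field.
rewrite E1E gE betE /q; move: (E x) (Y x) (pow_profile p (nm a)) E0 => e y f e0.
by field; rewrite e0 !lt0r_neq0.
Qed.

Lemma halfline_start c : halfline_u c 0 = a c /\ halfline_v c 0 = - (sw * g * a c).
Proof.
have E00 : E 0 = 1 by rewrite /E !mulr0 expR0; field.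
have E10 : E1 0 = bet * g by rewrite /E1 !mulr0 expR0; field.
rewrite /halfline_u /halfline_v /Y E00 E10 powR1 /= -qbet; split; first by rewrite mulr1.
by rewrite divr1; ring.
Qed.

Lemma halfline_decay : exists2 C, 0 <= C & forall c (x : R), 0 <= x ->
  `|halfline_u c x| <= C * expR (- sw * x) /\ `|halfline_v c x| <= C * expR (- sw * x).
Proof.
have g1 := halfline_slope_ge1 (nm a).
have Yx x : 0 <= x -> 0 <= Y x <= expR (- sw * x).
  move=> x0; rewrite powR_ge0 /= /Y powRN -qbet.
  rewrite (_ : - (q * bet) * x = - (bet * x * q)); last by ring.
  rewrite expRN expRM lef_pV2 ?posrE ?powR_gt0 ?E_gt0 ?expR_gt0 //.
  apply: ge0_ler_powR; rewrite ?nnegrE ?(ltW q_gt0) ?expR_ge0 ?(ltW (E_gt0 x0)) //.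
  exact: E_ge.
pose m := nm a.
have sg : 0 <= sw * g by rewrite mulr_ge0 ?(ltW sw_gt0) // (le_trans ler01).
exists (m * (1 + sw * g)) => [|c x x0].
  by rewrite mulr_ge0 ?nm_ge0 // addr_ge0.
have /andP[Y0 Y1] := Yx x x0; have am : `|a c| <= m := coord_le_nm a c.
have Ex := E_gt0 x0; have /andP[E10 E11] := E1_bound x0; split.
  rewrite normrM (ger0_norm Y0) -mulrA; apply: ler_pM => //.
  by apply: le_trans Y1 _; rewrite ler_peMl ?expR_ge0 // lerDl.
rewrite normrM -[leRHS]mulrA; apply: ler_pM => //.
have -> : - q * (Y x / E x) * E1 x = - (q * (E1 x / E x) * Y x).
  by field; exact: lt0r_neq0.
have A0 : 0 <= q * (E1 x / E x).
  by apply: mulr_ge0; [exact: ltW q_gt0|rewrite divr_ge0 // ltW].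
rewrite normrN ger0_norm; last exact: mulr_ge0.
apply: ler_pM => //.
apply: (@le_trans _ _ (sw * g)); last by rewrite lerDr.
rewrite -qbet -mulrA; apply: ler_wpM2l; first exact: ltW.
by rewrite ler_pdivrMr.
Qed.

End HalfLine.

Lemma continuous_pow_profile (R : realType) (p : R) : 1 < p ->
  continuous (fun s : R => pow_profile p `|s|).
Proof.
move=> p1 s; have p0 : 0 < p - 1 by rewrite subr_gt0.
have [->|s0] := eqVneq s 0; last first.
  have s0' : 0 < `|s| by rewrite normr_gt0.
  apply: (@continuous_comp R R R (fun s => `|s|) (pow_profile p)).
    exact: norm_continuous.
  have H : der `|s| (pow_profile p) ((p - 1) * `|s| `^ (p - 1 - 1)) by exact: is_derive1_powR.
  exact: der_continuous H.
apply/cvgrPdist_le => e e0; rewrite normr0 /pow_profile powR0 ?lt0r_neq0 //.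
near=> t; rewrite sub0r normrN ger0_norm ?powR_ge0 //.
have : `|t| <= e `^ (p - 1)^-1.
  near: t; have /cvgrPdist_le/(_ (e `^ (p - 1)^-1)) : (@id R) @ (0 : R) --> (0 : R) by exact: cvg_id.
  rewrite powR_gt0 // => /(_ isT); apply: filterS => t.
  by rewrite sub0r normrN.
move=> te; apply: (@le_trans _ _ ((e `^ (p - 1)^-1) `^ (p - 1))).
  by apply: ge0_ler_powR => //; rewrite ?nnegrE ?powR_ge0 // ltW.
by rewrite -powRrM mulVf ?lt0r_neq0 // powRr1 // ltW.
Unshelve. all: by end_near. Qed.

Lemma continuous_halfline_slope (R : realType) (p om : R) (T : topologicalType)
    (f : bool -> T -> R) : 1 < p -> (forall c, continuous (f c)) ->
  continuous (fun x => halfline_slope p om (nm (f^~ x))).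
Proof.
move=> p1 cf.
have cip : continuous (fun x => ip (f^~ x) (f^~ x)).
  move=> x; apply: cvgD; apply: cvgM; exact: cf.
have cnm : continuous (fun x => nm (f^~ x)).
  move=> x; apply: (@continuous_comp _ _ _ (fun x => ip (f^~ x) (f^~ x)) Num.sqrt).
    exact: cip.
  exact: sqrt_continuous.
have cpw : continuous (fun x => pow_profile p (nm (f^~ x))).
  rewrite (_ : (fun x => _) = (fun s => pow_profile p `|s|) \o (fun x => nm (f^~ x))).
    move=> x; apply: continuous_comp; first exact: cnm.
    exact: continuous_pow_profile.
  by apply/funext => x /=; rewrite ger0_norm // nm_ge0.
move=> x; apply: (@continuous_comp _ _ _
  (fun x => 1 + 2 * pow_profile p (nm (f^~ x)) / ((p + 1) * om)) Num.sqrt).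
  apply: cvgD; first exact: cvg_cst.
  apply: cvgM; last exact: cvg_cst.
  by apply: cvgM; [exact: cvg_cst|exact: cpw].
exact: sqrt_continuous.
Qed.

(** * Integration of decaying functions on an edge *)

Section Decaying.
Variable R : realType.
Notation mu := (@lebesgue_measure R).
(* The edge of length L is [Some L], the half-line is [None]. *)
Implicit Types (o : option R) (f g F : R -> R).

Definition interval o : set R :=
  if o is Some L then `[0, L] else `[0, +oo[.

Definition edge_length_gt0 o : Prop := if o is Some L then 0 < L else True.

Lemma intervalP o x : interval o x <-> 0 <= x /\ (if o is Some L then is_true (x <= L) else True).
Proof.
case: o => [L|] /=; rewrite in_itv /=; first by split=> [/andP[]|[-> ->]].
by rewrite andbT; split=> [|[]].
Qed.

Lemma interval_ge0 o x : interval o x -> 0 <= x.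
Proof. by case/intervalP. Qed.

Lemma measurable_interval o : measurable (interval o : set (measurableTypeR R)).
Proof. by case: o => [L|]; exact: measurable_itv. Qed.

(** Two-sided continuity at each point of the edge, and exponential decay,
    which on a bounded edge is just boundedness. *)
Definition decaying o f : Prop :=
  (forall x, interval o x -> {for x, continuous f}) /\
  exists C nu, [/\ 0 <= C, 0 < nu &
    forall x, interval o x -> `|f x| <= C * expR (- nu * x)].

Lemma expR_mono_rate (nu nu' x : R) : nu <= nu' -> 0 <= x ->
  expR (- nu' * x) <= expR (- nu * x).
Proof. by move=> nn x0; rewrite ler_expR !mulNr lerN2 ler_wpM2r. Qed.

Lemma decayingD o f g : decaying o f -> decaying o g ->
  decaying o (fun x => f x + g x).
Proof.
move=> [cf [C [nu [C0 nu0 fC]]]] [cg [D [ta [D0 ta0 gD]]]]; split.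
  by move=> x ox; apply: cvgD; [exact: cf|exact: cg].
exists (C + D), (Num.min nu ta); split; [exact: addr_ge0|by rewrite lt_min nu0|].
move=> x ox; apply: le_trans (ler_normD _ _) _; rewrite mulrDl; apply: lerD.
  apply: le_trans (fC x ox) _; apply: ler_wpM2l => //.
  by apply: expR_mono_rate (interval_ge0 ox); rewrite ge_min lexx.
apply: le_trans (gD x ox) _; apply: ler_wpM2l => //.
by apply: expR_mono_rate (interval_ge0 ox); rewrite ge_min lexx orbT.
Qed.

Lemma decaying_bounded o f : decaying o f ->
  exists2 B, 0 <= B & forall x, interval o x -> `|f x| <= B.
Proof.
move=> [_ [C [nu [C0 nu0 fC]]]]; exists C => // x ox.
apply: le_trans (fC x ox) _; rewrite ler_piMr // -[leRHS]expR0 ler_expR.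
by rewrite mulNr oppr_le0 mulr_ge0 ?(ltW nu0) // (interval_ge0 ox).
Qed.

Lemma decayingMl o f g B : (forall x, interval o x -> {for x, continuous f}) ->
  (forall x, interval o x -> `|f x| <= B) -> decaying o g ->
  decaying o (fun x => f x * g x).
Proof.
move=> cf fB [cg [C [nu [C0 nu0 gC]]]]; split.
  by move=> x ox; apply: cvgM; [exact: cf|exact: cg].
exists (`|B| * C), nu; split=> //; first exact: mulr_ge0.
move=> x ox; rewrite normrM -mulrA; apply: ler_pM => //; last exact: gC.
exact: le_trans (fB x ox) (ler_norm _).
Qed.

Lemma decayingM o f g : decaying o f -> decaying o g ->
  decaying o (fun x => f x * g x).
Proof.
move=> df dg; have [B _ fB] := decaying_bounded df.
by apply: decayingMl fB dg; case: df.
Qed.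

Lemma decayingZ o f c : decaying o f -> decaying o (fun x => c * f x).
Proof.
move=> df; apply: (@decayingMl o (fun=> c) f `|c|) df => //.
by move=> x _; exact: cst_continuous.
Qed.

Lemma eq_decaying o f g : f =1 g -> decaying o f -> decaying o g.
Proof. by move=> /funext ->. Qed.

Lemma decayingN o f : decaying o f -> decaying o (fun x => - f x).
Proof. by move=> /(decayingZ (-1)); apply: eq_decaying => x; rewrite mulN1r. Qed.

Lemma decayingB o f g : decaying o f -> decaying o g ->
  decaying o (fun x => f x - g x).
Proof. by move=> df /decayingN; exact: decayingD. Qed.

Lemma decaying_expR o nu : 0 < nu -> decaying o (fun x => expR (- nu * x)).
Proof.
move=> nu0; split; first by move=> x _; exact: der_continuous (der_exp x (- nu)).
by exists 1, nu; split=> // x _; rewrite mul1r ger0_norm // expR_ge0.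
Qed.

Lemma decaying0 o : decaying o (fun=> 0).
Proof.
apply: eq_decaying (decayingZ 0 (decaying_expR o ltr01)) => x; exact: mul0r.
Qed.

Lemma within_interval_continuous o f :
  (forall x, interval o x -> {for x, continuous f}) ->
  {within interval o, continuous f}.
Proof.
by move=> cf; apply: continuous_in_subspaceT => x; rewrite inE; exact: cf.
Qed.

Lemma decaying_segment L f : 0 < L ->
  (forall x, 0 <= x <= L -> {for x, continuous f}) -> decaying (Some L) f.
Proof.
move=> L0 cf; have {}cf x : interval (Some L) x -> {for x, continuous f}.
  by rewrite /= in_itv; exact: cf.
split=> //.
have [|m _ mP] := @EVT_max R (fun x => `|f x|) 0 L (ltW L0).
  move=> x; apply: continuous_comp; last exact: norm_continuous.
  exact: (@within_interval_continuous (Some L)).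
exists (`|f m| * expR L), 1; split; [by rewrite mulr_ge0 ?expR_ge0|by []|].
move=> x xL; apply: le_trans (mP x xL) _; rewrite -mulrA ler_peMr //.
rewrite -expRD -[leLHS]expR0 ler_expR mulN1r subr_ge0.
by move: xL; rewrite /= in_itv => /andP[].
Qed.

Lemma cvg_expR_rate nu : 0 < nu -> expR (- nu * x) @[x --> +oo%R] --> (0 : R).
Proof.
move=> nu0; apply/cvgrPdist_lt => e e0.
have /cvgrPdist_lt/(_ e e0) [M [Mr MP]] := @cvgr_expR R.
exists (M / nu); split; first exact: num_real.
move=> x; rewrite ltr_pdivrMr // => Mx.
by have := MP (nu * x); rewrite mulNr; apply; rewrite mulrC.
Qed.

Lemma integrable_expR (nu : R) : 0 < nu ->
  mu.-integrable `[0, +oo[ (EFin \o (fun x => expR (- nu * x))) /\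
  \int[mu]_(x in `[0, +oo[) expR (- nu * x) = nu^-1.
Proof.
move=> nu0; pose F (x : R) := - nu^-1 * expR (- nu * x).
have dF (x : R) : der x F (expR (- nu * x)).
  apply: der_eq (derZ _ (der_exp x (- nu))) _.
  by rewrite mulrA mulrNN mulVf ?mul1r // lt0r_neq0.
have ce : {within `[0, +oo[, continuous (fun x => expR (- nu * x))}.
  by apply: (@within_interval_continuous None) => x _; exact: der_continuous (der_exp x (- nu)).
have E : (\int[mu]_(x in `[0%R, +oo[) (expR (- nu * x))%:E = 0%:E - (F 0)%:E)%E.
  apply: ge0_continuous_FTC2y => //.
  - rewrite -[X in _ --> X](mulr0 (- nu^-1)).
    by apply: cvgM; [exact: cvg_cst|exact: cvg_expR_rate].
  - by apply: cvg_at_right_filter; exact: der_continuous (dF 0).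
  - by move=> x _; rewrite derive1E; case: (dF x).
have F0 : F 0 = - nu^-1 by rewrite /F mulr0 expR0 mulr1.
split; last by rewrite /Rintegral E F0 /= sub0r opprK.
apply/integrableP; split.
  by apply/measurable_EFinP; exact: subspace_continuous_measurable_fun.
under eq_integral => x _ do rewrite /= ger0_norm ?expR_ge0 //.
by rewrite E -EFinB ltry.
Qed.

Lemma decaying_measurable o f : decaying o f -> measurable_fun (interval o) f.
Proof.
move=> [cf _]; apply: subspace_continuous_measurable_fun.
  exact: measurable_interval.
exact: within_interval_continuous.
Qed.

Lemma decaying_integrable o f : decaying o f -> mu.-integrable (interval o) (EFin \o f).
Proof.
move=> df; have mf := decaying_measurable df; case: df => cf [C [nu [C0 nu0 fC]]].
case: o cf fC mf => [L|] cf fC mf.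
  apply: continuous_compact_integrable; first exact: segment_compact.
  exact: (@within_interval_continuous (Some L)).
have [ie _] := integrable_expR nu0.
apply: (le_integrable _ _ _ (integrableZl _ C ie)) => //=.
- exact/measurable_EFinP.
- move=> x ox; rewrite lee_fin; apply: le_trans (fC x ox) _.
  exact: ler_norm.
Qed.

Definition boundary o F : R := if o is Some L then F L - F 0 else - F 0.

(** On the half-line the primitive tends to 0 at infinity, which leaves its
    value at 0. *)
Lemma integral_derivative o f F : edge_length_gt0 o ->
  (forall x, interval o x -> der x F (f x)) -> decaying o f -> decaying o F ->
  \int[mu]_(x in interval o) f x = boundary o F.
Proof.
move=> oL dF df DF; case: o oL dF df DF => [L|] /= oL dF df DF.
  rewrite /Rintegral (@continuous_FTC2 _ f F) //=.
  - by apply: (@within_interval_continuous (Some L)); case: df.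
  - have cF x : 0 <= x <= L -> {for x, continuous F}.
      by move=> xL; apply: der_continuous (dF x _); rewrite in_itv.
    split.
    + move=> x; rewrite in_itv => /andP[x0 xL].
      by case: (dF x) => //; rewrite in_itv /= !ltW.
    + by apply: cvg_at_right_filter; apply: cF; rewrite lexx ltW.
    + by apply: cvg_at_left_filter; apply: cF; rewrite lexx ltW.
  - move=> x; rewrite in_itv => /andP[x0 xL]; rewrite derive1E.
    by case: (dF x) => //; rewrite in_itv /= !ltW.
have := df => -[cf [C [nu [C0 nu0 fC]]]].
have [ie eE] := integrable_expR nu0.
pose g x := f x + C * expR (- nu * x).
pose G x := F x - C / nu * expR (- nu * x).
have G0 : F x @[x --> +oo%R] --> (0 : R).
  case: DF => _ [D [ta [D0 ta0 FD]]].
  have De : D * expR (- ta * x) @[x --> +oo%R] --> (0 : R).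
    rewrite -[X in _ --> X](mulr0 D).
    by apply: cvgM; [exact: cvg_cst|exact: cvg_expR_rate].
  have NDe : - (D * expR (- ta * x)) @[x --> +oo%R] --> (0 : R).
    by rewrite -[X in _ --> X]oppr0; exact: cvgN.
  apply: squeeze_cvgr NDe De; near=> x.
  by rewrite -ler_norml; apply: FD; apply/intervalP; split=> //; near: x; exact: nbhs_pinfty_ge.
have dG (x : R) : interval None x -> der x G (g x).
  move=> ox; apply: der_eq (derB (dF x ox) (derZ _ (der_exp x (- nu)))) _.
  by rewrite /g; field; exact: lt0r_neq0.
have dg : decaying None g by apply: decayingD df (decayingZ C (decaying_expR None nu0)).
have Eg : \int[mu]_(x in `[0, +oo[) g x = 0 - G 0.
  apply: Rintegral_ge0_continuous_FTC2y => //.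
  - move=> x x0; have := fC x; rewrite /= in_itv /= andbT => /(_ x0).
    by rewrite ler_norml /g => /andP[]; lra.
  - by apply: (@within_interval_continuous None); case: dg.
  - rewrite -[X in _ --> X](subr0 0); apply: cvgB => //.
    rewrite -[X in _ --> X](mulr0 (C / nu)).
    by apply: cvgM; [exact: cvg_cst|exact: cvg_expR_rate].
  - by move=> x x0; case: (dG x) => //; rewrite /= in_itv /= andbT ltW.
  - apply: cvg_at_right_filter; apply: der_continuous (dG 0 _).
    by rewrite /= in_itv /= lexx.
  - move=> x; rewrite in_itv /= andbT => x0; rewrite derive1E.
    by case: (dG x) => //; rewrite /= in_itv /= andbT ltW.
have := Eg; rewrite /g RintegralD //; last 2 first.
- exact: decaying_integrable df.
- exact: (decaying_integrable (decayingZ C (decaying_expR None nu0))).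
rewrite RintegralZl // eE /G mulr0 expR0.
move=> H; apply: (addIr (C / nu)); rewrite H; ring.
Unshelve. all: by end_near. Qed.

Lemma le_integral_decaying o f g : decaying o f -> decaying o g ->
  (forall x, interval o x -> f x <= g x) ->
  \int[mu]_(x in interval o) f x <= \int[mu]_(x in interval o) g x.
Proof.
by move=> df dg fg; apply: le_Rintegral => //; [exact: measurable_interval| |];
  exact: decaying_integrable.
Qed.

Lemma integralD_decaying o f g : decaying o f -> decaying o g ->
  \int[mu]_(x in interval o) (f x + g x) =
  \int[mu]_(x in interval o) f x + \int[mu]_(x in interval o) g x.
Proof.
by move=> df dg; apply: RintegralD; [exact: measurable_interval| |];
  exact: decaying_integrable.
Qed.

Lemma integralZ_decaying o f c : decaying o f ->
  \int[mu]_(x in interval o) (c * f x) = c * \int[mu]_(x in interval o) f x.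
Proof.
by move=> df; apply: RintegralZl; [exact: measurable_interval|exact: decaying_integrable].
Qed.

End Decaying.

(** * The action on an edge *)

Section EdgeAction.
Variables (R : realType) (p om : R).
Hypothesis p_gt1 : 1 < p.
Hypothesis om_gt0 : 0 < om.
Notation mu := (@lebesgue_measure R).
Notation paths := (bool -> R -> R).
Implicit Types (o : option R) (u v w z : paths) (a b : plane R).

Let p1 : 0 < p - 1. Proof. by rewrite subr_gt0. Qed.
Let p0 : 0 < p + 1. Proof. by rewrite addr_gt0 // (lt_trans _ p_gt1). Qed.
Let pp : 0 < p. Proof. by rewrite (lt_trans _ p_gt1). Qed.

(* This is |a|^(p+1). *)
Definition pow_term a : R := pow_profile p (nm a) * ip a a.

Lemma pow_termE a : pow_term a = nm a `^ (p + 1).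
Proof.
rewrite /pow_term -nm_sqr /pow_profile; have [->|a0] := eqVneq (nm a) 0.
  by rewrite expr0n mulr0 powR0 // lt0r_neq0.
rewrite -powR_mulrn ?nm_ge0 // -powRD; last by rewrite a0 implybT.
by congr (_ `^ _); ring.
Qed.

Lemma pow_term_ge0 a : 0 <= pow_term a.
Proof. by rewrite mulr_ge0 ?powR_ge0 ?ip_ge0. Qed.

(** Young's inequality for the exponents p + 1 and (p + 1) / p. *)
Lemma pow_term_convex a b :
  (p + 1)^-1 * pow_term a + pow_profile p (nm a) * ip a (fun c => b c - a c)
  <= (p + 1)^-1 * pow_term b.
Proof.
rewrite (_ : ip a (fun c => b c - a c) = ip a b - ip a a); last by rewrite /ip; ring.
have f0 : 0 <= pow_profile p (nm a) by exact: powR_ge0.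
have : pow_profile p (nm a) * ip a b <= pow_profile p (nm a) * (nm a * nm b).
  by rewrite ler_wpM2l // ip_le_nm.
have q0 : 0 < (p + 1) / p by rewrite divr_gt0.
have := conjugate_powR (nm_ge0 b) (powR_ge0 (nm a) p) p0 q0.
have -> : (p + 1)^-1 + ((p + 1) / p)^-1 = 1.
  by field; rewrite !lt0r_neq0.
move=> /(_ erefl).
have -> : (nm a `^ p) `^ ((p + 1) / p) = nm a `^ (p + 1).
  by rewrite -powRrM; congr (_ `^ _); field; exact: lt0r_neq0.
have -> : nm a `^ p = pow_profile p (nm a) * nm a.
  by rewrite -[LHS]mulr_powRB1 ?nm_ge0 // mulrC.
rewrite -!pow_termE.
have -> : pow_term a / ((p + 1) / p) = pow_term a - (p + 1)^-1 * pow_term a.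
  by field; rewrite !lt0r_neq0.
rewrite [pow_term b / _]mulrC mulrBr -/(pow_term a) => H1 H2.
by move: H1 H2; rewrite [_ * (nm a * nm b)]mulrA [nm b * _]mulrC; lra.
Qed.

Definition edge_state o u v : Prop := forall c,
  [/\ forall x, interval o x -> der x (u c) (v c x), decaying o (u c) & decaying o (v c)].

Definition edge_solution o u v : Prop := edge_state o u v /\
  forall c (x : R), interval o x -> der x (v c) (om * u c x + radial (pow_profile p) (u^~ x) c).

Definition quadratic_density u v (x : R) : R :=
  2^-1 * ip (v^~ x) (v^~ x) + om / 2 * ip (u^~ x) (u^~ x).
Definition density u v (x : R) : R :=
  quadratic_density u v x + (p + 1)^-1 * pow_term (u^~ x).
Definition edge_action o u v : R := \int[mu]_(x in interval o) density u v x.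

Lemma decaying_ip o u w : (forall c, decaying o (u c)) -> (forall c, decaying o (w c)) ->
  decaying o (fun x => ip (u^~ x) (w^~ x)).
Proof. by move=> du dw; apply: decayingD; apply: decayingM. Qed.

Lemma continuous_nm (u : paths) (x : R) : (forall c, {for x, continuous (u c)}) ->
  {for x, continuous (fun x => nm (u^~ x))}.
Proof.
move=> cu; apply: (@continuous_comp R R R (fun x => ip (u^~ x) (u^~ x)) Num.sqrt).
  by apply: cvgD; apply: cvgM; exact: cu.
exact: sqrt_continuous.
Qed.

Lemma decaying_profile o u (f : R -> R) : (forall c, decaying o (u c)) -> decaying o f ->
  decaying o (fun x => pow_profile p (nm (u^~ x)) * f x).
Proof.
move=> du df.
have [B _ uB] := decaying_bounded (decaying_ip du du).
have B0 x : interval o x -> nm (u^~ x) <= Num.sqrt B.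
  move=> ox; rewrite /nm ler_wsqrtr //.
  exact: le_trans (ler_norm _) (uB x ox).
apply: (@decayingMl _ o _ _ (pow_profile p (Num.sqrt B))) df.
  move=> x ox.
  rewrite (_ : (fun x => _) = (fun s : R => pow_profile p `|s|) \o (fun x => nm (u^~ x))).
    apply: continuous_comp; last exact: continuous_pow_profile.
    by apply: continuous_nm => c; case: (du c) => + _; exact.
  by apply/funext => y /=; rewrite ger0_norm // nm_ge0.
move=> x ox; rewrite ger0_norm ?powR_ge0 //.
by apply: pow_profile_mono => //; [exact: nm_ge0|exact: B0].
Qed.

Lemma decaying_quadratic_density o u v : edge_state o u v ->
  decaying o (quadratic_density u v).
Proof.
move=> uv; apply: decayingD; apply: decayingZ; apply: decaying_ip => c;
  by have [] := uv c.
Qed.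

Lemma decaying_pow_term o u v : edge_state o u v -> decaying o (fun x => pow_term (u^~ x)).
Proof.
move=> uv; have du c : decaying o (u c) by have [] := uv c.
by apply: decaying_profile => //; exact: decaying_ip.
Qed.

Lemma decaying_density o u v : edge_state o u v -> decaying o (density u v).
Proof.
move=> uv; apply: decayingD; first exact: decaying_quadratic_density.
by apply: decayingZ; exact: decaying_pow_term uv.
Qed.

(** The action is convex, so that it lies above its tangent at a solution;
    after an integration by parts the tangent is a boundary term. *)
Theorem edge_action_convex o u v w z : edge_length_gt0 o ->
  edge_solution o u v -> edge_state o w z ->
  edge_action o u v + boundary o (fun x => ip (v^~ x) (fun c => w c x - u c x))
  <= edge_action o w z.
Proof.
move=> oL [uv eq] wz.
have du c : decaying o (u c) by have [] := uv c.
have dv c : decaying o (v c) by have [] := uv c.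
have dw c : decaying o (w c) by have [] := wz c.
have dz c : decaying o (z c) by have [] := wz c.
have dwu c : decaying o (fun x => w c x - u c x) by exact: decayingB.
have dzv c : decaying o (fun x => z c x - v c x) by exact: decayingB.
pose a c x := om * u c x + pow_profile p (nm (u^~ x)) * u c x.
have da c : decaying o (a c).
  apply: decayingD; first exact: decayingZ.
  exact: decaying_profile.
pose g x := ip (a^~ x) (fun c => w c x - u c x) + ip (v^~ x) (fun c => z c x - v c x).
have dg : decaying o g.
  by apply: decayingD; apply: (@decaying_ip o _ (fun c x => _)).
have <- : \int[mu]_(x in interval o) g x =
    boundary o (fun x => ip (v^~ x) (fun c => w c x - u c x)).
  apply: integral_derivative => //.
    move=> x ox; have d c : der x (fun x => v c x * (w c x - u c x))
        ((om * u c x + radial (pow_profile p) (u^~ x) c) * (w c x - u c x)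
         + v c x * (z c x - v c x)).
      have [dw1 _ _] := wz c; have [du1 _ _] := uv c.
      exact: derM (eq c x ox) (derB (dw1 x ox) (du1 x ox)).
    by apply: der_eq (derD (d false) (d true)) _; rewrite /g /ip /a /radial; ring.
  exact: (@decaying_ip o v (fun c x => w c x - u c x)).
rewrite /edge_action -integralD_decaying //; last exact: decaying_density.
apply: le_integral_decaying.
- by apply: decayingD => //; exact: decaying_density.
- exact: decaying_density.
move=> x ox; rewrite /density /quadratic_density /g.
have := pow_term_convex (u^~ x) (w^~ x).
have := ip_ge0 (fun c => z c x - v c x).
have := mulr_ge0 (ltW om_gt0) (ip_ge0 (fun c => w c x - u c x)).
move: (pow_term _) (pow_term _) => P Q.
rewrite /a /ip /=; lra.
Qed.

(** The squares of the end values are controlled by a small part of the energy,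
    since the potential grows faster than quadratically. *)
Theorem edge_action_coercive o K : edge_length_gt0 o -> 0 <= K ->
  exists C, forall u v, edge_state o u v ->
  K * (ip (u^~ 0) (u^~ 0) + (if o is Some L then ip (u^~ L) (u^~ L) else 0))
  <= edge_action o u v + C.
Proof.
move=> oL K0.
(* A weight with value 1 at 0, and -1 at L, bounded by [ka]. *)
have [th [th1 [ka [c [c0 [thd dka thka b1]]]]]] : exists (th th1 ka : R -> R) (c : R), 0 <= c /\
  [/\ forall x, interval o x -> der x th (th1 x) /\ {for x, continuous th1},
      decaying o ka,
      forall x, interval o x -> [/\ 0 <= ka x <= 1, `|th x| <= ka x & `|th1 x| <= c * ka x]
    & forall F, boundary o (fun x => th x * F x) = - (F 0 + (if o is Some L then F L else 0))].
  case: o oL => [L|] /= oL.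
    exists (fun x => 1 - 2 / L * x), (fun=> - (2 / L)), (fun=> 1), (2 / L); split.
      by rewrite divr_ge0 // ltW.
    split.
    - move=> x _; split; last exact: cst_continuous.
      by apply: der_eq (derB (der_cst x 1) (derZ (2 / L) (der_id x))) _; ring.
    - by apply: decaying_segment => // x _; exact: cst_continuous.
    - move=> x; rewrite in_itv /= => /andP[x0 xL].
      have L2 : 0 <= 2 / L by rewrite divr_ge0 // ltW.
      rewrite ler01 lexx; split=> //; last by rewrite normrN mulr1 ger0_norm.
      rewrite ler_norml; have H1 : 0 <= 2 / L * x by rewrite mulr_ge0.
      have : 2 / L * x <= 2 by rewrite mulrAC ler_pdivrMr //; lra.
      by move=> H2; apply/andP; split; lra.
    - by move=> F; rewrite mulr0 subr0 mul1r divfK ?lt0r_neq0 //; ring.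
  exists (fun x => expR (- 1 * x)), (fun x => - 1 * expR (- 1 * x)), (fun x => expR (- 1 * x)), 1.
  split=> //; split.
  - move=> x _; split; first exact: der_exp.
    exact: der_continuous (derZ (-1) (der_exp x (-1))).
  - exact: decaying_expR.
  - move=> x ox; have x0 := @interval_ge0 _ None x ox.
    rewrite expR_ge0 normrM normrN1 !mul1r ger0_norm ?expR_ge0 //; split=> //.
    by rewrite -[leRHS]expR0 ler_expR mulN1r oppr_le0.
  - by move=> F; rewrite mulr0 expR0 mul1r addr0.
pose K' := K * c + 2 * K ^+ 2.
have K'0 : 0 <= K' by rewrite addr_ge0 ?mulr_ge0 // sqr_ge0.
have [C' C'0 potential] : exists2 C', 0 <= C' & forall a, K' * ip a a <= (p + 1)^-1 * pow_term a + C'.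
  pose s0 := (K' * (p + 1)) `^ (p - 1)^-1.
  exists (K' * s0 ^+ 2) => [|a]; first by rewrite mulr_ge0 // sqr_ge0.
  rewrite /pow_term -nm_sqr; have [as0|s0a] := leP (nm a) s0.
    apply: le_trans (_ : K' * s0 ^+ 2 <= _).
      by rewrite ler_wpM2l // ler_pXn2r ?nnegrE ?nm_ge0 ?powR_ge0.
    by rewrite lerDr mulr_ge0 ?invr_ge0 ?(ltW p0) // mulr_ge0 ?powR_ge0 ?sqr_ge0.
  apply: le_trans (_ : (p + 1)^-1 * (pow_profile p (nm a) * nm a ^+ 2) <= _); last first.
    by rewrite lerDl mulr_ge0 // sqr_ge0.
  rewrite [leRHS]mulrA; apply: ler_wpM2r; first exact: sqr_ge0.
  rewrite ler_pdivlMl // mulrC.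
  have -> : K' * (p + 1) = pow_profile p s0.
    rewrite /pow_profile -powRrM mulVf ?lt0r_neq0 // powRr1 // mulr_ge0 //; exact: ltW.
  by apply: pow_profile_mono => //; [exact: powR_ge0|exact: ltW].
exists (C' * \int[mu]_(x in interval o) ka x) => u v uv.
have du c' : decaying o (u c') by have [] := uv c'.
have dv c' : decaying o (v c') by have [] := uv c'.
have dth (f : R -> R) : decaying o f -> decaying o (fun x => th x * f x).
  apply: (@decayingMl _ o th f 1) => x ox; first by have [d _] := thd x ox; exact: der_continuous d.
  by have [/andP[_ k1] tk _] := thka x ox; exact: le_trans tk k1.
have dth1 (f : R -> R) : decaying o f -> decaying o (fun x => th1 x * f x).
  apply: (@decayingMl _ o th1 f c) => x ox; first by have [_] := thd x ox.
  by have [/andP[_ k1] _ tk] := thka x ox; apply: le_trans tk _; rewrite ler_piMr.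
have duu := decaying_ip du du; have duv := decaying_ip du dv.
pose g x := th1 x * ip (u^~ x) (u^~ x) + 2 * (th x * ip (u^~ x) (v^~ x)).
have dg : decaying o g by apply: decayingD; [exact: dth1|apply: decayingZ; exact: dth].
have Eg : \int[mu]_(x in interval o) g x =
    - (ip (u^~ 0) (u^~ 0) + (if o is Some L then ip (u^~ L) (u^~ L) else 0)).
  rewrite -(b1 (fun x => ip (u^~ x) (u^~ x))); apply: integral_derivative => //; last exact: dth.
  move=> x ox; have [dt _] := thd x ox.
  have d c' : der x (u c') (v c' x) by have [H _ _] := uv c'; exact: H.
  apply: der_eq (derM dt (derD (derM (d false) (d false)) (derM (d true) (d true)))) _.
  by rewrite /g /ip; ring.
rewrite -[X in K * X]opprK -Eg mulrN -mulNr -integralZ_decaying //.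
rewrite -(integralZ_decaying C' dka) /edge_action -integralD_decaying; last 2 first.
- exact: decaying_density.
- exact: decayingZ.
apply: le_integral_decaying.
- exact: decayingZ.
- by apply: decayingD; [exact: decaying_density|exact: decayingZ].
move=> x ox; have [/andP[k0 k1] tk t1k] := thka x ox.
rewrite /density /quadratic_density /g.
set U := u^~ x; set V := v^~ x.
have H1 : - K * (th1 x * ip U U) <= K * c * ka x * ip U U.
  rewrite mulrA mulNr; apply: ler_wpM2r; first exact: ip_ge0.
  rewrite -mulrN -mulrA; apply: ler_wpM2l => //.
  by apply: le_trans (ler_norm _) _; rewrite normrN.
have H2 : - K * (2 * (th x * ip U V)) <= 2^-1 * ip V V + 2 * K ^+ 2 * ka x * ip U U.
  have t2 : th x ^+ 2 <= ka x.
    rewrite -real_normK ?num_real // expr2; apply: le_trans (_ : 1 * ka x <= _); last by rewrite mul1r.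
    by apply: ler_pM => //; exact: le_trans tk k1.
  have := ip_ge0 (fun c => V c + 2 * K * th x * U c).
  have : 2 * K ^+ 2 * th x ^+ 2 * ip U U <= 2 * K ^+ 2 * ka x * ip U U.
    apply: ler_wpM2r; first exact: ip_ge0.
    by apply: ler_wpM2l => //; rewrite mulr_ge0 // sqr_ge0.
  rewrite (_ : ip (fun c => V c + _) _ = ip V V + 4 * K * th x * ip U V + 4 * K ^+ 2 * th x ^+ 2 * ip U U).
    by move=> h1 h2; lra.
  by rewrite /ip; ring.
have H3 : ka x * (K' * ip U U) <= (p + 1)^-1 * pow_term U + C' * ka x.
  apply: le_trans (ler_wpM2l k0 (potential U)) _.
  rewrite mulrDr [ka x * C']mulrC lerD2r; apply: ler_piMl => //.
  by rewrite mulr_ge0 ?pow_term_ge0 // invr_ge0 ltW.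
have := mulr_ge0 (ltW om_gt0) (ip_ge0 U).
by move: H1 H2 H3; rewrite /K'; lra.
Qed.

End EdgeAction.

(** * Weak derivatives on an edge *)

Section Bumps.
Variable R : realType.
Implicit Types (f : R -> R) (x a b : R).

Lemma der_of_quadratic_bound f x d K :
  (forall h, `|f (x + h) - f x - d * h| <= K * h ^+ 2) -> der x f d.
Proof.
move=> fK.
have cv : h^-1 *: (f (h *: (1 : R) + x) - f x) @[h --> (0 : R)^'] --> d.
  apply/cvgrPdist_le => e e0.
  have K1 : 0 < `|K| + 1 by rewrite ltr_wpDl.
  have : \forall h \near (0 : R)^', `|h| < e / (`|K| + 1).
    exact: (dnbhs0_lt (divr_gt0 e0 K1)).
  have h0 : \forall h \near (0 : R)^', h != 0 by exact: nbhs_dnbhs_neq.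
  move: h0; apply: filterS2 => h h0 hK.
  rewrite (_ : d - _ = - (h^-1 * (f (x + h) - f x - d * h))); last first.
    by rewrite /GRing.scale /= mulr1 [h + x]addrC; field.
  rewrite normrN normrM normfV ler_pdivrMl ?normr_gt0 //.
  apply: le_trans (fK h) _; rewrite -real_normK ?num_real // expr2 mulrCA.
  apply: ler_wpM2l => //; apply: (@le_trans _ _ ((`|K| + 1) * `|h|)).
    by apply: ler_wpM2r => //; apply: le_trans (ler_norm K) _; rewrite lerDl.
  by rewrite mulrC -ler_pdivlMr // ltW.
split; first by apply/cvg_ex; exists d.
exact: cvg_lim cv.
Qed.

Definition pos_sqr x : R := Num.max x 0 ^+ 2.

Lemma der_pos_sqr x : der x pos_sqr (2 * Num.max x 0).
Proof.
apply: (@der_of_quadratic_bound _ _ _ 1) => h; rewrite mul1r /pos_sqr ler_norml.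
have [x0|x0] := leP x 0; have [xh|xh] := leP (x + h) 0;
  rewrite ?expr0n /=; apply/andP; split; nra.
Qed.

Lemma continuous_max0 : continuous (fun x : R => Num.max x 0).
Proof.
move=> x; apply: (@continuous_max _ _ (fun x => x) (fun=> 0)); first exact: id.
exact: cst_continuous.
Qed.

End Bumps.

Section WeakDerivative.
Variable R : realType.
Notation mu := (@lebesgue_measure R).
Implicit Types (o : option R) (f g : R -> R) (a b x : R).

Lemma ae_mono (P Q : R -> Prop) : (forall x, P x -> Q x) ->
  {ae mu, forall x, P x} -> {ae mu, forall x, Q x}.
Proof. by move=> PQ; apply: negligibleS => x /= nQ /PQ. Qed.

Lemma ae_and (P Q : R -> Prop) : {ae mu, forall x, P x} -> {ae mu, forall x, Q x} ->
  {ae mu, forall x, P x /\ Q x}.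
Proof.
move=> aP aQ; apply: negligibleS (negligibleU aP aQ) => x /= /not_andP[nP|nQ].
  by left.
by right.
Qed.

(* The closed segment [a, b] lies in the interior of the edge. *)
Definition inner o a b : Prop := 0 < a /\ (if o is Some L then b < L else True).

Lemma inner_interval o a b x : inner o a b -> a <= x <= b -> interval o x.
Proof.
move=> [a0 bL] /andP[ax xb]; apply/intervalP; split; first exact: le_trans (ltW a0) ax.
by case: o bL => // L bL; exact: le_trans xb (ltW bL).
Qed.

Lemma interior_intervalP o x : (interval o)° x <-> inner o x x.
Proof.
case: o => [L|]; rewrite /interval /inner.
  by rewrite interior_itv_bnd /= in_itv /=; split=> [/andP[]|[-> ->]].
by rewrite interior_itv_bndy /= in_itv /= andbT; split=> [|[]].
Qed.

Definition bump o (phi phi1 : R -> R) : Prop :=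
  [/\ forall x, der x phi (phi1 x), continuous phi1 &
     exists a b, [/\ a <= b, inner o a b & forall x, ~ (a <= x <= b) -> phi x = 0 /\ phi1 x = 0]].

Lemma test_fun_bump o phi : edge_length_gt0 o -> test_fun (interval o) phi ->
  bump o phi (derive1 phi).
Proof.
move=> oL [dphi cphi [K [cK KI] K0]].
have dphi1 x : der x phi (derive1 phi x) by split=> //; rewrite derive1E.
split=> //.
have [a [b [ab iab Kab]]] : exists a b, [/\ a <= b, inner o a b & K `<=` `[a, b]].
  have [Kn0|Kn0] := pselect (K !=set0); last first.
    have [c [c0 cL]] : exists c, inner o c c.
      case: o oL {KI} => [L|] /= L0; last by exists 1.
      by exists (L / 2); split; rewrite ?divr_gt0 // ltr_pdivrMr // ltr_pMr ?ltr1n.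
    by exists c, c; split=> // x Kx; exfalso; apply: Kn0; exists x.
  have cid : {within K, continuous (fun x : R => x)} by apply: continuous_subspaceT => x; exact: id.
  have [a aK amin] := compact_EVT_min Kn0 cK cid.
  have [b bK bmax] := compact_EVT_max Kn0 cK cid.
  move: aK bK; rewrite !inE => aK bK.
  exists a, b; split.
  - by apply: amin; rewrite inE.
  - by have [? _] := (interior_intervalP o a).1 (KI _ aK); have [_ ?] := (interior_intervalP o b).1 (KI _ bK).
  - by move=> x Kx; rewrite /= in_itv /= amin ?bmax ?inE.
exists a, b; split=> // x xab; have phi0 y : ~ (a <= y <= b) -> phi y = 0.
  by move=> yab; apply: K0 => /Kab; rewrite /= in_itv.
split; first exact: phi0.
suff d0 : der x phi 0 by rewrite derive1E; case: d0.
apply: (@near_eq_is_derive _ _ _ (fun=> 0) phi) => //.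
have : (~` `[a, b]) x by rewrite /= in_itv.
have : open (~` `[a, b] : set R) by apply: closed_openC; exact: itv_closed.
rewrite openE => H /H; rewrite /interior; apply: filterS => y /= yab.
by apply/esym/phi0; move: yab; rewrite in_itv.
Qed.

Lemma bump_test_fun o phi phi1 : bump o phi phi1 ->
  test_fun (interval o) phi /\ derive1 phi = phi1.
Proof.
move=> [dphi cphi1 [a [b [ab iab phi0]]]].
have E : derive1 phi = phi1 by apply/funext => x; rewrite derive1E; case: (dphi x).
split=> //; split; rewrite ?E //.
exists `[a, b]%classic.
  split; first exact: segment_compact.
  move=> x; rewrite /= in_itv /= => /andP[ax xb]; apply/interior_intervalP.
  case: iab => a0 bL; split; first exact: lt_le_trans a0 ax.
  by case: o bL {phi0} => // L bL; exact: le_lt_trans xb bL.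
by move=> x /= xab; apply: (phi0 x _).1; move: xab; rewrite in_itv.
Qed.

(** Functions that can be paired with bumps. *)
Definition locint o g : Prop := measurable_fun (interval o) g /\
  forall a b, inner o a b -> mu.-integrable `[a, b] (EFin \o g).

Lemma locint_continuous o g : (forall x, interval o x -> {for x, continuous g}) ->
  locint o g.
Proof.
move=> cg; split.
  apply: subspace_continuous_measurable_fun; first exact: measurable_interval.
  exact: within_interval_continuous.
move=> a b iab; apply: continuous_compact_integrable; first exact: segment_compact.
apply: continuous_in_subspaceT => x; rewrite inE /= in_itv /= => xab.
exact: cg (inner_interval iab xab).
Qed.

Lemma measurable_segment a b : measurable (`[a, b]%classic : set (measurableTypeR R)).
Proof. exact: measurable_itv. Qed.

Lemma locintB o f g : locint o f -> locint o g -> locint o (fun x => f x - g x).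
Proof.
move=> [mf lf] [mg lg]; split; first exact: measurable_funB.
move=> a b iab; have := integrableB (measurable_segment a b) (lf a b iab) (lg a b iab).
by apply: eq_integrable => //; exact: measurable_segment.
Qed.

Lemma locint_sqr o g : measurable_fun (interval o) g ->
  (\int[mu]_(x in interval o) (g x ^+ 2)%:E < +oo)%E -> locint o g.
Proof.
move=> mg g2; split=> // a b iab.
have sub : `[a, b]%classic `<=` interval o.
  by move=> x; rewrite /= in_itv; exact: inner_interval.
have mgab : measurable_fun `[a, b] g := measurable_funS (measurable_interval o) sub mg.
have ig2 : mu.-integrable (interval o) (EFin \o (fun x => g x ^+ 2)).
  apply/integrableP; split; first by apply/measurable_EFinP; exact: measurable_funX.
  by under eq_integral => x _ do rewrite /= ger0_norm ?sqr_ge0 //.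
have ig2ab := integrableS (measurable_interval o) (measurable_segment a b) sub ig2.
have i1 : mu.-integrable `[a, b] (EFin \o (fun=> 1 : R)).
  apply: continuous_compact_integrable; first exact: segment_compact.
  by apply: continuous_subspaceT => x; exact: cst_continuous.
apply: (le_integrable (measurable_segment a b) _ _ (integrableD (measurable_segment a b) i1 ig2ab)).
  exact/measurable_EFinP.
move=> x _; rewrite /= lee_fin [`|_ + _|]ger0_norm ?addr_ge0 ?sqr_ge0 //.
rewrite -[g x ^+ 2]real_normK ?num_real //.
by have := sqr_ge0 (`|g x| - 1); have := normr_ge0 (g x); nra.
Qed.

Section Pairing.
Variables (o : option R) (a b : R) (phi : R -> R).
Hypothesis iab : inner o a b.
Hypothesis cphi : continuous phi.
Hypothesis phi0 : forall x, ~ (a <= x <= b) -> phi x = 0.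

Let sub : `[a, b]%classic `<=` interval o.
Proof. by move=> x; rewrite /= in_itv; exact: inner_interval. Qed.

Let patch g : (fun x => g x * phi x) \_ (interval o) = (fun x => g x * phi x) \_ `[a, b].
Proof.
apply/funext => x; rewrite !patchE; case: ifPn => ox; case: ifPn => xab //.
  by move: xab; rewrite notin_setE /= in_itv /= => /phi0 ->; rewrite mulr0.
by move: xab ox; rewrite inE => /sub ? /negP; rewrite inE.
Qed.

Lemma pairing_segment g :
  \int[mu]_(x in interval o) (g x * phi x) = \int[mu]_(x in `[a, b]) (g x * phi x).
Proof. by rewrite Rintegral_mkcond patch -Rintegral_mkcond. Qed.

Lemma pairing_integrable_segment g : locint o g ->
  mu.-integrable `[a, b] (EFin \o (fun x => g x * phi x)).
Proof.
move=> [mg lg].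
have mgab : measurable_fun `[a, b] g := measurable_funS (measurable_interval o) sub mg.
have mphi : measurable_fun `[a, b] phi.
  apply: subspace_continuous_measurable_fun; first exact: measurable_segment.
  exact: continuous_subspaceT.
have [B B0 phiB] : exists2 B, 0 <= B & forall x, `|phi x| <= B.
  have [ab|ba] := leP a b; last first.
    exists 0 => // x; rewrite phi0 ?normr0 // => /andP[ax xb].
    by have := le_lt_trans (le_trans ax xb) ba; rewrite ltxx.
  have cn : {within `[a, b], continuous (fun x => `|phi x|)}.
    apply: continuous_subspaceT => x.
    apply: (@continuous_comp R R R phi (fun y => `|y|)); first exact: cphi.
    exact: norm_continuous.
  have [m _ mP] := EVT_max ab cn.
  exists `|phi m| => // x; have [xab|xab] := pselect (is_true (a <= x <= b)).
    by apply: mP; rewrite in_itv.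
  by rewrite phi0 // normr0.
have iB := integrableZl (measurable_segment a b) B (lg a b iab).
apply: (le_integrable (measurable_segment a b) _ _ iB).
  by apply/measurable_EFinP; exact: measurable_funM.
move=> x _; rewrite /= lee_fin !normrM mulrC.
by apply: ler_pM => //; apply: le_trans (phiB x) (ler_norm _).
Qed.

Lemma pairing_integrable g : locint o g ->
  mu.-integrable (interval o) (EFin \o (fun x => g x * phi x)).
Proof.
move=> lg; apply/(integrable_mkcond _ (measurable_interval o)).
have /(integrable_mkcond _ (measurable_segment a b)) := pairing_integrable_segment lg.
by rewrite !restrict_EFin patch.
Qed.

Lemma pairingB f g : locint o f -> locint o g ->
  \int[mu]_(x in interval o) ((f x - g x) * phi x) =
  \int[mu]_(x in interval o) (f x * phi x) - \int[mu]_(x in interval o) (g x * phi x).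
Proof.
move=> lf lg; rewrite -RintegralB; [|exact: measurable_interval|exact: pairing_integrable..].
by apply: eq_Rintegral => x _; rewrite mulrBl.
Qed.

Lemma pairing_ae f g : locint o f -> locint o g ->
  {ae mu, forall x, interval o x -> f x = g x} ->
  \int[mu]_(x in interval o) (f x * phi x) = \int[mu]_(x in interval o) (g x * phi x).
Proof.
move=> lf lg fg; congr fine; apply: ae_eq_integral; first exact: measurable_interval.
- exact: (measurable_int _ (pairing_integrable lf)).
- exact: (measurable_int _ (pairing_integrable lg)).
by apply: ae_mono fg => x fgx ox; rewrite fgx.
Qed.

End Pairing.

(** The product vanishes at both ends of the edge, since the support of the
    bump lies inside. *)
Lemma bump_parts o f f1 phi phi1 : edge_length_gt0 o ->
  (forall x, interval o x -> der x f (f1 x)) ->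
  (forall x, interval o x -> {for x, continuous f1}) -> bump o phi phi1 ->
  \int[mu]_(x in interval o) (f x * phi1 x) = - \int[mu]_(x in interval o) (f1 x * phi x).
Proof.
move=> oL df cf1 [dphi cphi1 [a [b [ab iab phi0]]]].
have cf x : interval o x -> {for x, continuous f} by move=> /df; exact: der_continuous.
have cphi : continuous phi by move=> x; exact: der_continuous (dphi x).
have dec g psi : (forall x, interval o x -> {for x, continuous g}) -> continuous psi ->
    (forall x, ~ (a <= x <= b) -> psi x = 0) -> decaying o (fun x => g x * psi x).
  move=> cg cpsi psi0; have c x : interval o x -> {for x, continuous (fun x => g x * psi x)}.
    by move=> ox; apply: cvgM; [exact: cg|exact: cpsi].
  have b0 : 0 < b by case: iab => a0 _; exact: lt_le_trans a0 ab.
  have sub x : 0 <= x <= b -> interval o x.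
    move=> /andP[x0 xb]; apply/intervalP; split=> //.
    by case: o iab {oL df cf1 cf cg c} => // L [_ bL]; exact: le_trans xb (ltW bL).
  have [_ [C [nu [C0 nu0 bC]]]] : decaying (Some b) (fun x => g x * psi x).
    by apply: decaying_segment => // x /sub; exact: c.
  split=> //; exists C, nu; split=> // x ox.
  have [xab|xab] := pselect (is_true (a <= x <= b)); last first.
    by rewrite psi0 // mulr0 normr0 mulr_ge0 // expR_ge0.
  apply: bC; rewrite /= in_itv /= (interval_ge0 ox) /=.
  by case/andP: xab.
have d1 := dec _ _ cf cphi1 (fun x xab => (phi0 x xab).2).
have d2 := dec _ _ cf1 cphi (fun x xab => (phi0 x xab).1).
have d3 := dec _ _ cf cphi (fun x xab => (phi0 x xab).1).
apply/eqP; rewrite -subr_eq0 opprK -integralD_decaying //; apply/eqP.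
have -> : \int[mu]_(x in interval o) (f x * phi1 x + f1 x * phi x) =
    boundary o (fun x => f x * phi x).
  apply: integral_derivative => //; last exact: decayingD.
  by move=> x ox; apply: der_eq (derM (df x ox) (dphi x)) _; rewrite addrC.
have phi00 : phi 0 = 0.
  by apply: (phi0 0 _).1 => /andP[a0 _]; case: iab => /lt_geF; rewrite a0.
rewrite /boundary; case: o iab {oL df cf1 cf dec d1 d2 d3} => [L|] [_ bL]; rewrite phi00 mulr0 ?subr0 ?oppr0 //.
by rewrite (phi0 L _).1 ?mulr0 // => /andP[_ Lb]; rewrite leNgt bL in Lb.
Qed.

(** Bumps approximate the indicator function of a segment. *)
Let step (n : nat) a b x : R := n%:R * (pos_sqr (x - a) * pos_sqr (b - x)).
Let approx n a b x : R := 1 - pos_sqr (1 - step n a b x).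

Let pos_sqr_ge0 x : 0 <= pos_sqr x. Proof. exact: sqr_ge0. Qed.

Let pos_sqr0 x : x <= 0 -> pos_sqr x = 0.
Proof. by move=> x0; rewrite /pos_sqr max_r // expr0n. Qed.

Let step_ge0 n a b x : 0 <= step n a b x.
Proof. exact: mulr_ge0 (ler0n _ n) (mulr_ge0 (pos_sqr_ge0 _) (pos_sqr_ge0 _)). Qed.

Let approx0 n a b x : ~ (a < x < b) -> approx n a b x = 0.
Proof.
move=> xab; rewrite /approx (_ : step n a b x = 0).
  by rewrite subr0 /pos_sqr max_l // expr1n subrr.
rewrite /step; have [xa|ax] := leP x a.
  by rewrite (@pos_sqr0 (x - a)) ?mul0r ?mulr0 // subr_le0.
by rewrite (@pos_sqr0 (b - x)) ?mulr0 // subr_le0 leNgt; apply/negP => xb; apply: xab; rewrite ax.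
Qed.

Let approx_itv n a b x : 0 <= approx n a b x <= 1.
Proof.
have s0 := step_ge0 n a b x; have p0 := pos_sqr_ge0 (1 - step n a b x).
rewrite /approx subr_ge0 lerBlDr lerDl p0 andbT /pos_sqr.
by rewrite expr_le1 // ?le_max ?lexx ?orbT // ge_max ler01 andbT; lra.
Qed.

Let approx1 a b x : a < x < b -> exists N : nat, forall n, (N <= n)%N -> approx n a b x = 1.
Proof.
move=> /andP[ax xb]; pose t := pos_sqr (x - a) * pos_sqr (b - x).
have t0 : 0 < t.
  by rewrite mulr_gt0 // /pos_sqr max_l ?exprn_gt0 ?subr_gt0 // ltW // subr_gt0.
exists (Num.bound t^-1) => n nN; rewrite /approx pos_sqr0 ?subr0 // subr_le0 /step -/t.
rewrite -ler_pdivrMr // mul1r; apply: le_trans (ltW (archi_boundP _)) _.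
  by rewrite invr_ge0 ltW.
by rewrite ler_nat.
Qed.

Let bump_approx o n a b : a <= b -> inner o a b -> exists phi1, bump o (approx n a b) phi1.
Proof.
move=> ab iab.
pose s1 x := n%:R * (2 * Num.max (x - a) 0 * pos_sqr (b - x) - pos_sqr (x - a) * (2 * Num.max (b - x) 0)).
have ds (x : R) : der x (step n a b) (s1 x).
  have da : der x (fun x => x - a) 1.
    by apply: der_eq (derB (der_id x) (der_cst x a)) _; rewrite subr0.
  have db : der x (fun x => b - x) (- 1).
    by apply: der_eq (derB (der_cst x b) (der_id x)) _; rewrite sub0r.
  have Ha : der x (fun x => pos_sqr (x - a)) (2 * Num.max (x - a) 0 * 1).
    exact: (@der_comp _ x (@pos_sqr R) (fun x => x - a) _ _ (der_pos_sqr _) da).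
  have Hb : der x (fun x => pos_sqr (b - x)) (2 * Num.max (b - x) 0 * -1).
    exact: (@der_comp _ x (@pos_sqr R) (fun x => b - x) _ _ (der_pos_sqr _) db).
  apply: der_eq (derZ n%:R (derM Ha Hb)) _.
  by rewrite /s1; ring.
pose p1 x := 2 * Num.max (1 - step n a b x) 0 * s1 x.
have dp (x : R) : der x (approx n a b) (p1 x).
  have H : der x (fun x => pos_sqr (1 - step n a b x))
      (2 * Num.max (1 - step n a b x) 0 * (0 - s1 x)).
    exact: (@der_comp _ x (@pos_sqr R) (fun x => 1 - step n a b x) _ _
      (der_pos_sqr _) (derB (der_cst x 1) (ds x))).
  apply: der_eq (derB (der_cst x 1) H) _.
  by rewrite /p1; ring.
have cmax (f : R -> R) : continuous f -> continuous (fun x => Num.max (f x) 0).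
  by move=> cf x; apply: (@continuous_comp R R R f (fun y => Num.max y 0)); [exact: cf|exact: continuous_max0].
have cps (f : R -> R) : continuous f -> continuous (fun x => pos_sqr (f x)).
  move=> cf x; apply: (@continuous_comp R R R f (@pos_sqr R)); first exact: cf.
  exact: der_continuous (der_pos_sqr (f x)).
have cxa : continuous (fun x : R => x - a) by move=> x; apply: continuousB; [exact: id|exact: cst_continuous].
have cbx : continuous (fun x : R => b - x) by move=> x; apply: continuousB; [exact: cst_continuous|exact: id].
have cM (f g : R -> R) : continuous f -> continuous g -> continuous (fun x => f x * g x).
  by move=> cf cg x; apply: cvgM; [exact: cf|exact: cg].
have cZ c (f : R -> R) : continuous f -> continuous (fun x => c * f x).
  by move=> cf; apply: cM => // x; exact: cst_continuous.
have cB (f g : R -> R) : continuous f -> continuous g -> continuous (fun x => f x - g x).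
  by move=> cf cg x; apply: cvgB; [exact: cf|exact: cg].
have cs1 : continuous s1.
  apply: (cZ n%:R); apply: cB.
    exact: cM (cZ 2 _ (cmax _ cxa)) (cps _ cbx).
  exact: cM (cps _ cxa) (cZ 2 _ (cmax _ cbx)).
have cst : continuous (step n a b) by move=> x; exact: der_continuous (ds x).
exists p1; split=> //.
  apply: cM => //; apply: cZ; apply: cmax; apply: cB => // x.
  exact: cst_continuous.
exists a, b; split=> // x xab; have xab' : ~ (a < x < b).
  by move=> /andP[ax xb]; apply: xab; rewrite !ltW.
split; first exact: approx0.
rewrite /p1 /s1; have [xa|ax] := leP x a.
  by rewrite (@pos_sqr0 (x - a)) ?subr_le0 // [Num.max (x - a) 0]max_r ?subr_le0 // !(mulr0, mul0r, subrr).
have bx : b - x <= 0.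
  by rewrite subr_le0 leNgt; apply/negP => xb; apply: xab'; rewrite ax.
by rewrite (@pos_sqr0 (b - x)) // [Num.max (b - x) 0]max_r // !(mulr0, mul0r, subrr).
Qed.

(** Dominated convergence along bumps that tend to the indicator function. *)
Lemma integral_zero_of_bumps o g a b : edge_length_gt0 o -> locint o g ->
  (forall phi phi1, bump o phi phi1 -> \int[mu]_(x in interval o) (g x * phi x) = 0) ->
  a <= b -> inner o a b -> \int[mu]_(x in `[a, b]) g x = 0.
Proof.
move=> oL lg g0 ab iab; have [mg ig] := lg.
have sub : `[a, b]%classic `<=` interval o.
  by move=> x; rewrite /= in_itv; exact: inner_interval.
have mgab : measurable_fun `[a, b] g := measurable_funS (measurable_interval o) sub mg.
have igab := ig a b iab.
have capp n : continuous (approx n a b).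
  by have [phi1 [d _ _]] := bump_approx n ab iab; move=> x; exact: der_continuous (d x).
have app_out n x : ~ (a <= x <= b) -> approx n a b x = 0.
  by move=> xab; apply: approx0 => /andP[ax xb]; apply: xab; rewrite !ltW.
have mfn n : measurable_fun `[a, b] (fun x => (g x * approx n a b x)%:E).
  exact: (measurable_int _ (pairing_integrable_segment iab (capp n) (app_out n) lg)).
have cv : {ae mu, forall x, `[a, b]%classic x ->
    (fun n => (g x * approx n a b x)%:E) @ \oo --> (g x)%:E}.
  have na : mu.-negligible ([set a] `|` [set b]).
    have n1 (c : R) : mu.-negligible [set c].
      by exists [set c]; split=> //; exact: lebesgue_measure_set1.
    exact: negligibleU.
  apply: negligibleS na => x /= /not_implyP[]; rewrite in_itv /= => /andP[ax xb] nc.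
  have [->|xa] := eqVneq x a; first by left.
  have [->|xb'] := eqVneq x b; first by right.
  exfalso; apply: nc.
  have [|N NP] := @approx1 a b x.
    by rewrite !lt_neqAle ax xb eq_sym xa xb'.
  apply: cvg_near_cst; exists N => // n /= /NP ->.
  by rewrite mulr1.
have dom : {ae mu, forall x n, `[a, b]%classic x ->
    (`|(g x * approx n a b x)%:E| <= (abse \o (EFin \o g)) x)%E}.
  apply: aeW => x n _; rewrite /= lee_fin normrM ler_piMr //.
  by have /andP[p0 p1] := approx_itv n a b x; rewrite ger0_norm.
have [_ _ lim] := dominated_convergence (measurable_segment a b) mfn
  ((measurable_EFinP _ _).2 mgab) cv (integrable_abse igab) dom.
suff : (\int[mu]_(x in `[a, b]) (g x)%:E = 0)%E by rewrite /Rintegral => ->.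
have z n : (\int[mu]_(x in `[a, b]) (g x * approx n a b x)%:E = 0)%E.
  have [phi1 bp] := bump_approx n ab iab.
  have := g0 _ _ bp; rewrite (pairing_segment iab (app_out n)) /Rintegral => E.
  rewrite -[LHS]fineK ?E //.
  exact: (integrable_fin_num _ (pairing_integrable_segment iab (capp n) (app_out n) lg)).
apply/esym; move: lim; rewrite (_ : [sequence _]_n = fun=> 0%E); last by apply/funext => n; exact: z.
by move=> /cvg_lim <- //; rewrite lim_cst.
Qed.

Let exhaustion o : edge_length_gt0 o -> exists c d : nat -> R,
  (forall n, c n <= d n /\ inner o (c n) (d n)) /\
  forall x, inner o x x -> exists n, c n < x < d n.
Proof.
have big (y : R) : 0 <= y -> exists n : nat, y < n%:R.
  by move=> y0; exists (Num.bound y); exact: archi_boundP.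
case: o => [L|] /= L0.
  have n3 n : 0 < n.+2%:R :> R by rewrite ltr0n.
  exists (fun n => L / n.+2%:R), (fun n => L - L / n.+2%:R); split=> [n|x [x0 xL]].
    have h1 : 0 < L / n.+2%:R by rewrite divr_gt0.
    have h2 : L / n.+2%:R <= L / 2.
      by rewrite ler_pM2l // lef_pV2 ?posrE // ler_nat.
    by move=> /=; move: (L / n.+2%:R) h1 h2 => t h1 h2; split; [lra|split; lra].
  have [n nP] := big (L / x + L / (L - x)) (ltac:(by rewrite addr_ge0 // divr_ge0 ?subr_ge0 // ltW)).
  exists n; have Lx : 0 < L - x by rewrite subr_gt0.
  have n0 : n%:R < n.+2%:R :> R by rewrite ltr_nat.
  have p1 : 0 <= L / x by rewrite divr_ge0 // ltW.
  have p2 : 0 <= L / (L - x) by rewrite divr_ge0 // ltW.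
  have h1 : L / x < n.+2%:R by lra.
  have h2 : L / (L - x) < n.+2%:R by lra.
  have : L / n.+2%:R < x by rewrite ltr_pdivrMr // mulrC -ltr_pdivrMr.
  have : L / n.+2%:R < L - x by rewrite ltr_pdivrMr // mulrC -ltr_pdivrMr.
  by move=> /=; move: (L / n.+2%:R) => t ? ?; apply/andP; split; lra.
have n3 n : 0 < n.+1%:R :> R by rewrite ltr0n.
exists (fun n => n.+1%:R^-1), (fun n => n.+1%:R); split=> [n|x [x0 _]].
  split; last by split=> //; rewrite invr_gt0.
  by apply: (@le_trans _ _ 1); rewrite ?invf_le1 // ler1n.
have [n nP] := big (x + x^-1) (ltac:(by rewrite addr_ge0 ?invr_ge0 // ltW)).
have x1 : 0 < x^-1 by rewrite invr_gt0.
have n0 : n%:R < n.+1%:R :> R by rewrite ltr_nat.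
exists n; rewrite invf_plt ?posrE //; apply/andP; split; lra.
Qed.

(** The integrals over the segments that start at a vanish, and Lebesgue's
    differentiation theorem recovers the function from them. *)
Let ae_segment o g a b : edge_length_gt0 o -> locint o g ->
  (forall phi phi1, bump o phi phi1 -> \int[mu]_(x in interval o) (g x * phi x) = 0) ->
  inner o a b -> {ae mu, forall x, a < x < b -> g x = 0}.
Proof.
move=> oL lg g0 iab; have [mg ig] := lg.
pose f := g \_ `[a, b].
have if_ : mu.-integrable setT (EFin \o f).
  have /(integrable_mkcond _ (measurable_segment a b)) := ig a b iab.
  by rewrite restrict_EFin.
have ify (y : R) : mu.-integrable `]-oo, y] (EFin \o f).
  by apply: integrableS if_ => //; exact: measurable_itv.
have := FTC1Ny ify (open_integrable_locally openT if_).
apply: ae_mono => x [dF F'] /andP[ax xb].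
pose F x := \int[mu]_(t in `]-oo, x]) f t.
have F0 y : a <= y <= b -> F y = 0.
  move=> /andP[ay yb]; rewrite /F -Rintegral_mkcondr.
  rewrite (_ : `]-oo, y] `&` `[a, b] = `[a, y]%classic).
    apply: (integral_zero_of_bumps oL lg g0) => //.
    by case: iab => a0 bL; split=> //; case: o bL {oL lg mg ig g0} => // L; exact: le_lt_trans.
  apply/seteqP; split=> z /=; rewrite !in_itv /=.
    by move=> [-> /andP[->]].
  by move=> /andP[az zy]; rewrite az zy (le_trans zy yb).
have d0 : der x F 0.
  apply: (@near_eq_is_derive _ _ _ (fun=> 0) F) => //.
  have : (`]a, b[%classic : set R) x by rewrite /= in_itv /= ax.
  have : open (`]a, b[%classic : set R) by exact: interval_open.
  rewrite openE => H /H; rewrite /interior; apply: filterS => y /=.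
  by rewrite in_itv /= => /andP[ay yb]; rewrite F0 // !ltW.
have fx : f x = g x by rewrite /f patchE mem_set //= in_itv /= !ltW.
rewrite -fx -F' derive1E; by case: d0.
Qed.

(** Fundamental lemma of the calculus of variations, by differentiation of the
    vanishing integrals. *)
Lemma fundamental_lemma o g : edge_length_gt0 o -> locint o g ->
  (forall phi phi1, bump o phi phi1 -> \int[mu]_(x in interval o) (g x * phi x) = 0) ->
  {ae mu, forall x, interval o x -> g x = 0}.
Proof.
move=> oL lg g0; have [c [d [cd ex]]] := exhaustion oL.
have := ae_foralln (fun n => ae_segment oL lg g0 (cd n).2).
have n1 (e : R) : {ae mu, forall x, x <> e}.
  by exists [set e]; split=> //; [exact: lebesgue_measure_set1|move=> x /= /contrapT].
move=> H; apply: ae_mono (ae_and H (ae_and (n1 0) (n1 (odflt 0 o)))).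
move=> x [gx [x0 xL]] ox.
have [|n nP] := ex x; last exact: gx nP.
have [x0' xL'] := (intervalP o x).1 ox; split; first by rewrite lt_neqAle x0' andbT eq_sym; apply/eqP.
by case: o ox xL xL' {oL lg g0 cd ex} => // L _ /= xL xL'; rewrite lt_neqAle xL' andbT; apply/eqP.
Qed.

(** du Bois-Reymond: subtract from a bump the multiple of a fixed bump with the
    same integral; the difference is the derivative of a bump. *)
Lemma du_bois_reymond o g : edge_length_gt0 o -> locint o g ->
  (forall phi phi1, bump o phi phi1 -> \int[mu]_(x in interval o) (g x * phi1 x) = 0) ->
  exists c, {ae mu, forall x, interval o x -> g x = c}.
Proof.
move=> oL lg g0.
have l1 : locint o (fun=> 1) by apply: locint_continuous => x _; exact: cst_continuous.
have [c [d [cd ex]]] := exhaustion oL.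
have [a0 [b0 [ab0 iab0]]] : exists a b, a < b /\ inner o a b.
  have [a [a0 aL]] : exists a, inner o a a.
    case: o oL {lg g0 l1 cd ex} => [L|] /= L0; last by exists 1.
    by exists (L / 2); split; rewrite ?divr_gt0 // ltr_pdivrMr // ltr_pMr ?ltr1n.
  have [n /andP[h1 h2]] := ex a (conj a0 aL).
  by exists (c n), (d n); split; [exact: lt_trans h1 h2|exact: (cd n).2].
have [rho [rho1 [brho rho0]]] : exists rho rho1, bump o rho rho1 /\
    \int[mu]_(x in interval o) (1 * rho x) != 0.
  apply: contrapT => no.
  have := integral_zero_of_bumps oL l1 _ (ltW ab0) iab0.
  have H phi phi1 : bump o phi phi1 -> \int[mu]_(x in interval o) (1 * phi x) = 0.
    move=> bphi; apply: contrapT => /eqP n0; apply: no.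
    by exists phi, phi1.
  move=> /(_ H); rewrite Rintegral_cst; last exact: measurable_segment.
  have muE : mu `[a0, b0]%classic = (b0 - a0)%:E.
    by rewrite lebesgue_measure_itv /= lte_fin ab0.
  move=> int1; have : b0 - a0 = 0; last by lra.
  by rewrite -[LHS]/(fine (b0 - a0)%:E) -muE -[LHS]mul1r; exact: int1.
pose m := \int[mu]_(x in interval o) (1 * rho x).
pose e := (\int[mu]_(x in interval o) (g x * rho x)) / m.
exists e.
have le : locint o (fun=> e) by apply: locint_continuous => x _; exact: cst_continuous.
suff: {ae mu, forall x, interval o x -> g x - e = 0}.
  by apply: ae_mono => x H ox; apply/eqP; rewrite -subr_eq0 H.
apply: (fundamental_lemma oL (locintB lg le)) => phi phi1 bphi.
have [drho crho1 [a1 [b1 [ab1 iab1 rhoz]]]] := brho.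
have [dphi cphi1 [a2 [b2 [ab2 iab2 phiz]]]] := bphi.
have crho : continuous rho by move=> x; exact: der_continuous (drho x).
have cphi : continuous phi by move=> x; exact: der_continuous (dphi x).
pose a := Num.min a1 a2; pose b := Num.max b1 b2.
have ab : a <= b by rewrite ge_min le_max ab1.
have iab : inner o a b.
  case: iab1 iab2 => p1 q1 [p2 q2]; split; first by rewrite lt_min p1.
  by case: o q1 q2 {oL lg g0 l1 le cd ex iab0 brho rho0 m e bphi} => // L q1 q2; rewrite gt_max q1.
have rz x : ~ (a <= x <= b) -> rho x = 0.
  move=> xab; apply: (rhoz x _).1 => /andP[ax xb]; apply: xab.
  by rewrite ge_min le_max ax xb.
have pz x : ~ (a <= x <= b) -> phi x = 0.
  move=> xab; apply: (phiz x _).1 => /andP[ax xb]; apply: xab.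
  by rewrite ge_min le_max ax xb !orbT.
pose kk := (\int[mu]_(x in interval o) (1 * phi x)) / m.
pose eta x := phi x - kk * rho x.
have ceta : continuous eta.
  move=> x; apply: cvgB; first exact: cphi.
  by apply: cvgM; [exact: cst_continuous|exact: crho].
have etaz x : ~ (a <= x <= b) -> eta x = 0.
  by move=> xab; rewrite /eta pz // rz // mulr0 subr0.
have pair_eta h : locint o h -> \int[mu]_(x in interval o) (h x * eta x) =
    \int[mu]_(x in interval o) (h x * phi x) - kk * \int[mu]_(x in interval o) (h x * rho x).
  move=> lh; have i1 := pairing_integrable iab crho rz lh.
  have i2 := pairing_integrable iab cphi pz lh.
  rewrite -RintegralZl //; last exact: measurable_interval.
  rewrite -RintegralB //; [|exact: measurable_interval|].
    by apply: eq_Rintegral => x _; rewrite /eta; ring.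
  have := integrableZl (measurable_interval o) kk i1.
  by apply: eq_integrable => //; exact: measurable_interval.
have int0 : \int[mu]_(x in interval o) (1 * eta x) = 0.
  by rewrite pair_eta // -/m /kk divfK // subrr.
have [P dP] := exists_primitive (-1) ceta.
have a_gt0 : 0 < a by case: iab.
have P_left x : -1 < x -> x <= a -> P x = P 0.
  move=> x1 xa.
  have lip := @der_lipschitz _ P eta (Num.min x 0) a 0.
  have H : `|P x - P 0| <= 0 * `|x - 0|.
    apply: lip.
    - move=> z /andP[z1 _]; apply: dP; apply: lt_le_trans z1.
      by rewrite lt_min x1; lra.
    - move=> z /andP[_ za]; have [->|zna] := eqVneq z a.
        have cna : {for a, continuous eta} := ceta a.
        suff -> : eta a = 0 by rewrite normr0.
        apply/eqP; rewrite -normr_le0 leNgt; apply/negP => ea.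
        have /cvgrPdist_lt/(_ _ ea)/nbhs_ballP[r /= r0 rP] := cna.
        have := rP (a - r / 2); rewrite /ball /= opprB addrC subrK.
        rewrite gtr0_norm ?divr_gt0 // ltr_pdivrMr // ltr_pMr // ltr1n => /(_ isT).
        rewrite (etaz (a - r / 2)); first by rewrite subr0 ltxx.
        by move=> /andP[ha _]; have := divr_gt0 r0 (ltr0n R 2); move: ha; lra.
      by rewrite etaz ?normr0 // => /andP[az _]; move: zna; rewrite eq_le za az.
    - by rewrite ge_min lexx xa.
    - by rewrite ge_min lexx orbT ltW.
  by apply/eqP; rewrite -subr_eq0 -normr_le0; apply: le_trans H _; rewrite mul0r.
have P_right x : b < x -> P x = P 0.
  move=> bx; have b_gt0 : 0 < b by exact: lt_le_trans ab.
  have x_gt0 : 0 < x by exact: lt_trans bx.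
  have iabx : inner (Some x) a b by [].
  have E := pairing_segment iab etaz (fun=> 1).
  have E' := pairing_segment iabx etaz (fun=> 1).
  move: int0; rewrite E -E' => int0.
  apply/eqP; rewrite -subr_eq0; apply/eqP; rewrite -[RHS]int0; apply/esym.
  apply: (@integral_derivative _ (Some x) (fun x => 1 * eta x) P x_gt0).
  - move=> z oz; rewrite mul1r; apply: dP.
    by apply: lt_le_trans (interval_ge0 oz); rewrite ltrN10.
  - apply: decaying_segment => // z _.
    by apply: cvgM; [exact: cst_continuous|exact: ceta].
  - apply: decaying_segment => // z /andP[z0 _].
    by apply: der_continuous (dP z _); apply: lt_le_trans z0; rewrite ltrN10.
pose Q x := P (Num.max x 0) - P 0.
have dQ (x : R) : der x Q (eta x).
  have [x0|x0] := leP x 0.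
    rewrite etaz; last by move=> /andP[ax _]; have := lt_le_trans a_gt0 (le_trans ax x0); rewrite ltxx.
    apply: (@near_eq_is_derive _ _ _ (fun=> 0) Q) => //.
    near=> y; rewrite /Q; have ya : y < a by near: y; apply: lt_nbhsl; exact: le_lt_trans a_gt0.
    rewrite P_left ?subrr //; first by rewrite lt_max ltrN10 orbT.
    by rewrite ge_max !ltW.
  have H : der x (fun y => P y - P 0) (eta x).
    by apply: der_eq (derB (dP x _) (der_cst x (P 0))) _; rewrite ?subr0 //; lra.
  apply: near_eq_is_derive H.
  near=> y; rewrite /Q max_l //; apply: ltW; near: y; exact: lt_nbhsr.
have bQ : bump o Q eta.
  split=> //; exists a, b; split=> // x xab; split; last exact: etaz.
  rewrite /Q; have [xa|ax] := leP x a.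
    rewrite P_left ?subrr //; first by rewrite lt_max ltrN10 orbT.
    by rewrite ge_max xa ltW.
  have bx : b < x by rewrite ltNge; apply/negP => xb; apply: xab; rewrite (ltW ax).
  by rewrite max_l ?P_right ?subrr // ltW // (lt_trans a_gt0).
have := g0 _ _ bQ; rewrite pair_eta // => gphi.
rewrite (pairingB iab cphi pz lg le).
have i1 := pairing_integrable iab cphi pz l1.
have := RintegralZl e (measurable_interval o) i1.
rewrite (_ : (fun x => e * (1 * phi x)) = (fun x => e * phi x)); last first.
  by apply/funext => x; rewrite mul1r.
move=> ->.
move: gphi; rewrite /kk /e => gphi; rewrite -[RHS]gphi; congr (_ - _).
by ring.
Unshelve. all: by end_near. Qed.

End WeakDerivative.
Local Open Scope complex_scope.

(** * Classical and weak solutions on an edge *)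

Section ComplexPaths.
Variable R : realType.
Notation mu := (@lebesgue_measure R).
Notation paths := (bool -> R -> R).
Implicit Types (o : option R) (u v : paths) (f g h : R -> R[i]).

Definition cplx (a : plane R) : R[i] := a false +i* a true.
Definition comp (c : bool) (z : R[i]) : R :=
  if c then complex.Im z else complex.Re z.

Lemma comp_cplx c a : comp c (cplx a) = a c. Proof. by case: c. Qed.

Lemma eq_comp (z w : R[i]) : (forall c, comp c z = comp c w) -> z = w.
Proof.
by case: z w => [a b] [c d] H; have /= -> := H false; have /= -> := H true.
Qed.

Lemma normc_cplx a : Normc.normc (cplx a) = nm a.
Proof. by rewrite /nm /ip /= -!expr2. Qed.

Lemma in_L2_comp o f : in_L2 (interval o) f <->
  (forall c, measurable_fun (interval o) (fun x => comp c (f x))) /\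
  (forall c, (\int[mu]_(x in interval o) (comp c (f x) ^+ 2)%:E < +oo)%E).
Proof.
have normE x : Normc.normc (f x) ^+ 2 = comp false (f x) ^+ 2 + comp true (f x) ^+ 2.
  by case: (f x) => a b /=; rewrite sqr_sqrtr // addr_ge0 // sqr_ge0.
have m2 c : measurable_fun (interval o) (fun x => comp c (f x)) ->
    measurable_fun (interval o) (EFin \o (fun x => comp c (f x) ^+ 2)).
  by move=> mf; apply/measurable_EFinP; exact: measurable_funX.
have E : (forall c, measurable_fun (interval o) (fun x => comp c (f x))) ->
    (\int[mu]_(x in interval o) (Normc.normc (f x) ^+ 2)%:E =
     \int[mu]_(x in interval o) (comp false (f x) ^+ 2)%:E +
     \int[mu]_(x in interval o) (comp true (f x) ^+ 2)%:E)%E.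
  move=> mf; rewrite -ge0_integralD //.
  - by apply: eq_integral => x _; rewrite normE EFinD.
  - exact: measurable_interval.
  - by move=> x _; rewrite lee_fin sqr_ge0.
  - exact: m2.
  - by move=> x _; rewrite lee_fin sqr_ge0.
  - exact: m2.
have n0 c : (0 <= \int[mu]_(x in interval o) (comp c (f x) ^+ 2)%:E)%E.
  by apply: integral_ge0 => x _; rewrite lee_fin sqr_ge0.
split=> [[mr mi fin]|[mf fin]].
  have mf c : measurable_fun (interval o) (fun x => comp c (f x)) by case: c.
  split=> // c; apply: le_lt_trans fin; rewrite E //.
  by case: c; [exact: leeDr|exact: leeDl].
split; [exact: (mf false)|exact: (mf true)|].
by rewrite E //; apply: lte_add_pinfty.
Qed.

Lemma in_L2_locint o f c : in_L2 (interval o) f -> locint o (fun x => comp c (f x)).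
Proof. by move=> /in_L2_comp[mf fin]; apply: locint_sqr. Qed.

Lemma in_L2_decaying o u : (forall c, decaying o (u c)) ->
  in_L2 (interval o) (fun x => cplx (u^~ x)).
Proof.
move=> du; apply/in_L2_comp; split=> c.
  by under eq_fun do rewrite comp_cplx; exact: decaying_measurable.
under eq_integral => x _ do rewrite comp_cplx.
have /integrableP[_] := decaying_integrable (decayingM (du c) (du c)).
apply: le_lt_trans; apply: ge0_le_integral => //=.
- exact: measurable_interval.
- by move=> x _; rewrite lee_fin sqr_ge0.
- by apply/measurable_EFinP; apply: measurable_funX; exact: decaying_measurable.
- apply/measurable_EFinP; apply: measurableT_comp => //.
  exact: measurable_funM (decaying_measurable (du c)) (decaying_measurable (du c)).
- by move=> x _; rewrite lee_fin expr2 ler_norm.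
Qed.

Lemma weak_derivative_comp o f g : weak_derivative (interval o) f g <->
  forall c, real_weak_derivative (interval o) (fun x => comp c (f x)) (fun x => comp c (g x)).
Proof. by split=> [[? ?] []|H]; [| |split; [exact: (H false)|exact: (H true)]]. Qed.

Lemma weak_derivative_classical o u v : edge_length_gt0 o ->
  (forall c x, interval o x -> der x (u c) (v c x)) ->
  (forall c x, interval o x -> {for x, continuous (v c)}) ->
  weak_derivative (interval o) (fun x => cplx (u^~ x)) (fun x => cplx (v^~ x)).
Proof.
move=> oL du cv; apply/weak_derivative_comp => c phi tphi.
under eq_Rintegral => x _ do rewrite comp_cplx.
under [in RHS]eq_Rintegral => x _ do rewrite comp_cplx.
apply: bump_parts => //.
  exact: cv.
exact: test_fun_bump.
Qed.

Lemma weak_derivative_ae o f g h : edge_length_gt0 o -> in_L2 (interval o) f ->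
  in_L2 (interval o) g -> {ae mu, forall x, interval o x -> f x = g x} ->
  weak_derivative (interval o) g h -> weak_derivative (interval o) f h.
Proof.
move=> oL lf lg fg /weak_derivative_comp gh; apply/weak_derivative_comp => c phi tphi.
rewrite -(gh c phi tphi); have [_ cphi1 [a [b [_ iab phi0]]]] := test_fun_bump oL tphi.
apply: (pairing_ae iab cphi1 (fun x xab => (phi0 x xab).2)); try exact: in_L2_locint.
by apply: ae_mono fg => x H ox; rewrite H.
Qed.

Lemma ae_comp o f g : (forall c, {ae mu, forall x, interval o x -> comp c (f x) = comp c (g x)}) ->
  {ae mu, forall x, interval o x -> f x = g x}.
Proof.
move=> H; apply: ae_mono (ae_and (H false) (H true)) => x [H0 H1] ox.
by apply: eq_comp => -[]; [exact: H1|exact: H0].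
Qed.

Lemma weak_derivative_unique o f g h : edge_length_gt0 o ->
  in_L2 (interval o) g -> in_L2 (interval o) h ->
  weak_derivative (interval o) f g -> weak_derivative (interval o) f h ->
  {ae mu, forall x, interval o x -> g x = h x}.
Proof.
move=> oL lg lh /weak_derivative_comp fg /weak_derivative_comp fh; apply: ae_comp => c.
have l1 := in_L2_locint c lg; have l2 := in_L2_locint c lh.
apply: ae_mono (fundamental_lemma oL (locintB l1 l2) _).
  by move=> x H ox; apply/eqP; rewrite -subr_eq0 H.
move=> phi phi1 bphi; have [dphi _ [a [b [_ iab phi0]]]] := bphi.
have cphi : continuous phi by move=> x; exact: der_continuous (dphi x).
have [tphi _] := bump_test_fun bphi.
rewrite (pairingB iab cphi (fun x xab => (phi0 x xab).1) l1 l2).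
apply/eqP; rewrite subr_eq0 -eqr_opp; apply/eqP.
by rewrite -(fg c phi tphi) -(fh c phi tphi).
Qed.

Lemma wderivP o f : in_H1 (interval o) f ->
  in_L2 (interval o) (wderiv (interval o) f) /\
  weak_derivative (interval o) f (wderiv (interval o) f).
Proof.
move=> [_ [g [lg fg]]]; rewrite /wderiv; case: xgetP => [h -> //|no].
by case: (no g).
Qed.

Lemma wderiv_ae o f g : edge_length_gt0 o -> in_L2 (interval o) f ->
  in_L2 (interval o) g -> weak_derivative (interval o) f g ->
  in_H1 (interval o) f /\
  {ae mu, forall x, interval o x -> wderiv (interval o) f x = g x}.
Proof.
move=> oL lf lg fg; have hf : in_H1 (interval o) f by split=> //; exists g.
split=> //; have [lw fw] := wderivP hf.
exact: weak_derivative_unique fw fg.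
Qed.

Lemma edge_state_wderiv o u v : edge_length_gt0 o -> edge_state o u v ->
  let f := fun x => cplx (u^~ x) in
  [/\ in_H1 (interval o) f, continuous_on (interval o) f &
   {ae mu, forall x, interval o x -> wderiv (interval o) f x = cplx (v^~ x)}].
Proof.
move=> oL uv f.
have du c : decaying o (u c) by have [] := uv c.
have dv c : decaying o (v c) by have [] := uv c.
have [||| h w] := @wderiv_ae o f (fun x => cplx (v^~ x)) oL.
- exact: in_L2_decaying.
- exact: in_L2_decaying.
- apply: weak_derivative_classical => // c; first by have [] := uv c.
  by case: (dv c).
split=> //; split; apply: within_interval_continuous;
  [by case: (du false)|by case: (du true)].
Qed.

Lemma edge_state_wderiv2 o u v w : edge_length_gt0 o -> edge_state o u v ->
  edge_state o v w -> let f := fun x => cplx (u^~ x) in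
  in_H2 (interval o) f /\
  {ae mu, forall x, interval o x ->
    wderiv (interval o) (wderiv (interval o) f) x = cplx (w^~ x)}.
Proof.
move=> oL uv vw f; have [hf _ wf] := edge_state_wderiv oL uv.
have [lw _] := wderivP hf.
have dv c : decaying o (v c) by have [] := uv c.
have dw c : decaying o (w c) by have [] := vw c.
have [||| h w2] := @wderiv_ae o (wderiv (interval o) f) (fun x => cplx (w^~ x)) oL.
- exact: lw.
- exact: in_L2_decaying.
- apply: (weak_derivative_ae oL lw (in_L2_decaying dv) wf).
  apply: weak_derivative_classical => // c; first by have [] := vw c.
  by case: (dw c).
by split.
Qed.

End ComplexPaths.

Section EigenfunctionRegularity.
Variable R : realType.
Notation mu := (@lebesgue_measure R).
Implicit Types (o : option R).

Definition edge_clamp o (x : R) : R :=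
  if o is Some L then Num.max 0 (Num.min x L) else Num.max 0 x.

Lemma edge_clampE o x : interval o x -> edge_clamp o x = x.
Proof.
by case: o => [L|] /intervalP[x0 xL] /=; rewrite ?(min_l xL) max_r.
Qed.

Lemma edge_clamp_interval o x : edge_length_gt0 o -> interval o (edge_clamp o x).
Proof.
move=> oL; apply/intervalP; case: o oL => [L|] /= oL; rewrite le_max lexx; split=> //.
by rewrite ge_max ge_min lexx orbT ltW.
Qed.

Lemma edge_clamp_continuous o : continuous (edge_clamp o).
Proof.
case: o => [L|] x; last first.
  by apply: (@continuous_max _ _ (fun=> 0) (fun x => x)); [exact: cst_continuous|exact: id].
apply: (@continuous_max _ _ (fun=> 0) (fun x => Num.min x L)).
  exact: cst_continuous.
by apply: (@continuous_min _ _ (fun x => x) (fun=> L)); [exact: id|exact: cst_continuous].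
Qed.

Lemma within_clamp_continuous o (f : R -> R) : edge_length_gt0 o ->
  {within interval o, continuous f} -> continuous (f \o edge_clamp o).
Proof.
move=> oL /subspace_continuousP cf x; apply/cvgrPdist_lt => e e0.
have /cvgrPdist_lt/(_ e e0) := cf (edge_clamp o x) (edge_clamp_interval x oL).
move=> H; have {}H : \forall y \near x, interval o (edge_clamp o y) ->
    `|f (edge_clamp o x) - f (edge_clamp o y)| < e.
  exact: (@edge_clamp_continuous o x _ H).
by near=> y; apply: (near H y); [|exact: edge_clamp_interval].
Unshelve. all: by end_near.
Qed.

(** A point where two continuous functions differ lies at the end of an
    interval, of positive measure, on which they differ. *)
Lemma continuous_ae_eq o (f g : R -> R) : edge_length_gt0 o ->
  {within interval o, continuous f} -> {within interval o, continuous g} ->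
  {ae mu, forall x, interval o x -> f x = g x} ->
  forall x, interval o x -> f x = g x.
Proof.
move=> oL cf cg fg x0 ox0; apply: contrapT => /eqP; rewrite -subr_eq0 -normr_gt0 => d0.
pose d x := f (edge_clamp o x) - g (edge_clamp o x).
have cd : continuous d.
  move=> x; apply: cvgB; [exact: (within_clamp_continuous oL cf)|exact: (within_clamp_continuous oL cg)].
have dx0 : d x0 = f x0 - g x0 by rewrite /d edge_clampE.
rewrite -dx0 in d0.
have /cvgrPdist_lt/(_ _ d0)/nbhs_ballP[r /= r0 rP] := cd x0.
have dn x : interval o x -> `|x0 - x| < r -> f x <> g x.
  move=> ox xr fgx; have := rP x xr.
  by rewrite {2}/d edge_clampE // fgx subrr subr0 ltxx.
have [p [q [pq sub]]] : exists p q, p < q /\ `]p, q[%classic `<=` [set x | interval o x /\ `|x0 - x| < r].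
  have [x00 x0L] := (intervalP o x0).1 ox0.
  have [[L [oE Lx]]|no] := pselect (exists L, o = Some L /\ x0 = L).
    subst o x0; exists (Num.max 0 (L - r)), L; split.
      by rewrite gt_max oL /= ltrBlDr ltrDl.
    move=> x /=; rewrite in_itv /= gt_max -andbA => /and3P[x0 xr xL]; split.
      by rewrite in_itv /= (ltW x0) ltW.
    by rewrite gtr0_norm ?subr_gt0 // ltrBlDr addrC -ltrBlDr.
  exists x0, (if o is Some L then Num.min L (x0 + r) else x0 + r); split.
    case: o {oL cf cg fg ox0 d cd dx0 d0 rP dn} x0L no => [L|] x0L no; last by rewrite ltrDl.
    rewrite lt_min ltrDl r0 andbT lt_neqAle x0L andbT; apply/eqP => x0E.
    by apply: no; exists L.
  move=> x /=; rewrite in_itv /= => /andP[x0x xq].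
  have xr : x < x0 + r by case: o {oL cf cg fg ox0 d cd dx0 d0 rP dn no x0L} xq => // L; rewrite lt_min => /andP[].
  split; last by rewrite ltr0_norm ?subr_lt0 // opprB ltrBlDr addrC.
  apply/intervalP; split; first exact: le_trans (ltW x0x).
  by case: o {oL cf cg fg ox0 d cd dx0 d0 rP dn no x0L} xq => // L; rewrite lt_min => /andP[/ltW].
case: fg => A [mA A0 subA].
have sA : `]p, q[%classic `<=` A.
  by move=> x /sub[ox xr]; apply: subA => /= H; exact: dn ox xr (H ox).
have : (mu `]p, q[%classic <= mu A)%E by apply: le_measure => //; rewrite inE //; exact: measurable_itv.
by rewrite A0 lebesgue_measure_itv /= lte_fin pq lee_fin subr_le0 leNgt pq.
Qed.

Lemma const_of_der0 (f : R -> R) : (forall x : R, 0 <= x -> der x f 0) ->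
  forall x, 0 <= x -> f x = f 0.
Proof.
move=> df x x0; apply/eqP; rewrite -subr_eq0 -normr_le0.
rewrite -[leRHS](mul0r `|x - 0|); apply: (@der_lipschitz _ f (fun=> 0) 0 x 0).
- by move=> y /andP[y0 _]; exact: df.
- by move=> y _; rewrite normr0.
- by rewrite x0 lexx.
- by rewrite lexx x0.
Qed.

(** The general solution of u'' = m^2 u combines two exponentials, and the
    square of the growing one has an infinite integral. *)
Lemma halfline_decaying_mode (m : R) (u v : R -> R) : 0 < m ->
  (forall x : R, 0 <= x -> der x u (v x)) ->
  (forall x : R, 0 <= x -> der x v (m ^+ 2 * u x)) ->
  (\int[mu]_(x in interval None) (u x ^+ 2)%:E < +oo)%E ->
  measurable_fun (interval None) u ->
  forall x, 0 <= x -> u x = u 0 * expR (- m * x) /\ v x = - m * u x.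
Proof.
move=> m0 du dv fin mu_.
pose w x := v x + m * u x.
have EE x : expR (- m * x) * expR (m * x) = 1.
  by rewrite -expRD mulNr addNr expR0.
have wE (x : R) : 0 <= x -> w x = w 0 * expR (m * x).
  move=> x0.
  have H (y : R) : 0 <= y -> der y (fun y => w y * expR (- m * y)) 0.
    move=> y0; apply: der_eq (derM (derD (dv y y0) (derZ m (du y y0))) (der_exp y (- m))) _.
    by rewrite /w; ring.
  have := const_of_der0 H x0; rewrite mulr0 expR0 mulr1 => <-.
  by rewrite -mulrA EE mulr1.
have uE (x : R) : 0 <= x -> u x = expR (- m * x) * (u 0 + w 0 * (expR (2 * m * x) - 1) / (2 * m)).
  move=> x0.
  have H (y : R) : 0 <= y -> der y (fun y => u y * expR (m * y) - w 0 / (2 * m) * expR (2 * m * y)) 0.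
    move=> y0; apply: der_eq (derB (derM (du y y0) (der_exp y m)) (derZ (w 0 / (2 * m)) (der_exp y (2 * m)))) _.
    have -> : v y = w y - m * u y by rewrite /w addrK.
    rewrite wE // (_ : 2 * m * y = m * y + m * y); last by ring.
    by rewrite expRD; field; exact: lt0r_neq0.
  have := const_of_der0 H x0; rewrite !mulr0 expR0 !mulr1 => E.
  have -> : u x = expR (- m * x) * (u x * expR (m * x)).
    by rewrite mulrCA EE mulr1.
  congr (_ * _); move: E => /eqP; rewrite subr_eq => /eqP ->.
  by field; exact: lt0r_neq0.
have w0 : w 0 = 0.
  apply: contrapT => /eqP w00.
  have aw : 0 < `|w 0| by rewrite normr_gt0.
  pose K := `|w 0| / (2 * m) + `|u 0|.
  have K0 : 0 <= K by rewrite addr_ge0 // divr_ge0 // mulr_ge0 // ltW.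
  pose X := (K + 1) * 2 / `|w 0|.
  have X0 : 0 <= X by rewrite divr_ge0 // mulr_ge0 // addr_ge0.
  have u1 x : X <= x -> 1 <= u x ^+ 2.
    move=> Xx; have x0 := le_trans X0 Xx.
    have -> : u x = w 0 / (2 * m) * expR (m * x) + expR (- m * x) * (u 0 - w 0 / (2 * m)).
      rewrite uE // (_ : 2 * m * x = m * x + m * x); last by ring.
      have : expR (m * x) = expR (- m * x) * expR (m * x) * expR (m * x) by rewrite EE mul1r.
      by rewrite expRD => {3}->; field; exact: lt0r_neq0.
    set A := w 0 / (2 * m) * expR (m * x); set B := expR (- m * x) * _.
    have eB : expR (- m * x) <= 1.
      by rewrite -[leRHS]expR0 ler_expR mulNr oppr_le0 mulr_ge0 // ltW.
    have BK : `|B| <= K.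
      rewrite normrM ger0_norm ?expR_ge0 //; apply: le_trans (_ : 1 * `|u 0 - w 0 / (2 * m)| <= _).
        by rewrite ler_wpM2r.
      rewrite mul1r; apply: le_trans (ler_normB _ _) _; rewrite /K addrC lerD2r.
      by rewrite normrM normfV [`|2 * m|]gtr0_norm // mulr_gt0.
    have AK : K + 1 <= `|A|.
      rewrite normrM [`|expR _|]ger0_norm ?expR_ge0 // normrM normfV [`|2 * m|]gtr0_norm ?mulr_gt0 //.
      apply: le_trans (_ : `|w 0| / (2 * m) * (m * x) <= _).
        rewrite (_ : `|w 0| / (2 * m) * (m * x) = `|w 0| / 2 * x); last by field; exact: lt0r_neq0.
        apply: le_trans (_ : `|w 0| / 2 * X <= _); last by rewrite ler_wpM2l // divr_ge0.
        by rewrite /X le_eqVlt; apply/orP; left; apply/eqP; field; exact: lt0r_neq0.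
      rewrite ler_wpM2l ?divr_ge0 ?mulr_ge0 // ?(ltW m0) //.
      by apply: le_trans (expR_ge1Dx _); rewrite lerDr.
    have : 1 <= `|A + B|.
      have := ler_normB (A + B) B; rewrite addrK; lra.
    by move=> h; rewrite -real_normK ?num_real // -[leLHS](expr1n _ 2) ler_pXn2r ?nnegrE.
  have sub : `[X, +oo[%classic `<=` (interval None : set R).
    by move=> x /=; rewrite !in_itv /= !andbT; exact: le_trans.
  have : (+oo <= \int[mu]_(x in interval None) (u x ^+ 2)%:E)%E.
    apply: (@le_trans _ _ (\int[mu]_(x in `[X, +oo[) (cst 1%:E x))%E).
      by rewrite integral_cst //= mul1e lebesgue_measure_itv /= ltry.
    have m2 : measurable_fun (interval None) (EFin \o (fun x => u x ^+ 2)).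
      by apply/measurable_EFinP; exact: measurable_funX.
    apply: (@le_trans _ _ (\int[mu]_(x in `[X, +oo[) (u x ^+ 2)%:E)%E).
      apply: ge0_le_integral => //.
      - exact: measurable_funS (measurable_interval None) sub m2.
      - by move=> x /=; rewrite in_itv /= andbT lee_fin => /u1.
    apply: ge0_subset_integral => //; first exact: measurable_interval.
    by move=> x _; rewrite lee_fin sqr_ge0.
  by rewrite leNgt fin.
move=> x x0; split; first by rewrite uE // w0 mul0r mul0r addr0 mulrC.
by have := wE x x0; rewrite w0 mul0r /w => /eqP; rewrite addr_eq0 mulNr => /eqP.
Qed.

(** Minus a primitive of h, the function has weak derivative 0, and du
    Bois-Reymond's lemma applies. *)
Lemma weak_primitive o (g h : R -> R) : edge_length_gt0 o -> locint o g -> continuous h ->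
  (forall phi phi1, bump o phi phi1 ->
    \int[mu]_(x in interval o) (g x * phi1 x) = - \int[mu]_(x in interval o) (h x * phi x)) ->
  exists F : R -> R, (forall x, interval o x -> der x F (h x)) /\
    {ae mu, forall x, interval o x -> g x = F x}.
Proof.
move=> oL lg ch gh; have [F0 dF0] := @exists_primitive _ h (-1) ch.
have dF x : interval o x -> der x F0 (h x).
  by move=> /interval_ge0 x0; apply: dF0; apply: lt_le_trans x0; rewrite ltrN10.
have cF x : interval o x -> {for x, continuous F0} by move=> /dF; exact: der_continuous.
have lF := locint_continuous cF.
have [|c gc] := du_bois_reymond oL (locintB lg lF).
  move=> phi phi1 b; have [_ cphi1 [a' [b' [_ iab phi0]]]] := b.
  rewrite (pairingB iab cphi1 (fun x xab => (phi0 x xab).2) lg lF) (gh _ _ b).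
  by rewrite (bump_parts oL dF (fun x _ => ch x) b) subrr.
exists (fun x => F0 x + c); split.
  by move=> x ox; apply: der_eq (derD (dF x ox) (der_cst x c)) _; rewrite addr0.
by apply: ae_mono gc => x H ox; rewrite -(H ox) addrC subrK.
Qed.

(** Two applications of the previous lemma show that f is a classical
    solution of u'' = - lam u; on a half-line its square integrability then
    leaves the decaying exponential only. *)
Lemma eigen_component o (lam : R) (f g h : R -> R) : edge_length_gt0 o -> lam < 0 ->
  {within interval o, continuous f} ->
  measurable_fun (interval o) f ->
  (\int[mu]_(x in interval o) (f x ^+ 2)%:E < +oo)%E ->
  locint o g -> locint o h ->
  (forall phi phi1, bump o phi phi1 ->
    \int[mu]_(x in interval o) (f x * phi1 x) = - \int[mu]_(x in interval o) (g x * phi x)) ->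
  (forall phi phi1, bump o phi phi1 ->
    \int[mu]_(x in interval o) (g x * phi1 x) = - \int[mu]_(x in interval o) (h x * phi x)) ->
  {ae mu, forall x, interval o x -> h x = - lam * f x} ->
  exists uv : (R -> R) * (R -> R),
   [/\ forall x, interval o x -> der x uv.1 (uv.2 x), decaying o uv.1, decaying o uv.2,
       forall x, interval o x -> der x uv.2 (- lam * uv.1 x) &
       forall x, interval o x -> f x = uv.1 x].
Proof.
move=> oL lam0 cf mf f2 lg lh fg gh hf.
have lf := locint_sqr mf f2.
pose f0 x := - lam * f (edge_clamp o x).
have cf0 : continuous f0.
  move=> x; apply: cvgM; [exact: cst_continuous|exact: (within_clamp_continuous oL cf)].
have lf0 : locint o f0 by apply: locint_continuous => x _; exact: cf0.
have [|v [dv gv]] := weak_primitive oL lg cf0.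
  move=> phi phi1 b; rewrite (gh _ _ b); congr (- _).
  have [dphi _ [a' [b' [_ iab phi0]]]] := b.
  apply: (pairing_ae iab (fun x => der_continuous (dphi x)) (fun x xab => (phi0 x xab).1) lh lf0).
  by apply: ae_mono hf => x H ox; rewrite H // /f0 edge_clampE.
have cv x : interval o x -> {for x, continuous v} by move=> /dv; exact: der_continuous.
pose v0 x := v (edge_clamp o x).
have cv0 : continuous v0 by apply: within_clamp_continuous => //; exact: within_interval_continuous.
have lv0 : locint o v0 by apply: locint_continuous => x _; exact: cv0.
have [|u [du fu]] := weak_primitive oL lf cv0.
  move=> phi phi1 b; rewrite (fg _ _ b); congr (- _).
  have [dphi _ [a' [b' [_ iab phi0]]]] := b.
  apply: (pairing_ae iab (fun x => der_continuous (dphi x)) (fun x xab => (phi0 x xab).1) lg lv0).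
  by apply: ae_mono gv => x H ox; rewrite H // /v0 edge_clampE.
have cu x : interval o x -> {for x, continuous u} by move=> /du; exact: der_continuous.
have E x : interval o x -> f x = u x.
  by apply: continuous_ae_eq => //; exact: within_interval_continuous.
have {}du x : interval o x -> der x u (v x).
  by move=> ox; have := du x ox; rewrite /v0 edge_clampE.
have {}dv x : interval o x -> der x v (- lam * u x).
  by move=> ox; have := dv x ox; rewrite /f0 edge_clampE // E.
suff [decu decv] : decaying o u /\ decaying o v by exists (u, v).
case: o oL cf mf f2 {lg lh fg gh hf lf f0 cf0 lf0 gv v0 cv0 lv0 fu} dv cv du cu E
  => [L|] oL cf mf f2 dv cv du cu E.
  by split; apply: decaying_segment.
have [m m0 m2] : exists2 m : R, 0 < m & m ^+ 2 = - lam.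
  exists (Num.sqrt (- lam)); first by rewrite sqrtr_gt0 oppr_gt0.
  by rewrite sqr_sqrtr // oppr_ge0 ltW.
have i0 (x : R) : 0 <= x -> interval None x by move=> x0; rewrite /= in_itv /= x0.
have mu_ : measurable_fun (interval None) u.
  by apply: eq_measurable_fun mf => x; rewrite inE => /E.
have H0 (x : R) : 0 <= x -> u x = u 0 * expR (- m * x) /\ v x = - m * u x.
  move: x; refine (@halfline_decaying_mode m u v m0 _ _ _ mu_).
  - by move=> y /i0/du.
  - by move=> y /i0/dv; rewrite m2.
  - by move: f2; under eq_integral => y do rewrite inE => /E ->.
split; split; [exact: cu| |exact: cv|].
  exists `|u 0|, m; split=> // x /interval_ge0 x0.
  by rewrite (H0 x x0).1 normrM [`|expR _|]ger0_norm ?expR_ge0.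
exists (m * `|u 0|), m; split=> //; first by rewrite mulr_ge0 // ltW.
move=> x /interval_ge0 x0; rewrite (H0 x x0).2 (H0 x x0).1 !normrM normrN (gtr0_norm m0).
by rewrite [`|expR _|]ger0_norm ?expR_ge0 // mulrA.
Qed.

Lemma eigen_classical o (lam : R) (f : R -> R[i]) : edge_length_gt0 o -> lam < 0 ->
  in_H2 (interval o) f -> continuous_on (interval o) f ->
  {ae mu, forall x, interval o x ->
     - wderiv (interval o) (wderiv (interval o) f) x = lam%:C * f x} ->
  exists u v : bool -> R -> R, [/\ edge_state o u v,
    forall c x, interval o x -> der x (v c) (- lam * u c x) &
    forall x, interval o x -> f x = cplx (u^~ x)].
Proof.
move=> oL lam0 [hf hg] [cr ci] eq.
have [lg /weak_derivative_comp fg] := wderivP hf.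
have [lh /weak_derivative_comp gh] := wderivP hg.
have /in_L2_comp[mf f2] : in_L2 (interval o) f by case: hf.
have ex c : exists uv : (R -> R) * (R -> R),
   [/\ forall x, interval o x -> der x uv.1 (uv.2 x), decaying o uv.1, decaying o uv.2,
       forall x, interval o x -> der x uv.2 (- lam * uv.1 x) &
       forall x, interval o x -> comp c (f x) = uv.1 x].
  apply: (eigen_component oL lam0 _ (mf c) (f2 c) (in_L2_locint c lg) (in_L2_locint c lh)).
  - by case: c.
  - by move=> phi phi1 /bump_test_fun[t <-]; exact: fg.
  - by move=> phi phi1 /bump_test_fun[t <-]; exact: gh.
  - apply: ae_mono eq => x H ox; have {H} := H ox.
    move=> /(congr1 (fun z => - z)); rewrite opprK => ->.
    by case: (f x) => a b; case: c => /=; rewrite /= ?mul0r ?subr0 ?addr0 mulNr.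
have /(_ _)/cid H := ex.
exists (fun c => (projT1 (H c)).1), (fun c => (projT1 (H c)).2); split.
- by move=> c; case: (projT2 (H c)).
- by move=> c; case: (projT2 (H c)).
- move=> x ox; apply: eq_comp => c; rewrite comp_cplx.
  by case: (projT2 (H c)) => _ _ _ _; apply.
Qed.

End EigenfunctionRegularity.

(** * Critical points of the reduced action *)

Lemma continuous_mulmx (R : realType) (T : topologicalType) m n (f : T -> 'rV[R]_m)
  (A : 'M[R]_(m, n)) : continuous f -> continuous (fun x => f x *m A).
Proof.
move=> cf; apply: continuous_coordP => i.
have -> : (fun x => (f x *m A) 0 i) = (fun x => \sum_j f x 0 j * A j i).
  by apply/funext => x; rewrite mxE.
apply: continuous_sum => j; apply: continuousM_fun; first exact: continuous_coord.
by move=> x; exact: cst_continuous.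
Qed.

Lemma continuousD_row (R : realType) (T : topologicalType) n (f g : T -> 'rV[R]_n) :
  continuous f -> continuous g -> continuous (fun x => f x + g x).
Proof. by move=> cf cg x; apply: cvgD; [exact: cf|exact: cg]. Qed.

Lemma dot_mulmx (R : realType) m n (x : 'rV[R]_m) (A : 'M[R]_(m, n)) y :
  dot (x *m A) y = dot x (y *m A^T).
Proof.
have E k (u v : 'rV[R]_k) : dot u v = (u *m v^T) 0 0.
  by rewrite mxE; apply: eq_bigr => i _; rewrite mxE.
by rewrite !E trmx_mul trmxK mulmxA.
Qed.

Lemma dot_mulmx_bound (R : realType) n (A : 'M[R]_n) : exists2 C : R, 0 <= C &
  forall x, `|dot x (x *m A)| <= C * dot x x.
Proof.
exists (\sum_i \sum_j `|A i j|); first by apply: sumr_ge0 => i _; exact: sumr_ge0.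
move=> x; have -> : dot x (x *m A) = \sum_i \sum_j x 0 i * x 0 j * A j i.
  apply: eq_bigr => i _; rewrite mxE mulr_sumr; apply: eq_bigr => j _; ring.
have le1 (i : 'I_n) : x 0 i ^+ 2 <= dot x x.
  by rewrite /dot (bigD1 i) //= -expr2 lerDl sumr_ge0 // => j _; rewrite -expr2 sqr_ge0.
rewrite exchange_big mulr_suml; apply: le_trans (ler_norm_sum _ _ _) _.
apply: ler_sum => i _; rewrite mulr_suml; apply: le_trans (ler_norm_sum _ _ _) _.
apply: ler_sum => j _; rewrite normrM mulrC ler_wpM2l // ler_norml.
have := le1 i; have := le1 j; set a := x 0 i; set b := x 0 j => aD bD.
have := sqr_ge0 (a + b); have := sqr_ge0 (a - b); rewrite !expr2 => s1 s2.
rewrite !expr2 in aD bD; lra.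
Qed.

Section ReducedAction.
Variables (R : realType) (n : nat).
Notation V := 'rV[R]_n.
Variables (A : V -> R) (N : V -> V) (P L : 'M[R]_n).
Hypothesis A_grad : forall x y, A y <= A x + dot (N y) (y - x).
Hypothesis A_coercive : forall K, 0 <= K -> exists C, forall x, K * dot x x <= A x + C.
Hypothesis N_cont : continuous N.
Hypothesis N_odd : forall x, N (- x) = - N x.
Hypothesis P_sym : P^T = P.
Hypothesis P_idem : P *m P = P.
Hypothesis L_sym : L^T = L.

Definition reduced_action x : R := A x + 2^-1 * dot x (x *m L).
Definition reduced_grad x : V := N x + x *m L.
Definition critical z : Prop :=
  [/\ z *m P = z, reduced_grad z *m P = 0 & reduced_action z < 0].

(* The constraint x P = x is built into an action on the whole space, the
   critical points of which are the constrained ones. *)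
Definition full_action x : R :=
  reduced_action (x *m P) + 2^-1 * dot (x - x *m P) (x - x *m P).
Definition full_grad x : V := reduced_grad (x *m P) *m P + (x - x *m P).

Let Q_sym x y : dot (x - x *m P) y = dot x (y - y *m P).
Proof. by rewrite dotDl dotDr dotNl dotNr dot_mulmx P_sym. Qed.

Let pythagoras x : dot x x = dot (x *m P) (x *m P) + dot (x - x *m P) (x - x *m P).
Proof.
rewrite Q_sym mulmxBl -mulmxA P_idem subrr subr0 dot_mulmx P_sym -mulmxA P_idem.
by rewrite -dotDr addrCA subrr addr0.
Qed.

Lemma full_grad_cont : continuous full_grad.
Proof.
have cid : continuous (fun x : V => x) by move=> x; exact: id.
have cP := continuous_mulmx (A := P) cid.
apply: continuousD_row; last exact: continuousB_row.
apply: continuous_mulmx; apply: continuousD_row; last exact: continuous_mulmx.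
by move=> x; apply: continuous_comp; [exact: cP|exact: N_cont].
Qed.

Lemma full_grad_odd x : full_grad (- x) = - full_grad x.
Proof. by rewrite /full_grad /reduced_grad !(mulNmx, N_odd) -!opprD mulNmx -opprD. Qed.

(** Convexity of A gives the inequality without the quadratic error, which
    only stems from the form L. *)
Lemma full_action_grad : exists2 C, 0 <= C & forall x y,
  full_action y <= full_action x + dot (full_grad y) (y - x) + C * dot (y - x) (y - x).
Proof.
have [C C0 LC] := dot_mulmx_bound L.
exists C => // x y.
have := A_grad (x *m P) (y *m P).
have quad (u v : V) (B : 'M[R]_n) : B^T = B ->
    dot v (v *m B) = dot u (u *m B) + 2 * dot (v *m B) (v - u) - dot (v - u) ((v - u) *m B).
  move=> Bs; rewrite mulmxBl !(dotDl, dotDr, dotNl, dotNr) (dotC u (v *m B)).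
  rewrite [dot (v *m B) u]dot_mulmx Bs (dotC (v *m B) v); ring.
have q1 := quad (x *m P) (y *m P) L L_sym.
have := quad (x - x *m P) (y - y *m P) 1%:M (trmx1 _ _).
rewrite !mulmx1 => q2.
have := LC (y *m P - x *m P); rewrite ler_norml => /andP[l1 _].
have d1 := pythagoras (y - x); rewrite mulmxBl in d1.
have d2 := dot_ge0 (y - x - (y *m P - x *m P)).
have E : y - y *m P - (x - x *m P) = y - x - (y *m P - x *m P).
  by rewrite !opprB addrACA [RHS]addrACA; congr (_ + _); rewrite addrC.
rewrite E in q2.
have g1 : dot (full_grad y) (y - x) = dot (N (y *m P)) (y *m P - x *m P)
   + dot (y *m P *m L) (y *m P - x *m P)
   + dot (y - y *m P) (y - x - (y *m P - x *m P)).
  rewrite dotDl dot_mulmx P_sym mulmxBl dotDl; congr (_ + _).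
  by rewrite -mulmxBl !Q_sym [(y - x - _) *m P]mulmxBl -mulmxA P_idem subrr subr0.
have := mulr_ge0 C0 d2; have := mulr_ge0 C0 (dot_ge0 (y *m P - x *m P)).
rewrite /full_action /reduced_action g1 d1; lra.
Qed.

(** A grows faster than any quadratic form. *)
Lemma full_action_bounded : exists M, forall x, full_action x <= 0 -> `|x| <= M.
Proof.
have [C C0 LC] := dot_mulmx_bound L.
have [B AB] := A_coercive (addr_ge0 C0 ler01).
exists (1 + 2 * `|B|) => x x0.
have xB : dot x x <= 2 * `|B|.
  have := AB (x *m P); have := LC (x *m P); rewrite ler_norml => /andP[l1 _].
  move: x0; rewrite /full_action /reduced_action (pythagoras x).
  have := dot_ge0 (x *m P); have := dot_ge0 (x - x *m P); have := ler_norm B.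
  have := mulr_ge0 C0 (dot_ge0 (x *m P)).
  lra.
have c0 : 0 <= 1 + 2 * `|B| by rewrite addr_ge0 // mulr_ge0.
apply: norm_le_coord => // i.
have le1 : x 0 i ^+ 2 <= dot x x.
  rewrite /dot (bigD1 i) //= -expr2 lerDl sumr_ge0 // => j _.
  by rewrite -expr2 sqr_ge0.
rewrite -ler_sqr ?nnegrE // real_normK ?num_real //.
have := mulr_ge0 (ler0n R 2) (normr_ge0 B); nra.
Qed.

Lemma continuous_full_action : continuous full_action.
Proof.
have [C C0 g] := full_action_grad.
exact: continuous_of_grad full_grad_cont g.
Qed.

Lemma full_action_constrained x : x *m P = x -> full_action x = reduced_action x.
Proof. by move=> xP; rewrite /full_action xP subrr dot0l mulr0 addr0. Qed.

Lemma full_grad0 x : full_grad x = 0 -> x *m P = x /\ reduced_grad x *m P = 0.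
Proof.
move=> D0; have xP : x *m P = x.
  apply/eqP; rewrite eq_sym -subr_eq0 -dot_eq0.
  have : dot (full_grad x) (x - x *m P) = 0 by rewrite D0 dot0l.
  rewrite dotDl dot_mulmx P_sym [(_ - _) *m P]mulmxBl -mulmxA P_idem subrr dotC dot0l add0r.
  by move=> ->.
by split=> //; move: D0; rewrite /full_grad xP subrr addr0.
Qed.

(** If every negative critical point were equivalent to one of m given ones,
    the detectors would bound the genus of the sublevel sets by d m, and the
    odd map h would violate the Borsuk-Ulam theorem as soon as d m <= r. *)
Theorem many_critical (d r k : nat) (eqv : V -> V -> Prop) (h : 'rV[R]_r.+1 -> V) (a : R) :
  (forall z, critical z -> exists phi : V -> 'rV[R]_d, [/\ continuous phi,
     forall x, phi (- x) = - phi x &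
     forall x, critical x -> eqv x z -> reduced_action x = reduced_action z /\ phi x != 0]) ->
  continuous h -> (forall b, h (- b) = - h b) -> (forall b, h b *m P = h b) -> a < 0 ->
  (forall b, r.+1%:R^-1 <= `|b| <= 1 -> reduced_action (h b) <= a) ->
  (d * k <= r)%N ->
  exists zs : 'I_k.+1 -> V, (forall i, critical (zs i)) /\
    forall i j : 'I_k.+1, (i < j)%N -> ~ eqv (zs j) (zs i).
Proof.
move=> det ch hN hP a0 ha dk.
have step m (zs : 'I_m -> V) : (m <= k)%N -> (forall i, critical (zs i)) ->
    exists2 x, critical x & forall i, ~ eqv x (zs i).
  move=> mk cz; apply: contrapT => no.
  have cover x : critical x -> exists i, eqv x (zs i).
    move=> cx; apply: contrapT => ni; apply: no; exists x => // i e; apply: ni.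
    by exists i.
  have /(_ _)/cid D i := det _ (cz i).
  pose phi i := projT1 (D i).
  have [C C0 g] := full_action_grad; have [M bM] := full_action_bounded.
  have [|||m' [f [m'd cf fN f0]]] := genus_sublevel full_grad_cont full_grad_odd C0 g bM
     (lev := fun i => reduced_action (zs i)) (phi := phi) (S := [set: 'I_m]%SET) (ltW a0).
  - by move=> i; case: (projT2 (D i)).
  - by move=> i x; have [_ H _] := projT2 (D i); exact: H.
  - move=> x xa /full_grad0[xP x0].
    rewrite full_action_constrained // in xa *.
    have cx : critical x by split=> //; exact: le_lt_trans xa a0.
    have [i e] := cover x cx; exists i; rewrite inE.
    by have [_ _ /(_ x cx e)[-> ->]] := projT2 (D i).
  rewrite cardsT card_ord in m'd.
  have : (r < m')%N.
    apply: (@borsuk_ulam _ _ _ (f \o h)).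
    - by move=> x; apply: continuous_comp; [exact: ch|exact: cf].
    - by move=> x /=; rewrite hN fN.
    - by move=> x xs; apply: f0 => /=; rewrite full_action_constrained //; exact: ha.
  rewrite ltnNge => /negP; apply; apply: leq_trans m'd (leq_trans _ dk).
  by rewrite leq_mul2l mk orbT.
suff H m : (m <= k.+1)%N -> exists zs : 'I_m -> V, (forall i, critical (zs i)) /\
    forall i j : 'I_m, (i < j)%N -> ~ eqv (zs j) (zs i) by exact: H.
elim: m => [|m IH] mk; first by exists (fun _ => 0); split=> [[]|[]].
have [zs [cz ne]] := IH (ltnW mk).
have [x cx nx] := step m zs mk cz.
exists (fun i => if unlift ord_max i is Some j then zs j else x); split.
  by move=> i; case: unliftP.
move=> i j; case: unliftP => [j' ->|->]; case: unliftP => [i' ->|->].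
- by rewrite !lift_max; exact: ne.
- by rewrite lift_max ltnNge ltnW.
- by move=> _; exact: nx.
- by rewrite ltnn.
Qed.

End ReducedAction.

(** * Solutions on a metric graph with prescribed vertex values *)

Section GraphStates.
Variables (R : realType) (G : metric_graph R).
Notation data := (edge_end G -> bool -> R).
Notation states := (edge G -> bool -> R -> R).
Implicit Types (e : edge G) (a : edge_end G) (z : data) (U V : states).

Definition elen e : option R := if e is inl f then Some (len f) else None.

Lemma elen_gt0 e : edge_length_gt0 (elen e).
Proof. by case: e => //= f; exact: len_gt0. Qed.

Lemma edge_domE e : edge_dom e = interval (elen e).
Proof. by case: e. Qed.

Definition end_edge a : edge G :=
  match a with inl (f, _) => inl f | inr h => inr h end.
Definition end_pos a : R := if a is inl (f, true) then len f else 0.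
Definition end_sign a : R := if a is inl (_, true) then -1 else 1.

Lemma end_pos_interval a : interval (elen (end_edge a)) (end_pos a).
Proof.
apply/intervalP; case: a => [[f []]|h] /=; split=> //; rewrite ?lexx // ltW //;
exact: len_gt0.
Qed.

Lemma sum_edge_ends (F : edge_end G -> R) :
  \sum_a F a = \sum_e (if e is inl f then F (inl (f, true)) + F (inl (f, false))
                       else if e is inr h then F (inr h) else 0).
Proof.
rewrite !big_sumType /=; congr (_ + _).
transitivity (\sum_(i : fin_edge G * bool) F (inl (i.1, i.2))).
  by apply: eq_bigr => -[].
rewrite -(pair_bigA _ (fun f b => F (inl (f, b)))) /=.
by apply: eq_bigr => f _; rewrite big_bool.
Qed.

Lemma sum_boundary (F : edge G -> R -> R) :
  \sum_e boundary (elen e) (F e) = - \sum_a end_sign a * F (end_edge a) (end_pos a).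
Proof.
rewrite sum_edge_ends -sumrN; apply: eq_bigr => -[f|h] _ /=; last by rewrite mul1r.
by ring.
Qed.

Definition graph_state U V : Prop := forall e, edge_state (elen e) (U e) (V e).
Definition trace U : data := fun a c => U (end_edge a) c (end_pos a).
Definition outgoing V : data := fun a c => end_sign a * V (end_edge a) c (end_pos a).

End GraphStates.

Section GraphSolutions.
Variables (R : realType) (p om : R) (G : metric_graph R).
Hypothesis p_gt1 : 1 < p.
Hypothesis om_gt0 : 0 < om.
Notation data := (edge_end G -> bool -> R).
Notation states := (edge G -> bool -> R -> R).
Implicit Types (e : edge G) (a : edge_end G) (z : data) (U V : states).

Lemma segment_solution_edge L u v : 0 < L ->
  segment_solution (pow_profile p) om L u v <-> edge_solution p om (Some L) u v.
Proof.
move=> L0; split=> [uv|[uv eq] c x xL].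
  have i (x : R) : interval (Some L) x -> 0 <= x <= L by rewrite /= in_itv.
  split=> c; last by move=> x /i xL; have [] := uv c x xL.
  split; first by move=> x /i xL; have [] := uv c x xL.
    by apply: decaying_segment => // x xL; have [d _] := uv c x xL; exact: der_continuous d.
  by apply: decaying_segment => // x xL; have [_ d] := uv c x xL; exact: der_continuous d.
have ox : interval (Some L) x by rewrite /= in_itv.
by split; [have [d _ _] := uv c; exact: d|exact: eq].
Qed.

Lemma solve_segment (f : fin_edge G) (al be : bool -> R) :
  exists uv : (bool -> R -> R) * (bool -> R -> R),
    segment_solution (pow_profile p) om (len f) uv.1 uv.2 /\
    forall c, uv.1 c 0 = al c /\ uv.1 c (len f) = be c.
Proof.
by have [u [v H]] := power_bvp p_gt1 om_gt0 (len_gt0 f) al be; exists (u, v).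
Qed.

Definition sol z e : (bool -> R -> R) * (bool -> R -> R) :=
  match e with
  | inl f => projT1 (cid (solve_segment f (z (inl (f, false))) (z (inl (f, true)))))
  | inr h => (halfline_u p om (z (inr h)), halfline_v p om (z (inr h)))
  end.

Definition solU z : states := fun e => (sol z e).1.
Definition solV z : states := fun e => (sol z e).2.

Lemma sol_segment z (f : fin_edge G) :
  segment_solution (pow_profile p) om (len f) (solU z (inl f)) (solV z (inl f)) /\
  forall c, solU z (inl f) c 0 = z (inl (f, false)) c /\
            solU z (inl f) c (len f) = z (inl (f, true)) c.
Proof. by rewrite /solU /solV /sol; case: cid => uv /= []. Qed.

Lemma sol_edge z e : edge_solution p om (elen e) (solU z e) (solV z e).
Proof.
case: e => [f|h]; first by apply/(segment_solution_edge _ _ (len_gt0 f)); have [] := sol_segment z f.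
have H c (x : R) (x0 : 0 <= x) := halfline_solution p_gt1 om_gt0 (z (inr h)) c x0.
have [C C0 D] := halfline_decay p_gt1 om_gt0 (z (inr h)).
have s0 : 0 < Num.sqrt om by rewrite sqrtr_gt0.
split=> c; last by move=> x /interval_ge0 x0; have [] := H c x x0.
split; first by move=> x /interval_ge0 x0; have [] := H c x x0.
  split; first by move=> x /interval_ge0 x0; have [d _] := H c x x0; exact: der_continuous d.
  by exists C, (Num.sqrt om); split=> // x /interval_ge0 x0; have [] := D c x x0.
split; first by move=> x /interval_ge0 x0; have [_ d] := H c x x0; exact: der_continuous d.
by exists C, (Num.sqrt om); split=> // x /interval_ge0 x0; have [] := D c x x0.
Qed.

Lemma sol_state z : graph_state (solU z) (solV z).
Proof. by move=> e; have [] := sol_edge z e. Qed.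

Lemma sol_trace z : trace (solU z) = z.
Proof.
apply/funext => -[[f b]|h]; apply/funext => c; rewrite /trace /=.
  by have [_ /(_ c)[]] := sol_segment z f; case: b.
by have [] := halfline_start om p_gt1 (z (inr h)) c.
Qed.

Definition slope z : data := outgoing (solV z).
Definition graph_action U V : R := \sum_e edge_action p om (elen e) (U e) (V e).

Lemma graph_action_ge0 U V : 0 <= graph_action U V.
Proof.
apply: sumr_ge0 => e _; apply: Rintegral_ge0 => y _.
have p0 : 0 <= (p + 1)^-1 by rewrite invr_ge0 ltW // addr_gt0 // (lt_trans _ p_gt1).
have o0 : 0 <= om / 2 by rewrite divr_ge0 // ltW.
have h0 : 0 <= 2^-1 :> R by rewrite invr_ge0.
exact: addr_ge0 (addr_ge0 (mulr_ge0 h0 (ip_ge0 _)) (mulr_ge0 o0 (ip_ge0 _)))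
  (mulr_ge0 p0 (pow_term_ge0 _ _)).
Qed.

Definition min_action z : R := graph_action (solU z) (solV z).

(** The solution minimises the convex action for its vertex values; for other
    vertex values the boundary terms of the tangent inequality are the
    outgoing slopes. *)
Lemma min_action_le z U V : graph_state U V ->
  min_action z - \sum_a ip (slope z a) (fun c => trace U a c - z a c) <= graph_action U V.
Proof.
move=> UV.
have -> : - \sum_a ip (slope z a) (fun c => trace U a c - z a c) =
  \sum_e boundary (elen e) (fun x => ip ((solV z e)^~ x) (fun c => U e c x - solU z e c x)).
  rewrite sum_boundary; congr (- _); apply: eq_bigr => a _.
  have T c : z a c = solU z (end_edge a) c (end_pos a) by rewrite -[in LHS](sol_trace z).
  by rewrite /ip !T /slope /outgoing /trace; ring.
rewrite -big_split; apply: ler_sum => e _ /=.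
have H := edge_action_convex p_gt1 om_gt0 (elen_gt0 e) (sol_edge z e) (UV e).
exact: H.
Qed.

Lemma min_action_trace_le U V : graph_state U V ->
  min_action (trace U) <= graph_action U V.
Proof.
move=> UV; apply: le_trans (min_action_le (trace U) UV); rewrite -[leLHS]subr0 lerD2l lerN2.
by apply: sumr_le0 => a _; rewrite /ip !subrr !mulr0 addr0.
Qed.

Lemma min_action_coercive K : 0 <= K -> exists C, forall z,
  K * \sum_a ip (z a) (z a) <= min_action z + C.
Proof.
move=> K0; have /(_ _)/cid H e := edge_action_coercive p_gt1 om_gt0 (elen_gt0 e) K0.
exists (\sum_e projT1 (H e)) => z; rewrite -big_split sum_edge_ends mulr_sumr.
apply: ler_sum => e _ /=; apply: le_trans (projT2 (H e) _ _ (sol_state z e)).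
have T a c : solU z (end_edge a) c (end_pos a) = z a c by rewrite -{2}(sol_trace z).
rewrite le_eqVlt; apply/orP; left; apply/eqP; congr (K * _).
case: e => [f|h] /=; rewrite /ip.
  by rewrite -!(T (inl (f, false))) -!(T (inl (f, true))) /= addrC.
by rewrite -!(T (inr h)) /= addr0.
Qed.

Lemma slope_segment z (f : fin_edge G) b c :
  slope z (inl (f, b)) c = (if b then -1 else 1) * solV z (inl f) c (if b then len f else 0).
Proof. by case: b. Qed.

Lemma slope_halfline z (h : inf_edge G) c :
  slope z (inr h) c = - (Num.sqrt om * halfline_slope p om (nm (z (inr h))) * z (inr h) c).
Proof.
by rewrite /slope /outgoing /= mul1r; have [] := halfline_start om p_gt1 (z (inr h)) c.
Qed.

(** On a segment the slopes at the ends are locally Lipschitz functions of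
    the end values; on a half-line they are explicit. *)
Lemma continuous_slope (T : topologicalType) (Z : T -> data) a c :
  (forall a c, continuous (fun t => Z t a c)) -> continuous (fun t => slope (Z t) a c).
Proof.
move=> cZ; case: a => [[f b]|h]; last first.
  under eq_fun do rewrite slope_halfline.
  have cs := continuous_halfline_slope (p := p) (om := om) p_gt1 (cZ (inr h)).
  move=> t; apply: cvgN; apply: cvgM; last exact: cZ.
  by apply: cvgM; [exact: cvg_cst|exact: cs].
have cnm (W : T -> bool -> R) : (forall c, continuous (W^~ c)) -> continuous (fun t => nm (W t)).
  move=> cW t; apply: (@continuous_comp T R R (fun t => ip (W t) (W t)) Num.sqrt).
    by apply: cvgD; apply: cvgM; exact: cW.
  exact: sqrt_continuous.
under eq_fun do rewrite slope_segment.
move=> t0; apply: cvgM; first exact: cvg_cst.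
pose M := nm (Z t0 (inl (f, false))) + nm (Z t0 (inl (f, true))) + 1.
have M0 : 0 <= M by rewrite !addr_ge0 // nm_ge0.
have [C C0 sl] := power_solution_slope p_gt1 om_gt0 (len_gt0 f) M0.
pose d t := nm (fun c => Z t0 (inl (f, false)) c - Z t (inl (f, false)) c) +
            nm (fun c => Z t0 (inl (f, true)) c - Z t (inl (f, true)) c).
have cd : continuous d.
  apply: continuousD_fun; apply: cnm => c'; apply: continuousB_fun => //;
  by move=> t; exact: cst_continuous.
have d0 : d t0 = 0.
  have H (w : bool -> R) : nm (fun c => w c - w c) = 0.
    by rewrite -[RHS](nm0 R); congr nm; apply/funext => c'; rewrite subrr.
  by rewrite /d !H addr0.
have nb b' : \forall t \near t0, nm (Z t (inl (f, b'))) <= M.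
  have lt : nm (Z t0 (inl (f, b'))) < M.
    by case: b'; rewrite /M; have := nm_ge0 (Z t0 (inl (f, false)));
       have := nm_ge0 (Z t0 (inl (f, true))); lra.
  have := @cnm (fun t => Z t (inl (f, b'))) (fun c => cZ _ c) t0.
  by move=> /cvgr_le; apply.
have nZ b' : nm (Z t0 (inl (f, b'))) <= M.
  by case: b'; rewrite /M; have := nm_ge0 (Z t0 (inl (f, false)));
     have := nm_ge0 (Z t0 (inl (f, true))); lra.
have E t b' : (solU (Z t) (inl f))^~ (if b' then len f else 0) = Z t (inl (f, b')).
  by apply/funext => c'; have [_ /(_ c')[]] := sol_segment (Z t) f; case: b'.
apply/cvgrPdist_le => e e0.
have e1 : 0 < e / (C + 1) by rewrite divr_gt0 // ltr_wpDl.
have nd : \forall t \near t0, d t <= e / (C + 1).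
  by have := cd t0; rewrite /continuous_at d0 => /cvgr_le; apply.
near=> t.
have dt0 : 0 <= d t by rewrite addr_ge0 // nm_ge0.
have [_ s1 s2] : [/\ forall x, 0 <= x <= len f -> nm (fun c => solU (Z t0) (inl f) c x - solU (Z t) (inl f) c x) <= d t,
    forall c, `|solV (Z t0) (inl f) c 0 - solV (Z t) (inl f) c 0| <= C * d t &
    forall c, `|solV (Z t0) (inl f) c (len f) - solV (Z t) (inl f) c (len f)| <= C * d t].
  apply: sl => //; [by have [] := sol_segment (Z t0) f|by have [] := sol_segment (Z t) f| | |].
  - rewrite (E _ false) (E _ true) (E _ false) (E _ true); split=> //; near: t; exact: nb.
  - rewrite (_ : (fun c => _) = fun c => Z t0 (inl (f, false)) c - Z t (inl (f, false)) c).
      by rewrite lerDl nm_ge0.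
    by apply/funext => c'; rewrite -!(E _ false).
  - rewrite (_ : (fun c => _) = fun c => Z t0 (inl (f, true)) c - Z t (inl (f, true)) c).
      by rewrite lerDr nm_ge0.
    by apply/funext => c'; rewrite -!(E _ true).
apply: le_trans (_ : C * d t <= _); first by case: b.
have : d t <= e / (C + 1) by near: t.
rewrite ler_pdivlMr ?ltr_wpDl // mulrDr mulr1 mulrC; apply: le_trans.
by rewrite lerDl.
Unshelve. all: by end_near.
Qed.

Lemma sol_segment_unique z (f : fin_edge G) u v :
  segment_solution (pow_profile p) om (len f) u v ->
  (forall c, u c 0 = z (inl (f, false)) c) -> (forall c, u c (len f) = z (inl (f, true)) c) ->
  (forall c x, 0 <= x <= len f -> solU z (inl f) c x = u c x) /\
  (forall c b, solV z (inl f) c (if b then len f else 0) = v c (if b then len f else 0)).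
Proof.
move=> uv u0 uL; have [su e] := sol_segment z f.
pose M := nm (u^~ 0) + nm (u^~ (len f)).
have M0 : 0 <= M by rewrite addr_ge0 // nm_ge0.
have [C C0 sl] := power_solution_slope p_gt1 om_gt0 (len_gt0 f) M0.
have e0 : (solU z (inl f))^~ 0 = u^~ 0 by apply/funext => c; rewrite u0; have [] := e c.
have eL : (solU z (inl f))^~ (len f) = u^~ (len f).
  by apply/funext => c; rewrite uL; have [] := e c.
have [|||H1 H2 H3] := sl _ _ _ _ 0 (lexx 0) su uv.
- by rewrite e0 eL /M; split; rewrite ?lerDl ?lerDr nm_ge0.
- rewrite (_ : (fun c => _) = fun=> 0) ?nm0 //; apply/funext => c.
  by rewrite (congr1 (@^~ c) e0) subrr.
- rewrite (_ : (fun c => _) = fun=> 0) ?nm0 //; apply/funext => c.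
  by rewrite (congr1 (@^~ c) eL) subrr.
rewrite mulr0 in H2 H3; split=> [c x xL|c b].
  have := le_trans (coord_le_nm _ c) (H1 x xL).
  by rewrite normr_le0 subr_eq0 => /eqP.
apply/eqP; rewrite -subr_eq0 -normr_le0.
by case: b; [exact: H3|exact: H2].
Qed.

(** The radial nonlinearity commutes with sign changes of each of the two
    real components, and solutions on a segment are unique. *)
Lemma sol_reflect (s : bool -> R) z : (forall c, s c * s c = 1) ->
  (forall (f : fin_edge G) c x, 0 <= x <= len f ->
     solU (fun a c => s c * z a c) (inl f) c x = s c * solU z (inl f) c x) /\
  forall a c, slope (fun a c => s c * z a c) a c = s c * slope z a c.
Proof.
move=> s2.
have nmS (w : bool -> R) : nm (fun c => s c * w c) = nm w.
  have m c : s c * w c * (s c * w c) = w c * w c by rewrite mulrACA s2 mul1r.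
  by rewrite /nm /ip !m.
have F f : (forall c x, 0 <= x <= len f ->
     solU (fun a c => s c * z a c) (inl f) c x = s c * solU z (inl f) c x) /\
   (forall c b, solV (fun a c => s c * z a c) (inl f) c (if b then len f else 0) =
      s c * solV z (inl f) c (if b then len f else 0)).
  have [su e] := sol_segment z f.
  apply: (@sol_segment_unique _ f (fun c x => s c * solU z (inl f) c x)
     (fun c x => s c * solV z (inl f) c x)).
  - move=> c x xL; have [d1 d2] := su c x xL; split; first exact: derZ.
    by apply: der_eq (derZ (s c) d2) _; rewrite /radial nmS; ring.
  - by move=> c; have [-> _] := e c.
  - by move=> c; have [_ ->] := e c.
split=> [f|[[f b]|h] c]; first by have [] := F f.
  by have [_ H] := F f; rewrite !slope_segment H mulrCA.
by rewrite !slope_halfline nmS; ring.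
Qed.

Lemma slope_odd z a c : slope (fun a c => - z a c) a c = - slope z a c.
Proof.
have [_ H] := @sol_reflect (fun=> -1) z (fun _ => etrans (mulrNN 1 1) (mulr1 1)).
by rewrite -mulN1r -H; congr (slope _ a c); apply/funext => b; apply/funext => d; rewrite mulN1r.
Qed.

Lemma sol_real z : (forall a, z a true = 0) ->
  (forall e x, interval (elen e) x -> solU z e true x = 0) /\
  forall a, slope z a true = 0.
Proof.
move=> z0; pose s c : R := if c then -1 else 1.
have [|H1 H2] := @sol_reflect s z; first by case; rewrite /s ?mulrNN mulr1.
have zE : (fun a c => s c * z a c) = z.
  by apply/funext => a; apply/funext => -[]; rewrite /s ?mul1r // z0 mulr0.
rewrite zE in H1 H2.
have neg (x : R) : x = -1 * x -> x = 0 by rewrite mulN1r => e; lra.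
split=> [[f|h] x ox|a]; last exact: neg (H2 a true).
  by apply: neg; apply: (H1 f true); move: ox; rewrite /= in_itv.
by rewrite /solU /sol /= /halfline_u z0 mul0r.
Qed.

End GraphSolutions.
Local Open Scope sesquilinear_scope.

(** * Vertex conditions as real matrices *)

Lemma linear_matrix (R : realType) m n (f : 'rV[R]_m -> 'rV[R]_n) : linear f ->
  exists M : 'M[R]_(m, n), forall x, x *m M = f x.
Proof.
move=> lf; pose g : {linear 'rV[R]_m -> 'rV[R]_n} :=
  HB.pack f (GRing.isLinear.Build R _ _ _ f lf).
by exists (lin1_mx g) => x; rewrite mul_rV_lin1.
Qed.

Lemma matrix_ext (R : realType) m n (A B : 'M[R]_(m, n)) :
  (forall x : 'rV[R]_m, x *m A = x *m B) -> A = B.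
Proof. by move=> AB; apply/row_matrixP => i; rewrite !rowE. Qed.

Lemma trmx_of_dot (R : realType) n (A B : 'M[R]_n) :
  (forall x y, dot (x *m A) y = dot x (y *m B)) -> A^T = B.
Proof.
move=> AB; apply: matrix_ext => y; apply/eqP; rewrite -subr_eq0 -dot_eq0.
set x := _ - _; have := AB x y; rewrite dot_mulmx => /eqP.
by rewrite -subr_eq0 -dotNr -dotDr.
Qed.

Section VertexAlgebra.
Variables (R : realType) (G : metric_graph R).
Notation data := (edge_end G -> bool -> R).
Notation C := R[i].
Implicit Types (a : edge_end G) (z w s : data) (v : vertex G).

Definition dim : nat := #|{: edge_end G * bool}|.
Notation V := 'rV[R]_dim.

Definition vec z : V := \row_i z (enum_val i).1 (enum_val i).2.
Definition unvec (x : V) : data := fun a c => x 0 (enum_rank (a, c)).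

Lemma vecK z : unvec (vec z) = z.
Proof. by apply/funext => a; apply/funext => c; rewrite /unvec mxE enum_rankK. Qed.

Lemma unvecK x : vec (unvec x) = x.
Proof. by apply/rowP => i; rewrite mxE /unvec -surjective_pairing enum_valK. Qed.

Lemma unvecD x y : unvec (x + y) = fun a c => unvec x a c + unvec y a c.
Proof. by apply/funext => a; apply/funext => c; rewrite /unvec mxE. Qed.

Lemma unvecZ k x : unvec (k *: x) = fun a c => k * unvec x a c.
Proof. by apply/funext => a; apply/funext => c; rewrite /unvec mxE. Qed.

Lemma vec_linear k z w : vec (fun a c => k * z a c + w a c) = k *: vec z + vec w.
Proof. by apply/rowP => i; rewrite !mxE. Qed.

Lemma dot_vec z w : dot (vec z) (vec w) = \sum_a ip (z a) (w a).
Proof.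
rewrite /dot (reindex (@enum_rank _)) /=; last first.
  by exists (@enum_val _ _) => i _; [exact: enum_rankK|exact: enum_valK].
transitivity (\sum_(q : edge_end G * bool) z q.1 q.2 * w q.1 q.2).
  by apply: eq_bigr => q _; rewrite !mxE !enum_rankK.
rewrite -(pair_bigA _ (fun a c => z a c * w a c)) /=; apply: eq_bigr => a _.
by rewrite big_bool /ip addrC.
Qed.

Definition at_vertex z v : 'cV[C]_(degree v) := \col_i cplx (z (enum_val i)).

Lemma mem_ends a : a \in ends_at (end_vertex a). Proof. by rewrite inE. Qed.
Definition end_rank a : 'I_(degree (end_vertex a)) := enum_rank_in (mem_ends a) a.

Lemma end_rankK a : enum_val (end_rank a) = a.
Proof. by rewrite enum_rankK_in // mem_ends. Qed.

Definition glue (w : forall v, 'cV[C]_(degree v)) : data :=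
  fun a c => comp c (w (end_vertex a) (end_rank a) 0).

Lemma cplx_comp (x : C) : cplx (fun c => comp c x) = x.
Proof. by apply: eq_comp => c; rewrite comp_cplx. Qed.

(** The vertex of an edge end determines the type of the vector, whence the
    detour by an arbitrary v equal to that vertex. *)
Lemma at_vertex_glue (w : forall v, 'cV[C]_(degree v)) v : at_vertex (glue w) v = w v.
Proof.
apply/colP => i; rewrite mxE /glue cplx_comp.
have ev : end_vertex (enum_val i) = v by have := enum_valP i; rewrite inE => /eqP.
suff H a (j : 'I_(degree v)) : end_vertex a = v -> enum_val j = a ->
    w (end_vertex a) (end_rank a) 0 = w v j 0 by exact: H.
move=> av; subst v => ja; congr (w _ _ 0); apply: enum_val_inj.
by rewrite ja end_rankK.
Qed.

Lemma glue_at_vertex z : glue (at_vertex z) = z.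
Proof.
apply/funext => a; apply/funext => c.
by rewrite /glue mxE comp_cplx end_rankK.
Qed.

Lemma at_vertex_inj z w : (forall v, at_vertex z v = at_vertex w v) -> z = w.
Proof.
move=> zw; rewrite -(glue_at_vertex z) -(glue_at_vertex w); congr glue.
by apply: functional_extensionality_dep.
Qed.

Lemma at_vertexD k z w v :
  at_vertex (fun a c => k * z a c + w a c) v = k%:C *: at_vertex z v + at_vertex w v.
Proof.
by apply/colP => i; rewrite !mxE; apply: eq_comp => -[]; rewrite /= ?mul0r ?subr0 ?addr0.
Qed.

Lemma sum_at_vertex z w :
  \sum_a ip (z a) (w a) = \sum_v reC (hdot (at_vertex z v) (at_vertex w v)).
Proof.
rewrite (partition_big (@end_vertex _ G) xpredT) //=; apply: eq_bigr => v _.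
transitivity (\sum_(a in ends_at v) ip (z a) (w a)).
  by apply: eq_bigl => a; rewrite inE.
rewrite big_enum_val /hdot.
rewrite (big_morph (@complex.Re R) (id1 := 0) (op1 := +%R)) //; last by move=> [? ?] [? ?].
apply: eq_bigr => i _; rewrite !mxE /ip /=; ring.
Qed.

Lemma hdot_mx d (x y : 'cV[C]_d) : hdot x y = (y ^t* *m x) 0 0.
Proof. by rewrite mxE; apply: eq_bigr => i _; rewrite !mxE mulrC. Qed.

Lemma hdot_adjoint d (M : 'M[C]_d) x y : hdot (M *m x) y = hdot x (M ^t* *m y).
Proof. by rewrite !hdot_mx trmx_mul map_mxM trmxCK mulmxA. Qed.

Definition blockwise (M : forall v, 'M[C]_(degree v)) z : data :=
  glue (fun v => M v *m at_vertex z v).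

Lemma at_blockwise M z v : at_vertex (blockwise M z) v = M v *m at_vertex z v.
Proof. exact: at_vertex_glue. Qed.

Lemma blockwise_linear M : linear (fun x => vec (blockwise M (unvec x))).
Proof.
move=> k x y; rewrite -vec_linear; congr vec; apply: at_vertex_inj => v.
rewrite at_vertexD !at_blockwise; rewrite unvecD unvecZ at_vertexD mulmxDr.
by rewrite scalemxAr.
Qed.

(** A matrix acting on complex vectors at each vertex, seen as a real matrix
    acting on the row of all the real coordinates of the vertex values. *)
Definition realmx M : 'M[R]_dim := projT1 (cid (linear_matrix (blockwise_linear M))).

Lemma realmxE M z : vec z *m realmx M = vec (blockwise M z).
Proof. by rewrite /realmx; case: cid => A /= ->; rewrite vecK. Qed.

Lemma realmx_mul M N : realmx M *m realmx N = realmx (fun v => N v *m M v).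
Proof.
apply: matrix_ext => x; rewrite -(unvecK x) mulmxA !realmxE; congr vec.
by apply: at_vertex_inj => v; rewrite !at_blockwise mulmxA.
Qed.

Lemma realmx_adjoint M : (realmx M)^T = realmx (fun v => M v ^t*).
Proof.
apply: trmx_of_dot => x y; rewrite -(unvecK x) -(unvecK y) !realmxE !dot_vec !sum_at_vertex.
by apply: eq_bigr => v _; rewrite !at_blockwise hdot_adjoint.
Qed.

Lemma realmx_eq M N z w : (vec z *m realmx M = vec w *m realmx N) <->
  forall v, M v *m at_vertex z v = N v *m at_vertex w v.
Proof.
rewrite !realmxE; split=> [/(congr1 unvec)|H].
  by rewrite !vecK => E v; rewrite -!at_blockwise E.
by congr vec; apply: at_vertex_inj => v; rewrite !at_blockwise.
Qed.

Definition rotmx : 'M[R]_dim := realmx (fun v => ('i : C)%:M).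

Lemma realmx1 : realmx (fun v => 1%:M) = 1%:M.
Proof.
apply: matrix_ext => x; rewrite -(unvecK x) realmxE mulmx1; congr vec.
by apply: at_vertex_inj => v; rewrite at_blockwise mul1mx.
Qed.

Lemma vec_rot z : vec z *m rotmx = vec (fun a c => if c then z a false else - z a true).
Proof.
rewrite realmxE; congr vec; apply: at_vertex_inj => v; rewrite at_blockwise mul_scalar_mx.
by apply/colP => i; rewrite !mxE; apply: eq_comp => -[] /=; ring.
Qed.

Lemma rotmx_comm M : rotmx *m realmx M = realmx M *m rotmx.
Proof.
rewrite !realmx_mul; apply: matrix_ext => x; rewrite -(unvecK x); apply/realmx_eq => v.
by rewrite scalar_mxC.
Qed.

Lemma rotmx_adjoint : rotmx^T = - rotmx.
Proof.
apply: trmx_of_dot => x y; rewrite mulmxN -(unvecK x) -(unvecK y) !vec_rot dotNr !dot_vec -sumrN.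
by apply: eq_bigr => a _; rewrite /ip; ring.
Qed.

Lemma rotmx2 : rotmx *m rotmx = - 1%:M.
Proof.
apply: matrix_ext => x; rewrite mulmxA mulmxN mulmx1 -(unvecK x) !vec_rot -scaleN1r.
rewrite -[RHS]addr0 -[0](_ : vec (fun _ _ => 0) = 0); last by apply/rowP => i; rewrite !mxE.
rewrite -vec_linear; congr vec; apply/funext => a; apply/funext => -[]; ring.
Qed.

Lemma repart_linear : linear (fun x => vec (fun a c => if c then 0 else unvec x a c)).
Proof.
move=> k x y; rewrite -vec_linear; congr vec; apply/funext => a; apply/funext => c.
by rewrite unvecD unvecZ; case: c; rewrite ?mulr0 ?addr0.
Qed.
Definition remx : 'M[R]_dim := projT1 (cid (linear_matrix repart_linear)).

Lemma remxE z : vec z *m remx = vec (fun a c => if c then 0 else z a c).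
Proof. by rewrite /remx; case: cid => A /= ->; rewrite vecK. Qed.

Lemma remx_sym : remx^T = remx.
Proof.
apply: trmx_of_dot => x y; rewrite -(unvecK x) -(unvecK y) !remxE !dot_vec.
by apply: eq_bigr => a _; rewrite /ip; ring.
Qed.

Lemma remx_idem : remx *m remx = remx.
Proof.
apply: matrix_ext => x; rewrite mulmxA -(unvecK x) !remxE; congr vec.
by apply/funext => a; apply/funext => -[].
Qed.

Lemma remx_fixed z : vec z *m remx = vec z <-> forall a, z a true = 0.
Proof.
rewrite remxE; split=> [/(congr1 unvec)|z0]; last first.
  by congr vec; apply/funext => a; apply/funext => -[]; rewrite ?z0.
by rewrite !vecK => E a; rewrite -E.
Qed.

Lemma remx_comm M : (forall v, real_mx (M v)) -> remx *m realmx M = realmx M *m remx.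
Proof.
move=> Mr; apply: matrix_ext => x; rewrite !mulmxA -(unvecK x) remxE !realmxE remxE; congr vec.
apply/funext => a; apply/funext => c; rewrite /blockwise /glue !mxE.
have compS c' (n : nat) (F : 'I_n -> C) : comp c' (\sum_i F i) = \sum_i comp c' (F i).
  by rewrite (big_morph (comp c') (id1 := 0) (op1 := +%R)) //; case: c' => // -[? ?] [? ?].
rewrite !compS; case: c.
  apply: big1 => i _; rewrite !mxE /=; have := Mr _ (end_rank a) i.
  by case: (M _ _ _) => m1 m2 /= ->; rewrite mulr0 mul0r addr0.
apply: eq_bigr => i _; rewrite !mxE /=; have := Mr _ (end_rank a) i.
by case: (M _ _ _) => m1 m2 /= ->; rewrite !mul0r.
Qed.

End VertexAlgebra.

(** * Functions satisfying the vertex conditions *)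

Section VertexConditions.
Variables (R : realType) (G : metric_graph R) (H : hamiltonian G).
Notation data := (edge_end G -> bool -> R).
Notation states := (edge G -> bool -> R -> R).
Implicit Types (z s : data) (U V : states) (psi : graph_fun G) (v : vertex G).

Lemma trmxC_mul0 d (A B : 'M[R[i]]_d) : A ^t* = A -> B ^t* = B -> A *m B = 0 -> B *m A = 0.
Proof. by move=> hA hB AB; rewrite -hA -hB -map_mxM -trmx_mul AB trmx0 map_mx0. Qed.

Let PDh v : PD (H v) ^t* = PD (H v). Proof. by case: (PD_proj (H v)). Qed.
Let PNh v : PN (H v) ^t* = PN (H v). Proof. by case: (PN_proj (H v)). Qed.
Let PRh v : PR (H v) ^t* = PR (H v). Proof. by case: (PR_proj (H v)). Qed.
Let PD2 v : PD (H v) *m PD (H v) = PD (H v). Proof. by case: (PD_proj (H v)). Qed.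
Let PR2 v : PR (H v) *m PR (H v) = PR (H v). Proof. by case: (PR_proj (H v)). Qed.
Let PND v : PN (H v) *m PD (H v) = 0. Proof. exact: trmxC_mul0 (PDN_orth _). Qed.
Let PRD v : PR (H v) *m PD (H v) = 0. Proof. exact: trmxC_mul0 (PDR_orth _). Qed.
Let LamR v : Lam (H v) *m PR (H v) = Lam (H v).
Proof. by rewrite -{1}(Lam_range (H v)) -!mulmxA PR2 mulmxA Lam_range. Qed.
Let RLam v : PR (H v) *m Lam (H v) = Lam (H v).
Proof. by rewrite -{1}(Lam_range (H v)) !mulmxA PR2 Lam_range. Qed.
Let DLam v : PD (H v) *m Lam (H v) = 0.
Proof. by rewrite -RLam mulmxA (PDR_orth (H v)) mul0mx. Qed.
Let NLam v : PN (H v) *m Lam (H v) = 0.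
Proof. by rewrite -RLam mulmxA (PNR_orth (H v)) mul0mx. Qed.

Definition domain_mx : 'M[R]_(dim G) := realmx (fun v => 1%:M - PD (H v)).
Definition robin_mx : 'M[R]_(dim G) := realmx (fun v => Lam (H v)).

Lemma domain_mx_idem : domain_mx *m domain_mx = domain_mx.
Proof.
rewrite realmx_mul; apply: matrix_ext => x; rewrite -(unvecK x); apply/realmx_eq => v.
by rewrite mulmxBl mul1mx mulmxBr mulmx1 PD2 subrr subr0.
Qed.

Lemma domain_mx_sym : domain_mx^T = domain_mx.
Proof.
rewrite realmx_adjoint; apply: matrix_ext => x; rewrite -(unvecK x); apply/realmx_eq => v.
by rewrite linearB /= trmx1 map_mxB map_mx1 PDh.
Qed.

Lemma robin_mx_sym : robin_mx^T = robin_mx.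
Proof.
rewrite realmx_adjoint; apply: matrix_ext => x; rewrite -(unvecK x); apply/realmx_eq => v.
by rewrite Lam_herm.
Qed.

Lemma robin_mx_domain : robin_mx *m domain_mx = robin_mx.
Proof.
rewrite realmx_mul; apply: matrix_ext => x; rewrite -(unvecK x); apply/realmx_eq => v.
by rewrite mulmxBl mul1mx DLam subr0.
Qed.

(** For vertex values z and outgoing slopes s, the three vertex conditions
    amount to two real equations: Lam vanishes outside the range of PR, so
    that the conditions on the slopes are the components of one equation
    along the ranges of PN and PR. *)
Definition satisfies z s : Prop :=
  vec z *m domain_mx = vec z /\ vec s *m domain_mx = vec z *m robin_mx.

Lemma domain_mxP z : vec z *m domain_mx = vec z <->
  forall v, PD (H v) *m at_vertex z v = 0.
Proof.
rewrite -{2}(mulmx1 (vec z)) -(realmx1 G) realmx_eq; split=> E v; have := E v.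
  rewrite mulmxBl => /eqP; rewrite subr_eq addrC -subr_eq subrr eq_sym => /eqP.
  by [].
by rewrite mulmxBl => ->; rewrite subr0.
Qed.

Lemma satisfiesP z s : satisfies z s <-> forall v,
  [/\ PD (H v) *m at_vertex z v = 0, PN (H v) *m at_vertex s v = 0 &
      PR (H v) *m at_vertex s v = Lam (H v) *m (PR (H v) *m at_vertex z v)].
Proof.
have E2 := realmx_eq (fun v => 1%:M - PD (H v)) (fun v => Lam (H v)) s z.
split=> [[/domain_mxP z1 /E2 s1] v|E].
  split; first exact: z1.
    have := congr1 (mulmx (PN (H v))) (s1 v).
    by rewrite !mulmxA mulmxBr mulmx1 PND subr0 NLam mul0mx.
  have := congr1 (mulmx (PR (H v))) (s1 v).
  by rewrite !mulmxA mulmxBr mulmx1 PRD subr0 RLam LamR.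
split; first by apply/domain_mxP => v; have [] := E v.
apply/E2 => v; have [_ n r] := E v.
have -> : 1%:M - PD (H v) = PN (H v) + PR (H v).
  by apply/eqP; rewrite -(PDNR_sum (H v)) subr_eq -addrA addrC.
by rewrite mulmxDl n add0r r mulmxA LamR.
Qed.

Lemma robin_form z : \sum_v reC (hdot (Lam (H v) *m (PR (H v) *m at_vertex z v))
    (PR (H v) *m at_vertex z v)) = dot (vec z) (vec z *m robin_mx).
Proof.
rewrite dotC realmxE dot_vec sum_at_vertex; apply: eq_bigr => v _.
by rewrite at_blockwise -{2}(PRh v) -hdot_adjoint !mulmxA RLam LamR.
Qed.

Lemma rot_domain_mx : rotmx G *m domain_mx = domain_mx *m rotmx G.
Proof. exact: rotmx_comm. Qed.

Lemma rot_robin_mx : rotmx G *m robin_mx = robin_mx *m rotmx G.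
Proof. exact: rotmx_comm. Qed.

Lemma real_domain_mx : real_hamiltonian H -> remx G *m domain_mx = domain_mx *m remx G.
Proof.
move=> rH; apply: remx_comm => v i j; have [_ rD _ _] := rH v.
by rewrite !mxE; have := rD i j; case: (PD _ _ _) => a b /= ->; case: (i == j); rewrite /= subr0.
Qed.

Lemma real_robin_mx : real_hamiltonian H -> remx G *m robin_mx = robin_mx *m remx G.
Proof. by move=> rH; apply: remx_comm => v; have [[]] := rH v. Qed.

(** ** Vertex values and slopes of a function given by classical states *)

Definition represents psi U V : Prop := graph_state U V /\
  forall e x, interval (elen e) x -> psi e x = cplx (fun c => U e c x).

Lemma right_slope (f g : R -> R) d r : 0 < r -> der (0 : R) g d ->
  (forall t, 0 <= t <= r -> f t = g t) ->
  lim (t^-1 * (f t - f 0) @[t --> 0^'+]) = d.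
Proof.
move=> r0 dg fg.
have H0 : h^-1 *: (g (h *: 1 + 0) - g 0) @[h --> 0^'] --> d.
  case: dg => dv <-; exact: dv.
apply: cvg_lim => //; apply: cvg_trans (cvg_dnbhs_at_right H0); apply: near_eq_cvg.
near=> t.
have t0 : 0 < t by near: t; exact: nbhs_right_gt.
have tr : t <= r by near: t; apply: nbhs_right_le.
by rewrite !fg ?lexx ?(ltW t0) ?(ltW r0) // /GRing.scale /= mulr1 addr0.
Unshelve. all: by end_near.
Qed.

Lemma along_represented psi U V a : represents psi U V -> exists2 r : R, 0 < r &
  forall t, 0 <= t <= r ->
    along psi a t = cplx (fun c => U (end_edge a) c (end_pos a + end_sign a * t)).
Proof.
move=> [_ E]; case: a => [[f []]|h].
- exists (len f); first exact: len_gt0.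
  move=> t /andP[t0 tL]; rewrite /= mulN1r E //=.
  by rewrite in_itv /= subr_ge0 tL gerBl t0.
- exists (len f); first exact: len_gt0.
  by move=> t tL; rewrite /= mul1r add0r E //= in_itv.
exists 1 => // t /andP[t0 _]; rewrite /= mul1r add0r E //= in_itv /= andbT //.
Qed.

Lemma vvals_represented psi U V v : represents psi U V ->
  vvals psi v = at_vertex (trace U) v.
Proof.
move=> rep; apply/colP => i; rewrite !mxE.
have [r r0 ->] := along_represented (enum_val i) rep; last by rewrite lexx ltW.
by congr cplx; apply/funext => c; rewrite mulr0 addr0.
Qed.

Lemma vderivs_represented psi U V v : represents psi U V ->
  vderivs psi v = at_vertex (outgoing V) v.
Proof.
move=> rep; apply/colP => i; rewrite !mxE; set a := enum_val i.
have [r r0 al] := along_represented a rep.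
pose g c t := U (end_edge a) c (end_pos a + end_sign a * t).
have dg c : der (0 : R) (g c) (outgoing V a c).
  have [d _ _] := rep.1 (end_edge a) c.
  have dU : der (end_pos a + end_sign a * 0) (U (end_edge a) c) (V (end_edge a) c (end_pos a)).
    by rewrite mulr0 addr0; exact: d (end_pos_interval a).
  have da : der (0 : R) (fun t => end_pos a + end_sign a * t) (end_sign a).
    apply: der_eq (derD (der_cst 0 (end_pos a)) (derZ (end_sign a) (der_id 0))) _.
    by rewrite add0r mulr1.
  have := @der_comp _ 0 (U (end_edge a) c) (fun t => end_pos a + end_sign a * t) _ _ dU da.
  by rewrite mulrC.
have sl c : lim (t^-1 * (comp c (along psi a t) - comp c (along psi a 0)) @[t --> 0^'+]) =
    outgoing V a c.
  by apply: (right_slope (f := fun t => comp c (along psi a t)) r0 (dg c)) => t tr;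
     rewrite al // comp_cplx.
by apply: eq_comp => c; rewrite comp_cplx -sl; case: c.
Qed.

Lemma in_dom_represented psi U V : represents psi U V -> graph_H2 psi ->
  (in_dom H psi <-> satisfies (trace U) (outgoing V)).
Proof.
move=> rep h2; rewrite satisfiesP; split=> [[_ E] v|E].
  by have := E v; rewrite (vvals_represented v rep) (vderivs_represented v rep).
by split=> // v; rewrite (vvals_represented v rep) (vderivs_represented v rep).
Qed.

Definition graph_of U : graph_fun G := fun e x => cplx (fun c => U e c x).

Lemma graph_of_represents U V : graph_state U V -> represents (graph_of U) U V.
Proof. by []. Qed.

End VertexConditions.

Section ActionOfStates.
Variables (R : realType) (p om : R) (G : metric_graph R) (H : hamiltonian G).
Hypothesis p_gt1 : 1 < p.
Hypothesis om_gt0 : 0 < om.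
Notation mu := (@lebesgue_measure R).
Notation states := (edge G -> bool -> R -> R).
Implicit Types (U V : states).

Lemma normc_sqr_integral o (f : R -> R[i]) (w : bool -> R -> R) : in_L2 (interval o) f ->
  (forall c, decaying o (w c)) ->
  {ae mu, forall x, interval o x -> f x = cplx (w^~ x)} ->
  \int[mu]_(x in interval o) (Normc.normc (f x) `^ 2) = \int[mu]_(x in interval o) ip (w^~ x) (w^~ x).
Proof.
move=> lf dw fw.
have nE (z : R[i]) : Normc.normc z `^ 2 = comp false z ^+ 2 + comp true z ^+ 2.
  by case: z => a b /=; rewrite powR_mulrn ?sqrtr_ge0 // sqr_sqrtr // addr_ge0 // sqr_ge0.
have [mf _] := (in_L2_comp o f).1 lf.
congr fine; apply: ae_eq_integral; first exact: measurable_interval.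
- apply/measurable_EFinP; under eq_fun do rewrite nE.
  by apply: measurable_funD; apply: measurable_funX; exact: mf.
- apply/measurable_EFinP; exact: decaying_measurable (decaying_ip dw dw).
by apply: ae_mono fw => x fx ox; rewrite fx // nE !comp_cplx /ip !expr2.
Qed.

Lemma action_level_of U V : graph_state U V ->
  action_level H p om (graph_of U) =
    graph_action p om U V + 2^-1 * dot (vec (trace U)) (vec (trace U) *m robin_mx H).
Proof.
move=> UV; have oL := @elen_gt0 R G.
have dU e c : decaying (elen e) (U e c) by have [] := UV e c.
have dV e c : decaying (elen e) (V e c) by have [] := UV e c.
have E1 : Lpow 2 (graph_deriv (graph_of U)) =
    \sum_e \int[mu]_(x in interval (elen e)) ip ((V e)^~ x) ((V e)^~ x).
  apply: eq_bigr => e _; rewrite /graph_deriv edge_domE.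
  have [h1 _ w] := edge_state_wderiv (oL e) (UV e).
  apply: normc_sqr_integral => //; first by have [] := wderivP h1.
have E2 : Lpow 2 (graph_of U) =
    \sum_e \int[mu]_(x in interval (elen e)) ip ((U e)^~ x) ((U e)^~ x).
  apply: eq_bigr => e _; rewrite edge_domE; apply: normc_sqr_integral => //.
    exact: in_L2_decaying.
  by apply: aeW.
have E3 : Lpow (p + 1) (graph_of U) =
    \sum_e \int[mu]_(x in interval (elen e)) pow_term p ((U e)^~ x).
  apply: eq_bigr => e _; rewrite edge_domE; apply: eq_Rintegral => x _.
  by rewrite pow_termE // normc_cplx.
have rep := graph_of_represents UV.
have E4 : \sum_v reC (hdot (Lam (H v) *m (PR (H v) *m vvals (graph_of U) v))
    (PR (H v) *m vvals (graph_of U) v)) = dot (vec (trace U)) (vec (trace U) *m robin_mx H).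
  by rewrite -robin_form; apply: eq_bigr => v _; rewrite (vvals_represented v rep).
rewrite /action_level /energy /quad_form E1 E2 E3 E4.
have -> : graph_action p om U V =
   \sum_e (2^-1 * (\int[mu]_(x in interval (elen e)) ip ((V e)^~ x) ((V e)^~ x)) +
    om / 2 * (\int[mu]_(x in interval (elen e)) ip ((U e)^~ x) ((U e)^~ x)) +
    (p + 1)^-1 * (\int[mu]_(x in interval (elen e)) pow_term p ((U e)^~ x))).
  apply: eq_bigr => e _; have duu := decaying_ip (dU e) (dU e); have dvv := decaying_ip (dV e) (dV e).
  have dp := decaying_pow_term p_gt1 (UV e).
  rewrite /edge_action /density integralD_decaying; last exact: decayingZ; last first.
    exact: decaying_quadratic_density (UV e).
  rewrite integralD_decaying; [|exact: decayingZ|exact: decayingZ].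
  by rewrite !integralZ_decaying.
rewrite !big_split /= -!mulr_sumr; ring.
Qed.

(** The two equations of a critical point z are the vertex conditions of the
    solution with vertex values z, because the flux is the opposite of its
    outgoing slopes. *)
Lemma critical_solves z : critical (fun x => min_action p_gt1 om_gt0 (unvec x))
    (fun x => - vec (slope p_gt1 om_gt0 (unvec x))) (domain_mx H) (robin_mx H) (vec z) ->
  let u := graph_of (solU p_gt1 om_gt0 z) in
  [/\ in_form_dom H u, solves H p om u & action_level H p om u < 0].
Proof.
move=> [zP gP neg] u.
have st := sol_state p_gt1 om_gt0 z.
have rep := graph_of_represents st.
have E := sol_edge p_gt1 om_gt0 z.
have oL := @elen_gt0 R G.
pose W e c x := om * solU p_gt1 om_gt0 z e c x + radial (pow_profile p) ((solU p_gt1 om_gt0 z e)^~ x) c.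
have vw e : edge_state (elen e) (solV p_gt1 om_gt0 z e) (W e).
  move=> c; have [d du dv] := st e c; split=> //; first by have [_] := E e; apply.
  apply: decayingD; first exact: decayingZ.
  by apply: decaying_profile => // c'; have [] := st e c'.
have h2 : graph_H2 u.
  move=> e; rewrite edge_domE; have [_ c _] := edge_state_wderiv (oL e) (st e).
  by have [h _] := edge_state_wderiv2 (oL e) (st e) (vw e).
have sat : satisfies H (trace (solU p_gt1 om_gt0 z)) (outgoing (solV p_gt1 om_gt0 z)).
  rewrite /satisfies (sol_trace p_gt1 om_gt0 z); split=> //.
  move: gP; rewrite /reduced_grad vecK mulmxDl -mulmxA robin_mx_domain mulNmx => /eqP.
  by rewrite addrC subr_eq0 => /eqP <-.
have dom : in_dom H u by apply/(in_dom_represented H rep h2).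
split.
- split; first by move=> e; have [[]] := h2 e.
  by case: dom => _ D v; have [] := D v.
- split=> // e; rewrite edge_domE.
  have [_ w] := edge_state_wderiv2 (oL e) (st e) (vw e).
  apply: ae_mono w => x Hx ox; rewrite /ham_op /graph_deriv edge_domE Hx // /u /graph_of normc_cplx.
  by apply: eq_comp => -[]; rewrite /= /W /radial /pow_profile /=; ring.
rewrite (action_level_of st) (sol_trace p_gt1 om_gt0 z).
by move: neg; rewrite /reduced_action vecK.
Qed.

End ActionOfStates.

(** * Negative directions spanned by eigenfunctions *)

Section Pairing.
Variables (R : realType) (G : metric_graph R).
Notation mu := (@lebesgue_measure R).
Notation states := (edge G -> bool -> R -> R).
Implicit Types (U V W Z : states) (e : edge G).

Definition decaying_states U : Prop := forall e c, decaying (elen e) (U e c).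

Definition pairing U W : R :=
  \sum_e \int[mu]_(x in interval (elen e)) ip ((U e)^~ x) ((W e)^~ x).

Lemma pairingC U W : pairing U W = pairing W U.
Proof.
apply: eq_bigr => e _; apply: eq_Rintegral => x _; rewrite /ip.
by rewrite mulrC [X in _ + X]mulrC.
Qed.

Lemma pairing_linear k U V W : decaying_states U -> decaying_states V ->
  decaying_states W ->
  pairing (fun e c x => k * U e c x + V e c x) W = k * pairing U W + pairing V W.
Proof.
move=> dU dV dW; rewrite mulr_sumr -big_split; apply: eq_bigr => e _ /=.
have d1 := decaying_ip (dU e) (dW e); have d2 := decaying_ip (dV e) (dW e).
rewrite -integralZ_decaying // -integralD_decaying //; last exact: decayingZ.
by apply: eq_Rintegral => x _; rewrite /ip; ring.
Qed.

Definition combo m (b : 'I_m -> R) (U : 'I_m -> states) : states :=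
  fun e c x => \sum_i b i * U i e c x.

Lemma decaying_sum (I : Type) (r : seq I) (b : I -> R) (U : I -> states) :
  (forall i, decaying_states (U i)) ->
  decaying_states (fun e c x => \sum_(i <- r) b i * U i e c x).
Proof.
move=> dU e c; elim: r => [|i r IH].
  by apply: eq_decaying (decaying0 _) => x; rewrite big_nil.
apply: eq_decaying (decayingD (decayingZ (b i) (dU i e c)) IH) => x.
by rewrite big_cons.
Qed.

Lemma pairing_combo m (b : 'I_m -> R) (U : 'I_m -> states) W :
  (forall i, decaying_states (U i)) -> decaying_states W ->
  pairing (combo b U) W = \sum_i b i * pairing (U i) W.
Proof.
move=> dU dW; rewrite /combo.
elim: (index_enum _) => [|i r IH].
  rewrite big_nil; apply: big1 => e _.
  rewrite -[RHS](_ : \int[mu]_(x in interval (elen e)) 0 = 0).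
    by apply: eq_Rintegral => x _; rewrite /ip !big_nil !mul0r addr0.
  by rewrite /Rintegral integral0.
rewrite big_cons -IH -pairing_linear //; last exact: decaying_sum.
by apply: eq_bigr => e _; apply: eq_Rintegral => x _; rewrite /ip !big_cons.
Qed.

Lemma pairing_ge0 U : 0 <= pairing U U.
Proof. by apply: sumr_ge0 => e _; apply: Rintegral_ge0 => x _; exact: ip_ge0. Qed.

(** The integrand is continuous and nonnegative. *)
Lemma pairing_eq0 U : decaying_states U -> pairing U U <= 0 ->
  forall e c x, interval (elen e) x -> U e c x = 0.
Proof.
move=> dU U0 e c x ox.
pose f x := ip ((U e)^~ x) ((U e)^~ x).
have df : decaying (elen e) f := decaying_ip (dU e) (dU e).
have i0 e' : 0 <= \int[mu]_(x in interval (elen e')) ip ((U e')^~ x) ((U e')^~ x).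
  by apply: Rintegral_ge0 => y _; exact: ip_ge0.
have I0 : \int[mu]_(x in interval (elen e)) f x = 0.
  apply/eqP; rewrite eq_le i0 andbT; apply: le_trans U0.
  by rewrite /pairing (bigD1 e) //= lerDl sumr_ge0.
have /integrableP[mf fin] := decaying_integrable df.
have E : (\int[mu]_(x in interval (elen e)) `|(f x)%:E| = 0)%E.
  rewrite -[LHS]fineK; last by rewrite ge0_fin_numE // integral_ge0.
  congr (_%:E); apply: etrans I0; congr fine; apply: eq_integral => y _.
  by rewrite /= ger0_norm // ip_ge0.
have f0 y : interval (elen e) y -> f y = 0.
  apply: (@continuous_ae_eq _ _ f (fun=> 0) (elen_gt0 e)).
  - by apply: within_interval_continuous; case: df.
  - by apply: within_interval_continuous => z _; exact: cst_continuous.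
  - have [/(_ E) H _] := ae_eq_integral_abs mu (measurable_interval (elen e)) mf.
    have {}H : {ae mu, forall z, interval (elen e) z -> (f z)%:E = 0%E} by exact: H.
    by apply: ae_mono H => z Hz oz; have [] := Hz oz.
by apply: (@ip_zero R ((U e)^~ x)); rewrite -/(f x) f0.
Qed.

End Pairing.

Section Eigenfamily.
Variables (R : realType) (p om : R) (G : metric_graph R) (H : hamiltonian G).
Hypothesis p_gt1 : 1 < p.
Hypothesis om_gt0 : 0 < om.
Notation mu := (@lebesgue_measure R).
Notation states := (edge G -> bool -> R -> R).
Implicit Types (U V W Z : states) (e : edge G).
Notation P0 := (domain_mx H).
Notation L0 := (robin_mx H).

Definition eigenstate (l : R) U V : Prop := [/\ graph_state U V,
  satisfies H (trace U) (outgoing V) &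
  forall e c x, interval (elen e) x -> der x (V e c) (- l * U e c x)].

Lemma state_decaying U V : graph_state U V -> decaying_states U /\ decaying_states V.
Proof. by move=> UV; split=> e c; have [] := UV e c. Qed.

(** Integration by parts on each edge; the boundary terms only involve the
    slopes of the first state, which its vertex conditions express by its
    vertex values as soon as the second state satisfies the Dirichlet
    conditions. *)
Lemma green l U V W Z : eigenstate l U V -> graph_state W Z ->
  vec (trace W) *m P0 = vec (trace W) ->
  pairing V Z + dot (vec (trace U) *m L0) (vec (trace W)) = l * pairing U W.
Proof.
move=> [UV [_ <-] dV] WZ WP.
have [decU decV] := state_decaying UV; have [decW decZ] := state_decaying WZ.
have -> : dot (vec (outgoing V) *m P0) (vec (trace W)) =
    - \sum_e boundary (elen e) (fun x => ip ((V e)^~ x) ((W e)^~ x)).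
  rewrite dot_mulmx domain_mx_sym WP dot_vec sum_boundary opprK; apply: eq_bigr => a _.
  by rewrite /ip /outgoing /trace; ring.
apply/eqP; rewrite -subr_eq0 addrAC subr_eq0; apply/eqP.
rewrite /pairing mulr_sumr -sumrB; apply: eq_bigr => e _.
have dVZ := decaying_ip (decV e) (decZ e); have dUW := decaying_ip (decU e) (decW e).
have <- : \int[mu]_(x in interval (elen e))
   (ip ((V e)^~ x) ((Z e)^~ x) + - l * ip ((U e)^~ x) ((W e)^~ x)) =
   boundary (elen e) (fun x => ip ((V e)^~ x) ((W e)^~ x)).
  apply: integral_derivative.
  - exact: elen_gt0.
  - move=> x ox; have dW c : der x (W e c) (Z e c x) by have [d _ _] := WZ e c; exact: d.
    have d c := derM (dV e c x ox) (dW c).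
    by apply: der_eq (derD (d false) (d true)) _; rewrite /ip; ring.
  - by apply: decayingD => //; exact: decayingZ.
  - exact: decaying_ip.
rewrite integralD_decaying //; last exact: decayingZ.
by rewrite integralZ_decaying // mulNr.
Qed.

Section Family.
Variables (m : nat) (U V : 'I_m -> states) (l : 'I_m -> R) (l0 : R).
Hypothesis UV : forall i, eigenstate (l i) (U i) (V i).
Hypothesis l_le : forall i, l i <= l0.
Hypothesis l0_lt : l0 + om < 0.
Implicit Types b : 'I_m -> R.

Let dU i : decaying_states (U i).
Proof. by have [/state_decaying[]] := UV i. Qed.
Let dV i : decaying_states (V i).
Proof. by have [/state_decaying[]] := UV i. Qed.

Definition trace_mx : 'M[R]_(m, dim G) := \matrix_(i, j) vec (trace (U i)) 0 j.

Lemma combo_state b : graph_state (combo b U) (combo b V).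
Proof.
move=> e c; split; [|exact: decaying_sum|exact: decaying_sum].
move=> x ox; rewrite /combo; elim: (index_enum _) => [|i r IH].
  rewrite big_nil (_ : (fun x => _) = fun=> 0); first exact: der_cst.
  by apply/funext => y; rewrite big_nil.
rewrite big_cons (_ : (fun x => _) = fun y => b i * U i e c y + \sum_(j <- r) b j * U j e c y).
  by apply: derD IH; apply: derZ; have [st _ _] := UV i; have [d _ _] := st e c; exact: d.
by apply/funext => y; rewrite big_cons.
Qed.

Lemma combo_trace (x : 'rV[R]_m) : vec (trace (combo (fun i => x 0 i) U)) = x *m trace_mx.
Proof.
apply/rowP => j; rewrite !mxE; apply: eq_bigr => i _.
by rewrite !mxE.
Qed.

Lemma row_trace_mx i : row i trace_mx = vec (trace (U i)).
Proof. by apply/rowP => j; rewrite !mxE. Qed.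

Lemma trace_mx_domain : trace_mx *m P0 = trace_mx.
Proof.
apply/row_matrixP => i; have [_ [uP _] _] := UV i.
by rewrite row_mul row_trace_mx.
Qed.

Let comboP b : vec (trace (combo b U)) *m P0 = vec (trace (combo b U)).
Proof.
have -> : b = (fun i => (\row_i b i) 0 i) by apply/funext => i; rewrite mxE.
by rewrite combo_trace -mulmxA trace_mx_domain.
Qed.

(** Green's formula in both orders. *)
Lemma eigen_orthogonal i j : l i * pairing (U i) (U j) = l j * pairing (U i) (U j).
Proof.
have [si [_ _] _] := UV i; have [sj [_ _] _] := UV j.
have tP k : vec (trace (U k)) *m P0 = vec (trace (U k)) by have [_ []] := UV k.
rewrite -(green (UV i) sj (tP j)) [in RHS]pairingC -(green (UV j) si (tP i)) pairingC.
by rewrite dot_mulmx robin_mx_sym dotC.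
Qed.

(** With d_i = l0 - l_i >= 0, orthogonality turns the double sum of the
    d_i b_i b_j <U_i, U_j> into the square norm of the combination with
    coefficients sqrt (d_i) b_i. *)
Lemma combo_form_le b X : X = combo b U ->
  pairing (combo b V) (combo b V) + dot (vec (trace X)) (vec (trace X) *m L0)
  <= l0 * pairing X X.
Proof.
move=> -> {X}; set X := combo b U; have st : graph_state X (combo b V) := combo_state b.
have [decX decY] := state_decaying st.
pose d i := Num.sqrt (l0 - l i).
have d2 i : d i * d i = l0 - l i by rewrite -expr2 sqr_sqrtr // subr_ge0.
have Gi i := green (UV i) st (comboP b).
have E1 : pairing (combo b V) (combo b V) + dot (vec (trace X)) (vec (trace X) *m L0) =
    \sum_i b i * (l i * pairing (U i) X).
  rewrite (pairing_combo _ dV decY).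
  have -> : dot (vec (trace X)) (vec (trace X) *m L0) =
      \sum_i b i * dot (vec (trace (U i)) *m L0) (vec (trace X)).
    rewrite -{1}robin_mx_sym -dot_mulmx.
    have trE : vec (trace X) = \sum_i b i *: vec (trace (U i)).
      by apply/rowP => j; rewrite summxE mxE; apply: eq_bigr => i _; rewrite !mxE.
    rewrite {1}trE mulmx_suml.
    elim: (index_enum _) => [|i r IH]; first by rewrite !big_nil dot0l.
    by rewrite !big_cons dotDl IH -scalemxAl dotZl.
  by rewrite -big_split; apply: eq_bigr => i _; rewrite /= -mulrDr Gi.
have E2 : pairing X X = \sum_i b i * pairing (U i) X by rewrite pairing_combo.
have E3 c : pairing (U c) X = \sum_j b j * pairing (U c) (U j).
  by rewrite pairingC pairing_combo //; apply: eq_bigr => j _; rewrite pairingC.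
rewrite E1 E2 -subr_ge0 mulr_sumr -sumrB.
have := pairing_ge0 (combo (fun i => d i * b i) U).
congr (0 <= _); rewrite pairing_combo //; last exact: decaying_sum.
apply: eq_bigr => i _; rewrite pairingC pairing_combo // E3.
rewrite !mulr_sumr -sumrB; apply: eq_bigr => j _; rewrite (pairingC (U j)).
have := eigen_orthogonal i j; set M := pairing (U i) (U j).
have [->|M0] := eqVneq M 0; first by move=> _; ring.
move=> /(mulIf M0) lij.
have dij : d j = d i by rewrite /d lij.
by rewrite dij; transitivity (d i * d i * (b i * b j * M)); [ring|rewrite d2; ring].
Qed.

(** The quadratic part of the action is at most (l0 + om) / 2 times the
    square norm, and for small coefficients the nonlinear term is smaller
    than half of this. *)
Lemma small_combo_action : exists2 eps, 0 < eps & forall b, (forall i, `|b i| <= eps) ->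
  forall X, X = combo b U ->
  graph_action p om X (combo b V) + 2^-1 * dot (vec (trace X)) (vec (trace X) *m L0)
  <= (l0 + om) / 4 * pairing X X.
Proof.
have /choice[B BP] i : exists B, 0 <= B /\ forall e c x, interval (elen e) x -> `|U i e c x| <= B.
  have /choice[D DP] (q : edge G * bool) : exists B, 0 <= B /\
      forall x, interval (elen q.1) x -> `|U i q.1 q.2 x| <= B.
    by have [B B0 h] := decaying_bounded (dU i q.1 q.2); exists B.
  exists (\sum_q D q); split; first by apply: sumr_ge0 => q _; have [] := DP q.
  move=> e c x ox; apply: le_trans ((DP (e, c)).2 x ox) _.
  by rewrite (bigD1 (e, c)) //= lerDl sumr_ge0 // => q _; have [] := DP q.
pose S := \sum_i B i.
have S0 : 0 <= S by apply: sumr_ge0 => i _; have [] := BP i.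
pose eta := - (l0 + om).
have eta0 : 0 < eta by rewrite oppr_gt0.
have p1 : 0 < p - 1 by rewrite subr_gt0.
have pp : 0 < p + 1 by rewrite addr_gt0 // (lt_trans _ p_gt1).
pose q := eta * (p + 1) / 4.
have q0 : 0 < q by rewrite divr_gt0 // mulr_gt0.
pose de := q `^ (p - 1)^-1.
have de0 : 0 < de by exact: powR_gt0.
have deq : pow_profile p de = q.
  by rewrite /pow_profile /de -powRrM mulVf ?powRr1 ?lt0r_neq0 // ltW.
have S2 : 0 < 2 * S + 1 by rewrite ltr_wpDl // mulr_ge0.
exists (de / (2 * S + 1)); first by rewrite divr_gt0.
move=> b bs _ ->; set X := combo b U; have st : graph_state X (combo b V) := combo_state b.
have [decX decY] := state_decaying st.
have Xde e x : interval (elen e) x -> nm ((X e)^~ x) <= de.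
  move=> ox; have Xc c : `|X e c x| <= de / (2 * S + 1) * S.
    rewrite /X /combo; apply: le_trans (ler_norm_sum _ _ _) _; rewrite mulr_sumr.
    apply: ler_sum => i _; rewrite normrM ler_pM //.
    by have [_] := BP i; apply.
  rewrite nm_leP ?ltW // /ip -!expr2.
  have D0 : 0 <= de / (2 * S + 1) * S by rewrite mulr_ge0 // divr_ge0 // ltW.
  have sq c : X e c x ^+ 2 <= (de / (2 * S + 1) * S) ^+ 2.
    by rewrite -[leLHS]real_normK ?num_real // ler_sqr ?nnegrE.
  have D1 : 2 * (de / (2 * S + 1) * S) <= de.
    rewrite (_ : 2 * _ = de * (2 * S) / (2 * S + 1)); last by ring.
    by rewrite ler_pdivrMr // ler_wpM2l ?(ltW de0) // lerDl.
  have := sq false; have := sq true; rewrite !expr2; nra.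
have powX e : \int[mu]_(x in interval (elen e)) pow_term p ((X e)^~ x) <=
    q * \int[mu]_(x in interval (elen e)) ip ((X e)^~ x) ((X e)^~ x).
  have dXX := decaying_ip (decX e) (decX e).
  rewrite -integralZ_decaying //; apply: le_integral_decaying.
  - exact: decaying_pow_term (st e).
  - exact: decayingZ.
  - move=> x ox; rewrite /pow_term ler_wpM2r ?ip_ge0 // -deq.
    by apply: pow_profile_mono => //; [exact: nm_ge0|exact: Xde].
have actE : graph_action p om X (combo b V) <=
    2^-1 * pairing (combo b V) (combo b V) + (om / 2 + eta / 4) * pairing X X.
  rewrite /pairing !mulr_sumr -big_split; apply: ler_sum => e _ /=.
  have duu := decaying_ip (decX e) (decX e); have dvv := decaying_ip (decY e) (decY e).
  have dp := decaying_pow_term p_gt1 (st e).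
  rewrite /edge_action /density integralD_decaying; last exact: decayingZ; last first.
    exact: decaying_quadratic_density (st e).
  rewrite integralD_decaying; [|exact: decayingZ|exact: decayingZ].
  rewrite !integralZ_decaying // mulrDl addrA lerD2l ler_pdivrMl //.
  apply: le_trans (powX e) _; rewrite le_eqVlt; apply/orP; left; apply/eqP.
  by rewrite /q; ring.
have F := combo_form_le (erefl X); have := pairing_ge0 X => X0.
apply: le_trans (lerD actE (lexx _)) _; rewrite /eta in actE *.
nra.
Qed.

(** The action is nonnegative, while it would be negative on a small multiple
    of a combination that does not vanish but has zero vertex values. *)
Lemma combo_zero (b : 'rV[R]_m) : b *m trace_mx = 0 ->
  forall e c x, interval (elen e) x -> combo (fun i => b 0 i) U e c x = 0.
Proof.
move=> bA; have [eps e0 small] := small_combo_action.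
pose t := eps / (1 + `|b|).
have b1 : 0 < 1 + `|b| by rewrite ltr_pwDl.
have t0 : 0 < t by rewrite divr_gt0.
have tb i : `|(t *: b) 0 i| <= eps.
  rewrite mxE normrM gtr0_norm // /t mulrAC ler_pdivrMr // ler_wpM2l ?(ltW e0) //.
  by apply: le_trans (coord_le_norm b i) _; rewrite lerDr.
have := small (fun i => (t *: b) 0 i) tb _ erefl; rewrite combo_trace -scalemxAl bA scaler0 mul0mx.
rewrite dot0l mulr0 addr0; set X := combo _ U => Xle.
have st : graph_state X (combo (fun i => (t *: b) 0 i) V) by exact: combo_state.
have act0 : 0 <= graph_action p om X (combo (fun i => (t *: b) 0 i) V).
  exact: graph_action_ge0.
have X0 : pairing X X <= 0.
  have k0 : (l0 + om) / 4 < 0 by have := l0_lt; lra.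
  by have := le_trans act0 Xle; rewrite (nmulr_rge0 _ k0).
move=> e c x ox; have [dX _] := state_decaying st.
have := pairing_eq0 dX X0 c ox.
have -> : X e c x = t * combo (fun i => b 0 i) U e c x.
  by rewrite /X /combo mulr_sumr; apply: eq_bigr => i _; rewrite mxE mulrA.
by move=> /eqP; rewrite mulf_eq0 gt_eqF //= => /eqP.
Qed.

End Family.

End Eigenfamily.

(** * Independence of the eigenfunctions *)

Section Eigenbasis.
Variables (R : realType) (G : metric_graph R) (H : hamiltonian G).
Notation mu := (@lebesgue_measure R).
Notation states := (edge G -> bool -> R -> R).
Implicit Types (U V : states) (e : edge G).

Definition rot_state U : states := fun e c x => if c then U e false x else - U e true x.
Definition re_state U : states := fun e c x => if c then 0 else U e false x.

Lemma vec_trace_rot U : vec (trace (rot_state U)) = vec (trace U) *m rotmx G.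
Proof. by rewrite vec_rot. Qed.

Lemma vec_outgoing_rot V : vec (outgoing (rot_state V)) = vec (outgoing V) *m rotmx G.
Proof.
rewrite vec_rot; congr vec; apply/funext => a; apply/funext => -[] //.
by rewrite /outgoing /rot_state mulrN.
Qed.

Lemma vec_trace_re U : vec (trace (re_state U)) = vec (trace U) *m remx G.
Proof. by rewrite remxE; congr vec; apply/funext => a; apply/funext => -[]. Qed.

Lemma vec_outgoing_re V : vec (outgoing (re_state V)) = vec (outgoing V) *m remx G.
Proof.
rewrite remxE; congr vec; apply/funext => a; apply/funext => -[] //.
by rewrite /outgoing /re_state mulr0.
Qed.

Lemma graph_state_rot U V : graph_state U V -> graph_state (rot_state U) (rot_state V).
Proof.
move=> UV e [] /=; first by have [] := UV e false.
have [dt dt1 dt2] := UV e true; split; [|exact: decayingN|exact: decayingN].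
by move=> x ox; apply: derN; exact: dt.
Qed.

Lemma eigenstate_rot l U V : eigenstate H l U V -> eigenstate H l (rot_state U) (rot_state V).
Proof.
move=> [UV [tU oV] dV]; split.
- exact: graph_state_rot.
- rewrite /satisfies vec_trace_rot vec_outgoing_rot -!mulmxA rot_domain_mx rot_robin_mx.
  by rewrite !mulmxA tU oV.
- move=> e [] x ox; rewrite /rot_state; first exact: dV.
  by apply: der_eq (derN (dV e true x ox)) _; ring.
Qed.

Lemma eigenstate_re l U V : real_hamiltonian H ->
  eigenstate H l U V -> eigenstate H l (re_state U) (re_state V).
Proof.
move=> rH [UV [tU oV] dV]; split.
- move=> e [] /=; last by have [] := UV e false.
  by split=> [x _||]; [exact: der_cst|exact: decaying0|exact: decaying0].
- rewrite /satisfies vec_trace_re vec_outgoing_re -!mulmxA (real_domain_mx rH) (real_robin_mx rH).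
  by rewrite !mulmxA tU oV.
- move=> e [] x ox; rewrite /re_state; last exact: dV.
  by apply: der_eq (der_cst x 0) _; rewrite mulr0.
Qed.

Lemma eigen_represented l psi : l < 0 -> ham_eigenspace H l psi ->
  exists UV : states * states, eigenstate H l UV.1 UV.2 /\ represents psi UV.1 UV.2.
Proof.
move=> l0 [dom eq].
have ex e : exists uv : (bool -> R -> R) * (bool -> R -> R), [/\ edge_state (elen e) uv.1 uv.2,
    forall c x, interval (elen e) x -> der x (uv.2 c) (- l * uv.1 c x) &
    forall x, interval (elen e) x -> psi e x = cplx (uv.1^~ x)].
  have [h2 c] := dom.1 e; have := eq e; rewrite /ham_op /graph_deriv !edge_domE in h2 c *.
  move=> q; have [u [v [uv dv E]]] := eigen_classical (elen_gt0 e) l0 h2 c q.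
  by exists (u, v).
have [W WP] := choice ex.
have rep : represents psi (fun e => (W e).1) (fun e => (W e).2).
  by split=> e; have [] := WP e.
exists (fun e => (W e).1, fun e => (W e).2); split=> //; split; first by case: rep.
  by apply/(in_dom_represented H rep dom.1).
by move=> e; have [_ d _] := WP e.
Qed.

Variables (K : nat) (lam : 'I_K -> R).
Hypothesis lamP : negative_eigenvalues H lam.

Let level l : {set 'I_K} := [set i | lam i == l]%SET.

Lemma eigenbasis_levels : exists phi : forall l : R, 'I_#|level l| -> graph_fun G,
  forall l, l < 0 -> (forall j, ham_eigenspace H l (phi l j)) /\
    forall c, eq_on_graph (lin_comb c (phi l)) (fun _ _ => 0) -> forall j, c j = 0.
Proof.
have ex (l : R) : exists phi : 'I_#|level l| -> graph_fun G, l < 0 ->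
    (forall j, ham_eigenspace H l (phi j)) /\
    forall c, eq_on_graph (lin_comb c phi) (fun _ _ => 0) -> forall j, c j = 0.
  have [l0|] := ltP l 0; last by exists (fun _ _ _ => 0).
  by have [_ _ /(_ l l0)[phi [e i _]]] := lamP; exists phi.
exists (fun l => projT1 (cid (ex l))) => l; exact: (projT2 (cid (ex l))).
Qed.

Definition double (U : 'I_K -> states) (j : 'I_(K + K)) : states :=
  match fintype.split j with inl i => U i | inr i => rot_state (U i) end.

Definition double_level (j : 'I_(K + K)) : R :=
  match fintype.split j with inl i => lam i | inr i => lam i end.

Lemma double_eigenstate (U V : 'I_K -> states) :
  (forall i, eigenstate H (lam i) (U i) (V i)) ->
  forall j, eigenstate H (double_level j) (double U j) (double V j).
Proof.
move=> UV j; rewrite /double_level /double; case: (fintype.split j) => i //.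
exact: eigenstate_rot.
Qed.

(** In a vanishing combination the parts belonging to different eigenvalues
    are orthogonal, so that each of them vanishes. *)
Lemma eigenbasis : exists U V : 'I_K -> states,
  (forall i, eigenstate H (lam i) (U i) (V i)) /\
  forall b : 'I_(K + K) -> R,
    (forall e c x, interval (elen e) x -> combo b (double U) e c x = 0) -> forall j, b j = 0.
Proof.
have [phi phiP] := eigenbasis_levels.
have lam0 i : lam i < 0 by case: lamP.
have self i : i \in level (lam i) by rewrite inE.
pose rk i := enum_rank_in (self i) i.
have /choice[UV UVP] i : exists UV : states * states,
    eigenstate H (lam i) UV.1 UV.2 /\ represents (phi (lam i) (rk i)) UV.1 UV.2.
  by apply: eigen_represented => //; have [] := phiP _ (lam0 i).
pose U i := (UV i).1; pose V i := (UV i).2.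
exists U, V; split; first by move=> i; have [] := UVP i.
have dbl := double_eigenstate (fun i => (UVP i).1 : eigenstate H (lam i) (U i) (V i)).
have dU j : decaying_states (double U j) by have [/state_decaying[]] := dbl j.
move=> b b0.
have key l : forall e c x, interval (elen e) x ->
    combo (fun j => if double_level j == l then b j else 0) (double U) e c x = 0.
  set bl := fun j => _.
  have st : decaying_states (combo bl (double U)) by exact: decaying_sum.
  apply: (pairing_eq0 st); rewrite le_eqVlt; apply/orP; left; apply/eqP.
  have X0 : pairing (combo b (double U)) (combo bl (double U)) = 0.
    apply: big1 => e _; rewrite (_ : \int[mu]_(x in _) _ = \int[mu]_(x in interval (elen e)) 0).
      by rewrite /Rintegral integral0.
    by apply: eq_Rintegral => x; rewrite inE => ox; rewrite /ip !b0 // !mul0r addr0.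
  rewrite -[RHS]X0 !pairing_combo //; apply: eq_bigr => i _.
  rewrite pairingC !pairing_combo // !mulr_sumr; apply: eq_bigr => j _.
  rewrite /bl; case: ifP => [_|/negbT il] //; case: ifP => [/eqP jl|_]; last by rewrite !mul0r !mulr0.
  have := eigen_orthogonal dbl j i.
  rewrite jl => /eqP; rewrite -subr_eq0 -mulrBl mulf_eq0 subr_eq0 eq_sym (negbTE il) /= => /eqP ->.
  by rewrite !mulr0.
pose c i : R[i] := b (lshift K i) +i* b (rshift K i).
suff c0 i : c i = 0.
  by move=> j; rewrite -(splitK j); case: (fintype.split j) => i /=; have [] := c0 i.
pose l := lam i.
have [_ ind] := phiP l (lam0 i).
have rkE i' (q : 'I_#|level l|) : enum_val q = i' -> phi l q = phi (lam i') (rk i').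
  move=> qi; have li : lam i' = l by have := enum_valP q; rewrite qi inE => /eqP.
  move: q qi; rewrite -li => q qi; congr (phi _ _); apply: enum_val_inj.
  by rewrite qi enum_rankK_in.
have := ind (fun q => c (enum_val q)).
suff E : eq_on_graph (lin_comb (fun q => c (enum_val q)) (phi l)) (fun _ _ => 0).
  by move=> /(_ E (rk i)); rewrite enum_rankK_in.
move=> e x; rewrite edge_domE => ox; rewrite /lin_comb.
transitivity (\sum_(i' in level l) c i' * cplx (fun d => U i' e d x)).
  rewrite [RHS]big_enum_val; apply: eq_bigr => q _; congr (_ * _).
  by rewrite (rkE _ q erefl); have [_ [_ ->]] := UVP (enum_val q).
apply: eq_comp => d; rewrite (big_morph (comp d) (id1 := 0) (op1 := +%R)); last 2 first.
- by case: d => -[? ?] [? ?].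
- by case: d.
have -> : comp d (0 : R[i]) = 0 by case: d.
apply: etrans (key l e d x ox); rewrite /combo big_split_ord /= -big_split /= big_mkcond /=.
apply: eq_bigr => i' _; rewrite /double_level /double.
rewrite -/(unsplit (inl i')) -/(unsplit (inr i')) !unsplitK inE.
by case: eqP => _; rewrite ?mul0r ?addr0 //; case: d; rewrite /= /rot_state /=; ring.
Qed.

End Eigenbasis.

(** * Orbits of solutions *)

Section Orbits.
Variables (R : realType) (p om : R) (G : metric_graph R) (H : hamiltonian G).
Hypothesis p_gt1 : 1 < p.
Hypothesis om_gt0 : 0 < om.
Notation states := (edge G -> bool -> R -> R).
Notation X := 'rV[R]_(dim G).
Notation P0 := (domain_mx H).
Notation L0 := (robin_mx H).
Notation rot := (rotmx G).
Notation solU := (@solU R p om G p_gt1 om_gt0).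
Notation solV := (@solV R p om G p_gt1 om_gt0).
Notation slope := (@slope R p om G p_gt1 om_gt0).
Implicit Types (x y z : X) (U V : states).

Definition vertex_action x : R := min_action p_gt1 om_gt0 (unvec x).
Definition vertex_flux x : X := - vec (slope (unvec x)).
Notation J := (reduced_action vertex_action L0).
Notation crit P := (critical vertex_action vertex_flux P L0).

Lemma vertex_action_le x U V : graph_state U V ->
  vertex_action x + dot (vertex_flux x) (vec (trace U) - x) <= graph_action p om U V.
Proof.
move=> UV; apply: le_trans (min_action_le p_gt1 om_gt0 (unvec x) UV).
have -> : vec (trace U) - x = vec (fun a c => -1 * unvec x a c + trace U a c).
  by rewrite vec_linear unvecK scaleN1r addrC.
rewrite lerD2l dotNl dot_vec lerN2.
rewrite le_eqVlt; apply/orP; left; apply/eqP; apply: eq_bigr => a _; rewrite /ip; ring.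
Qed.

Lemma vertex_action_grad x y :
  vertex_action y <= vertex_action x + dot (vertex_flux y) (y - x).
Proof.
have := vertex_action_le y (sol_state p_gt1 om_gt0 (unvec x)).
rewrite sol_trace unvecK -[graph_action _ _ _ _]/(vertex_action x) => h.
by rewrite -(opprB x y) dotNr -lerBlDr opprK.
Qed.

Lemma vertex_action_coercive K : 0 <= K ->
  exists C, forall x, K * dot x x <= vertex_action x + C.
Proof.
move=> K0; have [C HC] := min_action_coercive G p_gt1 om_gt0 K0.
by exists C => x; have := HC (unvec x); rewrite -dot_vec unvecK.
Qed.

Lemma vertex_flux_cont : continuous vertex_flux.
Proof.
apply: continuous_coordP => i.
have -> : (fun x => vertex_flux x 0 i) =
    (fun x => 0 - slope (unvec x) (enum_val i).1 (enum_val i).2).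
  by apply/funext => x; rewrite !mxE sub0r.
apply: continuousB_fun; first by move=> x; exact: cst_continuous.
apply: continuous_slope => a c; apply: (@continuous_coord _ _ _ (fun x : X => x)).
by move=> x; exact: id.
Qed.

Lemma unvecN x : unvec (- x) = fun a c => - unvec x a c.
Proof. by apply/funext => a; apply/funext => c; rewrite /unvec mxE. Qed.

Lemma vertex_flux_odd x : vertex_flux (- x) = - vertex_flux x.
Proof. by apply/rowP => i; rewrite !mxE unvecN slope_odd. Qed.

Lemma vertex_action_ge0 x : 0 <= vertex_action x.
Proof. exact: graph_action_ge0. Qed.

Lemma critical_neq0 P z : crit P z -> 0 < dot z z.
Proof.
move=> [_ _ neg]; rewrite lt_neqAle dot_ge0 andbT eq_sym dot_eq0.
apply: contraTneq neg => ->; rewrite /reduced_action mul0mx dot0l mulr0 addr0 -leNgt.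
exact: vertex_action_ge0.
Qed.

(** ** Invariance under rotations *)

Definition rotation (t : R) x : X := cos t *: x + sin t *: (x *m rot).
Definition rotated x z : Prop := exists t, x = rotation t z.

Lemma dot_rot x : dot (x *m rot) x = 0.
Proof.
have : dot (x *m rot) x = - dot (x *m rot) x.
  by rewrite {1}dot_mulmx rotmx_adjoint mulmxN dotNr dotC.
by lra.
Qed.

Lemma dot_rot2 x y : dot (x *m rot) (y *m rot) = dot x y.
Proof.
by rewrite dot_mulmx rotmx_adjoint mulmxN -mulmxA rotmx2 mulmxN mulmx1 opprK.
Qed.

Lemma rotationK t x : rotation (- t) (rotation t x) = x.
Proof.
rewrite /rotation cosN sinN mulmxDl -!scalemxAl -mulmxA rotmx2 mulmxN mulmx1.
have c := cos2Dsin2 t; apply/rowP => i; rewrite !mxE.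
set a := x 0 i; set b := (\sum_j _).
by rewrite -[RHS]mul1r -c; ring.
Qed.

(** The rotated solution has the same action, and competes with the minimiser
    for the rotated vertex values. *)
Lemma vertex_action_rotation_le t x : vertex_action (rotation t x) <= vertex_action x.
Proof.
pose rt (W : states) : states := fun e c s => cos t * W e c s + sin t * rot_state W e c s.
pose U := solU (unvec x); pose V := solV (unvec x).
have UV : graph_state U V := sol_state p_gt1 om_gt0 (unvec x).
have RUV := graph_state_rot UV.
have st : graph_state (rt U) (rt V).
  move=> e c; have [d d1 d2] := UV e c; have [r r1 r2] := RUV e c; split.
  - by move=> y oy; apply: derD; apply: derZ; [exact: d|exact: r].
  - by apply: decayingD; exact: decayingZ.
  - by apply: decayingD; exact: decayingZ.
have trE : vec (trace (rt U)) = rotation t x.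
  have vU : vec (trace U) = x by rewrite /U sol_trace unvecK.
  by rewrite /rotation -[in RHS]vU -vec_trace_rot; apply/rowP => i; rewrite !mxE.
have iprt (W : states) e (y : R) : ip ((rt W e)^~ y) ((rt W e)^~ y) = ip ((W e)^~ y) ((W e)^~ y).
  rewrite /ip /rt /rot_state /= -[RHS]mul1r -(cos2Dsin2 t); ring.
have := min_action_trace_le p_gt1 om_gt0 st.
rewrite -[trace (rt U)]vecK trE => h; apply: le_trans h _; rewrite le_eqVlt; apply/orP; left; apply/eqP.
apply: eq_bigr => e _; apply: eq_Rintegral => y _.
by rewrite /density /quadratic_density (iprt U) (iprt V) /pow_term /nm (iprt U).
Qed.

Lemma reduced_action_rotation t x : J (rotation t x) = J x.
Proof.
have E1 : vertex_action (rotation t x) = vertex_action x.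
  have le1 := vertex_action_rotation_le t x.
  have := vertex_action_rotation_le (- t) (rotation t x); rewrite rotationK => le2.
  by apply: le_anti; apply/andP; split; [exact: le1|exact: le2].
have rL : rotation t x *m L0 = rotation t (x *m L0).
  by rewrite /rotation mulmxDl -!scalemxAl -!mulmxA rot_robin_mx.
have E2 : dot (rotation t x) (rotation t x *m L0) = dot x (x *m L0).
  rewrite rL /rotation !(dotDl, dotDr, dotZl, dotZr) dot_rot2.
  have sk y w : dot (y *m rot) w = - dot y (w *m rot).
    by rewrite dot_mulmx rotmx_adjoint mulmxN dotNr.
  by rewrite sk -[RHS]mul1r -(cos2Dsin2 t); ring.
by rewrite /reduced_action E1 E2.
Qed.

Definition orbit_detector z x : 'rV[R]_2 :=
  \row_j (if j == 0 then dot x z else dot x (z *m rot)).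

(** On the orbit of z the two coordinates are |z|^2 cos t and |z|^2 sin t. *)
Lemma orbit_detectorP P z x : crit P z -> rotated x z -> orbit_detector z x != 0.
Proof.
move=> cz [t ->]; have z0 := critical_neq0 cz; apply/eqP => /rowP D.
have := D 0; have := D 1; rewrite !mxE /= /rotation !(dotDl, dotZl) dot_rot2 dot_rot dotC dot_rot.
rewrite !mulr0 addr0 add0r => /eqP; rewrite mulf_eq0 (gt_eqF z0) orbF => /eqP st.
move=> /eqP; rewrite mulf_eq0 (gt_eqF z0) orbF => /eqP ct.
by have := cos2Dsin2 t; rewrite st ct !expr0n /= addr0 => /eqP; rewrite eq_sym oner_eq0.
Qed.

Lemma real_rot z : z *m remx G = z -> z *m rot *m remx G = 0.
Proof.
rewrite -(unvecK z) => /remx_fixed z0; rewrite vec_rot remxE; apply/rowP => i.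
by rewrite !mxE; case: (enum_val i).2; rewrite ?z0 ?oppr0.
Qed.

(** Two real points of the same orbit differ by a sign, so that a single
    coordinate detects the orbit. *)
Lemma real_detectorP P z x : crit P z -> crit P x ->
  z *m remx G = z -> x *m remx G = x -> rotated x z -> dot x z != 0.
Proof.
move=> cz cx zr xr [t xE]; have z0 := critical_neq0 cz; have x0 := critical_neq0 cx.
rewrite xE /rotation dotDl !dotZl dot_rot mulr0 addr0 mulf_eq0 (gt_eqF z0) orbF.
apply: contraTneq x0 => ct; rewrite -xr xE /rotation ct scale0r add0r -scalemxAl real_rot //.
by rewrite scaler0 dot0l ltxx.
Qed.

(** ** Existence *)

Section Family.
Variables (P : 'M[R]_(dim G)) (m : nat) (U V : 'I_m -> states) (l : 'I_m -> R) (l0 : R).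
Hypothesis P_sym : P^T = P.
Hypothesis P_idem : P *m P = P.
Hypothesis UV : forall i, eigenstate H (l i) (U i) (V i).
Hypothesis l_le : forall i, l i <= l0.
Hypothesis l0_lt : l0 + om < 0.
Hypothesis free : row_free (trace_mx U).
Hypothesis trP : trace_mx U *m P = trace_mx U.

(** The minimal action for the vertex values of a combination of
    eigenfunctions is at most the action of this combination. *)
Lemma trace_sphere_negative (b : 'rV[R]_m) eps : b != 0 ->
  (forall b, (forall i, `|b i| <= eps) -> forall X, X = combo b U ->
    graph_action p om X (combo b V) + 2^-1 * dot (vec (trace X)) (vec (trace X) *m L0)
    <= (l0 + om) / 4 * pairing X X) ->
  (forall i, `|b 0 i| <= eps) -> J (b *m trace_mx U) < 0.
Proof.
move=> b0 small be; have Hb := small (fun i => b 0 i) be _ erefl.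
have st := combo_state UV (fun i => b 0 i).
have [dX _] := state_decaying st.
rewrite /= combo_trace in Hb.
have Xgt0 : 0 < pairing (combo (fun i => b 0 i) U) (combo (fun i => b 0 i) U).
  rewrite ltNge; apply/negP => X0; move/eqP: b0; apply.
  have Xz := pairing_eq0 dX X0.
  apply: (row_free_inj free); rewrite mul0mx -combo_trace; apply/rowP => i; rewrite !mxE.
  by rewrite /trace Xz //; exact: end_pos_interval.
have := min_action_trace_le p_gt1 om_gt0 st.
rewrite -[trace (combo _ _)]vecK combo_trace => h.
have k0 : (l0 + om) / 4 < 0 by have := l0_lt; lra.
apply: le_lt_trans (lerD h (lexx _)) (le_lt_trans Hb _).
by rewrite nmulr_rlt0.
Qed.

(** The sphere of a space of combinations of m eigenfunctions is mapped to
    vertex values of negative action, as required to count critical points. *)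
Lemma critical_points (d k : nat) :
  (forall z, crit P z -> exists phi : X -> 'rV[R]_d, [/\ continuous phi,
     forall x, phi (- x) = - phi x &
     forall x, crit P x -> rotated x z -> phi x != 0]) ->
  (d * k < m)%N ->
  exists zs : 'I_k.+1 -> X, (forall i, crit P (zs i)) /\
    forall i j : 'I_k.+1, (i < j)%N -> ~ rotated (zs j) (zs i).
Proof.
move=> det.
have [eps eps0 small] := small_combo_action p_gt1 UV l_le l0_lt.
have neg (b : 'rV[R]_m) : b != 0 -> (forall i, `|b 0 i| <= eps) -> J (b *m trace_mx U) < 0.
  by move=> b0; exact: trace_sphere_negative.
move: (trace_mx U) trP neg; clear small; case: m => // r A AP neg dk.
pose h (b : 'rV[R]_r.+1) := (eps *: b) *m A.
have hP b : h b *m P = h b by rewrite /h -mulmxA AP.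
have ch : continuous h.
  apply: continuous_mulmx; apply: continuous_coordP => i.
  have -> : (fun b : 'rV[R]_r.+1 => (eps *: b) 0 i) = (fun b => eps * b 0 i).
    by apply/funext => b; rewrite mxE.
  apply: continuousM_fun; first by move=> b; exact: cst_continuous.
  by apply: continuous_coord => b; exact: id.
have negh b : r.+1%:R^-1 <= `|b| <= 1 -> J (h b) < 0.
  move=> /andP[b1 b2]; apply: neg => [|i].
    rewrite scaler_eq0 gt_eqF //= -normr_gt0; apply: lt_le_trans b1.
    by rewrite invr_gt0 ltr0n.
  rewrite mxE normrM gtr0_norm // ler_piMr ?(ltW eps0) //.
  exact: le_trans (coord_le_norm b i) b2.
have cJ : continuous (J \o h).
  have -> : J \o h = full_action vertex_action P L0 \o h.
    by apply/funext => b /=; rewrite full_action_constrained.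
  move=> b; apply: continuous_comp; first exact: ch.
  exact: (continuous_full_action vertex_action_grad vertex_flux_cont P_sym P_idem (robin_mx_sym H)).
have [a a0 Ha] : exists2 a, a < 0 & forall b, r.+1%:R^-1 <= `|b| <= 1 -> J (h b) <= a.
  have [A0|A0] := pselect ([set b : 'rV[R]_r.+1 | r.+1%:R^-1 <= `|b| <= 1] !=set0); last first.
    by exists (-1) => [|b bs]; [exact: ltrN10|case: A0; exists b].
  have [b bA bmax] := EVT_max_rV A0 (shell_compact (n := r)) (continuous_subspaceT cJ).
  exists (J (h b)); first by apply: negh; move: bA; rewrite inE.
  by move=> b' b's; apply: bmax; rewrite inE.
apply: (many_critical vertex_action_grad vertex_action_coercive vertex_flux_cont
  vertex_flux_odd P_sym P_idem (robin_mx_sym H) (d := d) (h := h) (a := a)) => //.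
- move=> z cz; have [phi [cphi phiN phi0]] := det z cz; exists phi; split=> // x cx xz.
  by split; [case: xz => t ->; exact: reduced_action_rotation|exact: phi0].
- by move=> b; rewrite /h scalerN mulNmx.
Qed.

End Family.

Lemma orbit_rotation t z w :
  eq_on_graph (graph_of (solU (unvec z)))
    (fun e s => (cos t +i* sin t) * graph_of (solU (unvec w)) e s) -> z = rotation t w.
Proof.
move=> E; rewrite /rotation -(unvecK w) vec_rot.
have vD (f g : edge_end G -> bool -> R) : vec f + vec g = vec (fun a c => f a c + g a c).
  by apply/rowP => i; rewrite !mxE.
have vZ k (f : edge_end G -> bool -> R) : k *: vec f = vec (fun a c => k * f a c).
  by apply/rowP => i; rewrite !mxE.
rewrite !vZ vD -[LHS]unvecK; congr vec; apply/funext => a; apply/funext => c.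
have T y : graph_of (solU (unvec y)) (end_edge a) (end_pos a) = cplx (unvec y a).
  by rewrite -[in RHS](sol_trace p_gt1 om_gt0 (unvec y)).
have := E (end_edge a) (end_pos a); rewrite edge_domE => /(_ (end_pos_interval a)).
rewrite (T z) (T w) => /(congr1 (comp c)); rewrite comp_cplx => ->.
by case: c => /=; ring.
Qed.

Lemma orbits_distinct k (zs : 'I_k -> X) :
  (forall i j : 'I_k, (i < j)%N -> ~ rotated (zs j) (zs i)) ->
  let u i := graph_of (solU (unvec (zs i))) in
  injective (fun i => S1_orbit (u i)) /\ injective (fun i => pm_pair (u i)).
Proof.
move=> ne u.
have H1 i j : S1_orbit (u i) = S1_orbit (u j) -> rotated (zs i) (zs j).
  move=> e; have : S1_orbit (u j) (u i).
    rewrite -e; exists 0; first by rewrite lexx mulr_gt0 ?pi_gt0.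
    by move=> e' x _; rewrite cos0 sin0 -[LHS]mul1r.
  by move=> [t _ /orbit_rotation ->]; exists t.
have H2 i j : pm_pair (u i) = pm_pair (u j) -> rotated (zs i) (zs j).
  move=> e; have : pm_pair (u j) (u i) by rewrite -e; left.
  move=> [E|E]; [exists 0|exists pi]; apply: orbit_rotation => e' x xe; apply: etrans (E e' x xe) _.
    by rewrite cos0 sin0 -[LHS]mul1r.
  by rewrite cospi sinpi -[in LHS]mulN1r; congr (_ * _); apply: eq_comp => -[]; rewrite /= ?oppr0.
have inj (f : 'I_k -> set (graph_fun G)) :
    (forall i j, f i = f j -> rotated (zs i) (zs j)) -> injective f.
  move=> fr i j fij; apply: val_inj => /=; case: (ltngtP i j) => // ij.
    by case: (ne _ _ ij); exact: fr.
  by case: (ne _ _ ij); exact: fr.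
by split; apply: inj.
Qed.

Lemma critical_solution x : crit P0 x -> let u := graph_of (solU (unvec x)) in
  [/\ in_form_dom H u, solves H p om u & action_level H p om u < 0].
Proof. by rewrite -{1}(unvecK x); exact: critical_solves. Qed.

(** Real vertex values have a real solution and real slopes, and the matrices
    of the vertex conditions preserve reality: a critical point in the space
    of real vertex values is a critical point. *)
Lemma real_critical x : real_hamiltonian H -> crit (remx G *m P0) x ->
  [/\ crit P0 x, x *m remx G = x & real_valued (graph_of (solU (unvec x)))].
Proof.
move=> rH [xP gP neg]; have rP := real_domain_mx rH.
have xr : x *m remx G = x by rewrite -{1}xP rP -!mulmxA remx_idem -rP xP.
have xD : x *m P0 = x by rewrite -{1}xP -!mulmxA domain_mx_idem xP.
have x0 : forall a, unvec x a true = 0.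
  by apply/(remx_fixed (unvec x)); rewrite unvecK.
have [s0 f0] := sol_real p_gt1 om_gt0 x0.
split=> //; last by move=> e y; rewrite edge_domE => /s0.
split=> //; rewrite -gP mulmxA; congr (_ *m _).
rewrite /reduced_grad mulmxDl -mulmxA -(real_robin_mx rH) mulmxA xr; congr (_ + _).
by rewrite /vertex_flux mulNmx; congr (- _); apply/esym/remx_fixed.
Qed.

End Orbits.

(** A row x is Re x - i Re (i x), and the rows i x are combinations of the
    rows: the real parts of the rows, taken twice, span all the rows. *)
Lemma rank_real_part (R : realType) (G : metric_graph R) m (A : 'M[R]_(m, dim G)) :
  (A *m rotmx G <= A)%MS -> (\rank A <= (\rank (A *m remx G)).*2)%N.
Proof.
move=> AJ.
have E : 1%:M = remx G - rotmx G *m remx G *m rotmx G.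
  apply: matrix_ext => x; rewrite -(unvecK x) mulmxBr mulmx1 !mulmxA vec_rot !remxE vec_rot.
  by apply/rowP => i; rewrite !mxE; case: (enum_val i) => a [] /=; ring.
rewrite -{1}[A]mulmx1 E mulmxBr -addnn; apply: leq_trans (mxrank_add _ _) _.
rewrite leq_add2l mxrank_opp !mulmxA; apply: leq_trans (mxrankM_maxl _ _) _.
by apply: mxrankS; exact: submxMr.
Qed.

Lemma double_trace_rot (R : realType) (G : metric_graph R) K
    (U : 'I_K -> edge G -> bool -> R -> R) :
  (trace_mx (double U) *m rotmx G <= trace_mx (double U))%MS.
Proof.
have H i : (vec (trace (U i)) <= trace_mx (double U))%MS /\
    (vec (trace (U i)) *m rotmx G <= trace_mx (double U))%MS.
  have := row_sub (lshift K i) (trace_mx (double U)).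
  have := row_sub (rshift K i) (trace_mx (double U)).
  rewrite !row_trace_mx /double -/(unsplit (inl i)) -/(unsplit (inr i)) !unsplitK.
  by rewrite vec_trace_rot.
apply/row_subP => j; rewrite row_mul row_trace_mx /double.
case: (fintype.split j) => i; first by case: (H i).
by rewrite vec_trace_rot -mulmxA rotmx2 mulmxN mulmx1 eqmx_opp; case: (H i).
Qed.

Theorem theorem1p4 (R : realType) (p : R) (G : metric_graph R)
    (H : hamiltonian G) (k : nat) (lam : 'I_k.+1 -> R) (omega : R)
    (p_gt1 : 1 < p)
    (G_connected : connected_graph G) (G_noncompact : noncompact_graph G)
    (lamP : negative_eigenvalues H lam)
    (omega_gt0 : 0 < omega) (omega_lt : omega < - lam ord_max) :
  (exists u : 'I_k.+1 -> graph_fun G,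
     injective (fun i => S1_orbit (u i)) /\
     forall i, [/\ in_form_dom H (u i), solves H p omega (u i) &
                   action_level H p omega (u i) < 0]) /\
  (real_hamiltonian H ->
   exists u : 'I_k.+1 -> graph_fun G,
     [/\ injective (fun i => S1_orbit (u i)),
         injective (fun i => pm_pair (u i)) &
         forall i, [/\ real_valued (u i), in_form_dom H (u i),
                       solves H p omega (u i) & action_level H p omega (u i) < 0]]).

Proof.
have l0_lt : lam ord_max + omega < 0 by rewrite addrC -ltrBrDr sub0r.
have l_le i : lam i <= lam ord_max by have [mono _ _] := lamP; apply: mono; exact: leq_ord.
have [U [V [UV indep]]] := eigenbasis lamP.
have dbl := double_eigenstate UV.
have dbl_le j : double_level lam j <= lam ord_max.
  by rewrite /double_level; case: (fintype.split j).
pose A := trace_mx (double U).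
have A_free : row_free A.
  apply: inj_row_free => b bA; apply/rowP => j; rewrite mxE.
  exact: indep (combo_zero p_gt1 omega_gt0 dbl dbl_le l0_lt bA) j.
have solutions k' (zs : 'I_k' -> 'rV[R]_(dim G)) i :
    critical (vertex_action p_gt1 omega_gt0) (vertex_flux p_gt1 omega_gt0)
      (domain_mx H) (robin_mx H) (zs i) ->
    [/\ in_form_dom H (graph_of (solU p_gt1 omega_gt0 (unvec (zs i)))),
        solves H p omega (graph_of (solU p_gt1 omega_gt0 (unvec (zs i)))) &
        action_level H p omega (graph_of (solU p_gt1 omega_gt0 (unvec (zs i)))) < 0].
  exact: critical_solution.
split.
  have [|| zs [cz ne]] := critical_points (p_gt1 := p_gt1) (om_gt0 := omega_gt0) (domain_mx_sym H)
      (domain_mx_idem H) dbl dbl_le l0_lt A_free (trace_mx_domain dbl) (d := 2) (k := k).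
  - move=> z cz; exists (orbit_detector z); split.
    + apply: continuous_coordP => j.
      have c w : continuous (fun x : 'rV[R]_(dim G) => dot x w).
        by apply: continuous_dot => x; [exact: id|exact: cst_continuous].
      case: (eqVneq j 0) => [->|j0].
        by under eq_fun do rewrite mxE /=; exact: c.
      by under eq_fun do rewrite mxE (negbTE j0); exact: c.
    + by move=> x; apply/rowP => j; rewrite !mxE; case: ifP; rewrite dotNl.
    + by move=> x _; exact: (orbit_detectorP cz).
  - lia.
  have [inj _] := orbits_distinct p_gt1 omega_gt0 ne.
  exists (fun i => graph_of (solU p_gt1 omega_gt0 (unvec (zs i)))); split=> // i.
  exact: solutions.
move=> rH.
have re_states j := eigenstate_re rH (dbl j).
have re_mx : trace_mx (fun j => re_state (double U j)) = A *m remx G.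
  by apply/row_matrixP => i; rewrite row_mul !row_trace_mx vec_trace_re.
(* Unlike the family itself, the real parts need not be independent. *)
pose f := maxrankfun (trace_mx (fun j => re_state (double U j))).
pose W (i : 'I_(\rank (trace_mx (fun j => re_state (double U j))))) := re_state (double U (f i)).
have W_mx : trace_mx W = rowsub f (trace_mx (fun j => re_state (double U j))).
  by apply/row_matrixP => i; rewrite row_rowsub !row_trace_mx.
have W_free : row_free (trace_mx W) by rewrite W_mx maxrowsub_free.
have W_eigen i := re_states (f i).
have k_lt : (1 * k < \rank (trace_mx (fun j => re_state (double U j))))%N.
  have rA : \rank A = (k.+1 + k.+1)%N := eqP A_free.
  have : (\rank A <= (\rank (A *m remx G)).*2)%N := rank_real_part (double_trace_rot U).
  by rewrite rA re_mx; move: (\rank _) => r; lia.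
pose P := remx G *m domain_mx H.
have rP := real_domain_mx rH.
have P_sym : P^T = P by rewrite /P trmx_mul domain_mx_sym remx_sym rP.
have P_idem : P *m P = P.
  by rewrite /P mulmxA -(mulmxA _ _ (remx G)) -rP !mulmxA remx_idem -!mulmxA domain_mx_idem.
have W_P : trace_mx W *m P = trace_mx W.
  rewrite /P mulmxA; have <- : trace_mx W = trace_mx W *m remx G.
    apply/row_matrixP => i; rewrite row_mul row_trace_mx /W vec_trace_re.
    by rewrite -mulmxA remx_idem.
  exact: (trace_mx_domain W_eigen).
have [|| zs [cz ne]] := critical_points (p_gt1 := p_gt1) (om_gt0 := omega_gt0) P_sym P_idem
    W_eigen (fun i => dbl_le (f i)) l0_lt W_free W_P (d := 1) (k := k).
- move=> z cz; exists (fun x => \row_(_ < 1) dot x z); split.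
  + apply: continuous_coordP => j; under eq_fun do rewrite mxE.
    by apply: continuous_dot => x; [exact: id|exact: cst_continuous].
  + by move=> x; apply/rowP => j; rewrite !mxE dotNl.
  + move=> x cx xz; have [_ zr _] := real_critical rH cz; have [_ xr _] := real_critical rH cx.
    have := real_detectorP cz cx zr xr xz.
    by apply: contraNneq => /rowP/(_ 0); rewrite !mxE => ->.
- exact: k_lt.
have [inj1 inj2] := orbits_distinct p_gt1 omega_gt0 ne.
exists (fun i => graph_of (solU p_gt1 omega_gt0 (unvec (zs i)))); split=> // i.
have [cr _ re] := real_critical rH (cz i).
by have [? ? ?] := solutions _ zs i cr; split.
Qed.
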